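(* Let $f\in L^2(\mathbb R_t\times\mathbb R^n_x;H^1(\mathbb R^n_v))$ be such that $(\partial_t+v\cdot\nabla_x)f=\nabla_v\cdot S$ in the sense of distributions for some $S\in L^2(\mathbb R^{1+2n};\mathbb R^n)$. Then, with $\kappa=1+\frac1{2n}$, $$\|f\|_{L^{2\kappa}(\mathbb R^{1+2n})}\le C\big(\|\nabla_vf\|_{L^2(\mathbb R^{1+2n})}+\|S\|_{L^2(\mathbb R^{1+2n})}\big)$$ for a constant $C=C(n)>0$.
   Context: Variables $(t,x,v)\in\mathbb R\times\mathbb R^n\times\mathbb R^n$; $\nabla_v$ is the gradient in $v$. *)

(* Defs.v *)
From HB Require Import structures.
From mathcomp Require Import all_boot all_order all_algebra.
From mathcomp Require Import all_classical all_reals all_analysis.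
Set Implicit Arguments. Unset Strict Implicit. Unset Printing Implicit Defensive.
Import Order.TTheory GRing.Theory Num.Theory.
Import numFieldNormedType.Exports.
Local Open Scope classical_set_scope.
Local Open Scope ring_scope.

Definition hbox (R : realType) (N : nat) (a b : 'rV[R]_N) : set 'rV[R]_N :=
  [set x | forall i, a ord0 i < x ord0 i <= b ord0 i].

Definition boxes (R : realType) (N : nat) : set (set 'rV[R]_N) :=
  [set B | exists a b, B = hbox a b].

(* R^N with its Borel sigma-algebra (generated by the boxes) *)
Definition Rspace (R : realType) (N : nat) := g_sigma_algebraType (@boxes R N).

(* mu is the Lebesgue measure on R^N: the (unique) measure on the Borel
   sets giving each box its volume. *)
Definition is_lebesgue (R : realType) (N : nat)
    (mu : {measure set (Rspace R N) -> \bar R}) : Prop :=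
  forall a b : 'rV[R]_N, (forall i, a ord0 i <= b ord0 i) ->
    mu (hbox a b) = (\prod_i (b ord0 i - a ord0 i))%:E.

Definition pd (R : realType) (N : nat) (i : 'I_N) (g : 'rV[R]_N -> R)
  : 'rV[R]_N -> R := fun x => 'D_(delta_mx ord0 i) g x.

Fixpoint pds (R : realType) (N : nat) (s : seq 'I_N) (g : 'rV[R]_N -> R)
  : 'rV[R]_N -> R :=
  match s with
  | [::] => g
  | i :: s' => pd i (pds s' g)
  end.

Definition smooth (R : realType) (N : nat) (g : 'rV[R]_N -> R) : Prop :=
  forall s : seq 'I_N, continuous (pds s g) /\
    forall i x, derivable (pds s g) x (delta_mx ord0 i).

Definition test_fun (R : realType) (N : nat) (g : 'rV[R]_N -> R) : Prop :=
  smooth g /\ exists r : R, forall x, r < `|x| -> g x = 0.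

Definition euclid (R : realType) (T : Type) (n : nat) (G : 'I_n -> T -> R)
  : T -> R := fun x => Num.sqrt (\sum_i (G i x) ^+ 2).

Definition tidx (n : nat) : 'I_(1 + n + n) := lshift n (lshift n ord0).
Definition xidx (n : nat) (i : 'I_n) : 'I_(1 + n + n) := lshift n (rshift 1 i).
Definition vidx (n : nat) (i : 'I_n) : 'I_(1 + n + n) := rshift (1 + n) i.

Local Open Scope ereal_scope.

Definition L2 (R : realType) (N : nat) (mu : {measure set (Rspace R N) -> \bar R})
  (f : Rspace R N -> R) : Prop :=
  measurable_fun [set: Rspace R N] f /\ Lnorm mu 2%:E (EFin \o f) < +oo.

Definition weak_pd (R : realType) (N : nat) (mu : {measure set (Rspace R N) -> \bar R})
  (i : 'I_N) (f g : Rspace R N -> R) : Prop :=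
  forall phi : 'rV[R]_N -> R, test_fun phi ->
    \int[mu]_x (f x * pd i phi x)%:E = - \int[mu]_x (g x * phi x)%:E.

Definition kinetic_eq (R : realType) (n : nat)
  (mu : {measure set (Rspace R (1 + n + n)) -> \bar R})
  (f : Rspace R (1 + n + n) -> R) (S : 'I_n -> Rspace R (1 + n + n) -> R) : Prop :=
  forall phi : 'rV[R]_(1 + n + n) -> R, test_fun phi ->
    \int[mu]_z (f z * (pd (tidx n) phi z
                       + \sum_i z ord0 (vidx i) * pd (xidx i) phi z)%R)%:E
    = \int[mu]_z (\sum_i S i z * pd (vidx i) phi z)%R%:E.

(* Main.v *)
(* Write Y = d_t + v . d_x, so that d_x = [d_v, Y], and let J_s f be the average of
   f against a smooth product mollifier of scale s, rescaled according to kinetic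
   dilations (weights 2, 3, 1 in t, x, v) and centred by kinetic translations. The
   difference of the mollifiers at scales s and 2 s is a sum of derivatives along
   t, x and v; rewriting these with d_v and Y alone and integrating by parts gives
   |J_s f - J_2s f| <= C s avg_s F with F = |grad_v f| + |S|. Since s avg_s F is at
   most C N s^(-2n), where N is the L^2 norm of F, the telescoped averages from
   scale s to infinity are also at most C N s^(-2n). For the scales below
   s = 1/M only the part of F above N M^(2n+1) is not absorbed in this bound;
   integrating its contribution yields, as J_s f tends to f locally in mean,
     |{ |f| > C N M^(2n) }| <= C N^(-1) M^(-2n-1) int_{F > N M^(2n+1)} F.
   Summing over dyadic M with weights M^(4n+2) = (M^(2n))^(2 kappa) bounds the
   L^(2 kappa) norm of f by N. *)
Require Import Defs.
From HB Require Import structures.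
From mathcomp Require Import all_boot all_order all_algebra.
From mathcomp Require Import all_classical all_reals all_analysis.
From mathcomp Require Import measurable_realfun.
From mathcomp Require Import ring lra zify.
Set Implicit Arguments. Unset Strict Implicit. Unset Printing Implicit Defensive.
Import Order.TTheory GRing.Theory Num.Theory.
Import numFieldNormedType.Exports.
Local Open Scope classical_set_scope.
Local Open Scope ring_scope.

(** * Smooth functions of one variable *)

(** Since $\partial_x$ is a commutator of $\partial_v$ and $Y$, its weight is $1+2=3$, and the
    homogeneous dimension is $2+3n+n=4n+2$. Half of it is the power lost when an $L^2$ function is
    averaged at scale $s$; the factor $s$ gained by integrating by parts leaves $s^{-2n}$, and
    $2\kappa=(4n+2)/(2n)$ is the quotient of the two exponents. The exponent is an endpoint.
    Estimating the tail of $F$ by Chebyshev's inequality would give $|\{|f|>CNM^{2n}\}|\le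
    CM^{-4n-2}$, a weak type bound whose weighted dyadic sum diverges. The tail
    $\int_{F>NM^{2n+1}}F$ is therefore kept until $M$ is summed; the sum is then geometric at each
    point and produces $\int F^2$. Only test functions are ever differentiated. They are products in
    rescaled coordinates, so derivatives and multiplications by coordinates act on single factors.
    Their frame depends on the centre $z_0$, so the two variables of the kernel do not play the same
    role, and both marginals of the kernel have to be bounded. Averages converge to $f$ only in mean
    over cubes, so neither a maximal function nor Lebesgue points enter. *)

Fixpoint differentiable_upto (R : realType) (k : nat) (h : R -> R) : Prop :=
  if k is k'.+1 then (forall x, derivable h x 1) /\ differentiable_upto k' (derive1 h)
  else True.

Definition smooth1 (R : realType) (h : R -> R) := forall k, differentiable_upto k h.

Lemma differentiable_uptoS (R : realType) k (h : R -> R) :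
  differentiable_upto k.+1 h -> differentiable_upto k h.
Proof.
elim: k h => [//|k IH] h [dh h']; split => //; exact: IH.
Qed.

Lemma smooth1_derivable (R : realType) (h : R -> R) x :
  smooth1 h -> derivable h x 1.
Proof. by move=> /(_ 1%N) []. Qed.

Lemma smooth1_derive (R : realType) (h : R -> R) :
  smooth1 h -> smooth1 (derive1 h).
Proof. by move=> sh k; case: (sh k.+1). Qed.

Lemma differentiable_upto_cst (R : realType) (c : R) k :
  differentiable_upto k (fun=> c).
Proof.
elim: k c => [//|k IH] c; split; first by move=> x; exact: derivable_cst.
rewrite (_ : derive1 (fun=> c) = fun=> 0); first exact: IH.
by apply/funext => x; rewrite derive1_cst.
Qed.

Lemma differentiable_uptoD (R : realType) k (f g : R -> R) :
  differentiable_upto k f -> differentiable_upto k g ->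
  differentiable_upto k (f + g).
Proof.
elim: k f g => [//|k IH] f g [df f'] [dg g']; split.
  by move=> x; exact: derivableD.
rewrite (_ : derive1 (f + g) = derive1 f + derive1 g); first exact: IH.
by apply/funext => x; rewrite derive1E deriveD// !fctE !derive1E.
Qed.

Lemma differentiable_uptoM (R : realType) k (f g : R -> R) :
  differentiable_upto k f -> differentiable_upto k g ->
  differentiable_upto k (f * g).
Proof.
elim: k f g => [//|k IH] f g Ff Fg.
have [df f'] := Ff; have [dg g'] := Fg; split.
  by move=> x; exact: derivableM.
rewrite (_ : derive1 (f * g) = f * derive1 g + g * derive1 f); last first.
  apply/funext => x; rewrite derive1E.
  have -> := deriveM (df x) (dg x).
  by rewrite !fctE [derive1 f x]derive1E [derive1 g x]derive1E.
by apply: differentiable_uptoD; apply: IH => //; exact: differentiable_uptoS.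
Qed.

Lemma smooth1_cst (R : realType) (c : R) : smooth1 (fun=> c).
Proof. by move=> k; exact: differentiable_upto_cst. Qed.

Lemma smooth1_id (R : realType) : smooth1 (fun x : R => x).
Proof.
case=> [//|k]; split; first by move=> x; exact: derivable_id.
rewrite (_ : derive1 _ = fun=> (1:R)); first exact: smooth1_cst.
by apply/funext => x; rewrite derive1E derive_id.
Qed.

Lemma smooth1D (R : realType) (f g : R -> R) :
  smooth1 f -> smooth1 g -> smooth1 (fun x => f x + g x).
Proof. by move=> sf sg k; exact: differentiable_uptoD. Qed.

Lemma smooth1M (R : realType) (f g : R -> R) :
  smooth1 f -> smooth1 g -> smooth1 (fun x => f x * g x).
Proof. by move=> sf sg k; exact: differentiable_uptoM. Qed.

(** The induction on the order closes because $(1/g)'=-g'\cdot(1/g)\cdot(1/g)$ involves $1/g$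
    itself, to which the hypothesis of one order less applies. *)
Lemma smooth1V (R : realType) (g : R -> R) :
  (forall x, g x != 0) -> smooth1 g -> smooth1 (fun x => (g x)^-1).
Proof.
move=> g0 sg; elim=> [//|k IH]; split.
  by move=> x; apply: derivableV => //; exact: smooth1_derivable.
rewrite (_ : derive1 _ = (fun=> -1) * derive1 g * ((fun x => (g x)^-1) * (fun x => (g x)^-1))).
  apply: differentiable_uptoM; last exact: differentiable_uptoM.
  apply: differentiable_uptoM; first exact: smooth1_cst.
  exact: smooth1_derive.
apply/funext => x; rewrite derive1E deriveV//; last exact: smooth1_derivable.
by rewrite !fctE derive1E /GRing.scale/= -exprVn; ring.
Qed.

Lemma derive1_affine (R : realType) (f : R -> R) (a b x : R) :
  derivable f (a * x + b) 1 ->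
  derivable (fun y => f (a * y + b)) x 1 /\
  derive1 (fun y => f (a * y + b)) x = a * derive1 f (a * x + b).
Proof.
move=> df.
have H : is_derive x (1:R) (a \*: (id : R -> R) + cst b) a.
  by apply: is_derive_eq; rewrite /GRing.scale/= mulr1 addr0.
have dl : derivable (fun y : R => a * y + b) x 1 by case: H.
have dle : derive1 (fun y : R => a * y + b) x = a by rewrite derive1E; case: H.
have Df : is_derive (a * x + b) 1 f (derive1 f (a * x + b)).
  by split; rewrite ?derive1E.
have [? E] := @is_derive1_comp R f (a \*: (id : R -> R) + cst b) x _ _ Df H.
by split => //; rewrite derive1E [LHS]E mulrC.
Qed.

Lemma smooth1_affine (R : realType) (f : R -> R) (a b : R) :
  smooth1 f -> smooth1 (fun y => f (a * y + b)).
Proof.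
move=> sf k; elim: k f sf => [//|k IH] f sf; split.
  by move=> x; apply: (derive1_affine _).1; exact: smooth1_derivable.
rewrite (_ : derive1 _ = (fun=> a) * (fun y => derive1 f (a * y + b))).
  apply: differentiable_uptoM; first exact: smooth1_cst.
  by apply: IH; exact: smooth1_derive.
apply/funext => x; rewrite !fctE (derive1_affine _).2//; exact: smooth1_derivable.
Qed.

(** The function $x^{-m}e^{-1/x}$ extended by 0. Carrying the power [m] makes the family closed
    under differentiation, up to linear combinations, so that smoothness of all members is one
    induction. *)
Definition flat (R : realType) (m : nat) (x : R) : R :=
  if 0 < x then x^-1 ^+ m * expR (- x^-1) else 0.

Lemma flat_ge0 (R : realType) (m : nat) (x : R) : 0 <= flat m x.
Proof.
rewrite /flat; case: ifP => // x0; rewrite mulr_ge0 ?expR_ge0// exprn_ge0//.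
by rewrite invr_ge0 ltW.
Qed.

Lemma flat_gt0 (R : realType) (m : nat) (x : R) : 0 < x -> 0 < flat m x.
Proof. by move=> x0; rewrite /flat x0 mulr_gt0 ?expR_gt0// exprn_gt0// invr_gt0. Qed.

Lemma flat_le0 (R : realType) (m : nat) (x : R) : x <= 0 -> flat m x = 0.
Proof. by move=> x0; rewrite /flat ltNge x0. Qed.

(** One term of the exponential series, $y^{m+2}/(m+2)!\le e^y$ at $y=1/x$. Quadratic decay is what
    yields the derivative 0 at the origin, the only delicate point. *)
Lemma flat_le (R : realType) (m : nat) (x : R) :
  flat m x <= (m.+2)`!%:R * x ^+ 2.
Proof.
have [x0|x0] := ltP 0 x; last by rewrite flat_le0// mulr_ge0// sqr_ge0.
rewrite /flat x0 expRN; set y := x^-1.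
have y0 : 0 < y by rewrite invr_gt0.
have : y ^+ m.+2 <= (m.+2)`!%:R * expR y.
  have := @expR_ge1Dxn R y m.+1 (ltW y0).
  rewrite -(ler_pM2l (_ : 0 < (m.+2)`!%:R)) ?ltr0n ?fact_gt0//.
  apply: le_trans; rewrite mulrDr mulr1 [_ * (_ / _)]mulrC divfK.
    by rewrite lerDr.
  by rewrite pnatr_eq0 -lt0n fact_gt0.
move=> H; have -> : x ^+ 2 = (y ^+ 2)^-1 by rewrite /y exprVn invrK.
rewrite ler_pdivrMr ?expR_gt0// mulrAC ler_pdivlMr ?exprn_gt0//.
by rewrite -exprD addn2.
Qed.

Lemma is_derive_quadratic (R : realType) (f : R -> R) (C : R) :
  (forall x, `|f x| <= C * x ^+ 2) -> is_derive (0:R) (1:R) f 0.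
Proof.
move=> fC.
have f0 : f 0 = 0.
  by apply/eqP; rewrite -normr_le0 (le_trans (fC 0))// expr0n/= mulr0.
have H : (fun h : R => h^-1 *: (f (h *: 1 + 0) - f 0)) @ 0^' --> (0:R).
  rewrite f0.
  have C0 : 0 <= C by have := fC 1; rewrite expr1n mulr1; apply: le_trans.
  apply/cvgr0Pnorm_le => e e0; near=> h.
  rewrite subr0 addr0 /GRing.scale/= mulr1 normrM normrV; last first.
    by rewrite unitfE; near: h; exact: nbhs_dnbhs_neq.
  have h0 : 0 < `|h| by rewrite normr_gt0; near: h; exact: nbhs_dnbhs_neq.
  rewrite mulrC ler_pdivrMr//; apply: (le_trans (fC h)).
  rewrite -(real_normK (num_real h)) expr2 mulrA ler_pM2r//.
  have h1 : `|h| <= e / (C + 1).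
    near: h; apply: dnbhs0_le; rewrite divr_gt0//.
    by rewrite ltr_wpDl.
  apply: (@le_trans _ _ ((C + 1) * `|h|)); first by rewrite ler_wpM2r// lerDl.
  by rewrite mulrC -ler_pdivlMr// ltr_wpDl.
split; first by apply/cvg_ex; exists 0.
exact/cvg_lim.
Unshelve. all: by end_near. Qed.

Lemma is_derive_flat (R : realType) (m : nat) (x : R) :
  is_derive x (1:R) (flat m : R -> R) (flat m.+2 x - m%:R * flat m.+1 x).
Proof.
have [x0|x0|->] := ltgtP x 0.
- rewrite !flat_le0 ?(ltW x0)// mulr0 subr0.
  have H : is_derive x (1:R) (cst 0 : R -> R) 0 by exact: is_derive_cst.
  apply: near_eq_is_derive H.
  near=> y; rewrite flat_le0//; apply: ltW.
  by near: y; exact: lt_nbhsl.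
- have x1 : x != 0 by rewrite gt_eqF.
  have dV : is_derive x (1:R) (fun y : R => y^-1) (- x ^- 2).
    apply: DeriveDef; first by apply: derivableV => //; exact: derivable_id.
    by rewrite deriveV// ?derive_id ?/GRing.scale/= ?mulr1//; exact: derivable_id.
  have dX : is_derive x (1:R) (fun y : R => y^-1 ^+ m) (m%:R * x^-1 ^+ m.-1 * (- x ^- 2)).
    rewrite (_ : (fun y : R => y^-1 ^+ m) = (fun y : R => y^-1) ^+ m); last by apply/funext => y; rewrite exprfctE.
    exact: is_deriveX.
  have dN : is_derive x (1:R) (fun y : R => - y^-1) (x ^- 2).
    by have := is_deriveN dV; rewrite opprK.
  have dE : is_derive x (1:R) (fun y : R => expR (- y^-1)) (expR (- x^-1) * x ^- 2).
    by apply: (@is_derive1_comp _ expR).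
  have H := @is_deriveM _ _ (fun y : R => y^-1 ^+ m) (fun y : R => expR (- y^-1)) x 1 _ _ dX dE.
  apply: (@near_eq_is_derive _ _ _ ((fun y : R => y^-1 ^+ m) * (fun y : R => expR (- y^-1)))).
    near=> y; rewrite /flat ifT//.
    by near: y; exact: lt_nbhsr.
  apply: is_derive_eq; rewrite /flat x0 /GRing.scale/=.
  by case: m dX {H} => [|m] dX; rewrite /= -?exprVn !exprS ?expr0; ring.
- rewrite !flat_le0// mulr0 subr0; apply: (@is_derive_quadratic _ _ (m.+2)`!%:R) => y.
  rewrite ger0_norm ?flat_ge0//; exact: flat_le.
Unshelve. all: by end_near. Qed.

Lemma smooth1_flat (R : realType) (m : nat) : smooth1 (flat m : R -> R).
Proof.
move=> k; elim: k m => [//|k IH] m; split.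
  by move=> x; case: (is_derive_flat m x).
rewrite (_ : derive1 _ = flat m.+2 + (fun=> - m%:R) * flat m.+1).
  by apply: differentiable_uptoD => //; apply: differentiable_uptoM => //; exact: differentiable_upto_cst.
apply/funext => x; rewrite derive1E; case: (is_derive_flat m x) => _ ->.
by rewrite !fctE mulNr.
Qed.

(** A step from 0 at $-1$ to 1 at $1$. The step is primitive and the bump is defined as its
    derivative, so that differences of rescaled bumps have explicit antiderivatives. The arguments
    are written as affine maps to fit [smooth1_affine] and [derive1_affine]. *)
Definition smooth_step (R : realType) (x : R) : R :=
  flat 0 (1 * x + 1) * (flat 0 (1 * x + 1) + flat 0 (-1 * x + 1))^-1.

Lemma smooth_step_den_gt0 (R : realType) (x : R) :
  0 < flat 0 (1 * x + 1) + flat 0 (-1 * x + 1).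
Proof.
have [x0|x0] := ltP 0 x.
  by rewrite ltr_pwDl ?flat_ge0// flat_gt0//; lra.
by rewrite ltr_wpDl ?flat_ge0// flat_gt0//; lra.
Qed.

Lemma smooth1_smooth_step (R : realType) : smooth1 (@smooth_step R).
Proof.
apply: smooth1M; first by apply: smooth1_affine; exact: smooth1_flat.
apply: smooth1V; first by move=> x; rewrite gt_eqF// smooth_step_den_gt0.
by apply: smooth1D; apply: smooth1_affine; exact: smooth1_flat.
Qed.

Lemma smooth_step_le (R : realType) (x : R) : x <= -1 -> smooth_step x = 0.
Proof. by move=> x1; rewrite /smooth_step flat_le0 ?mul0r//; lra. Qed.

Lemma smooth_step_ge (R : realType) (x : R) : 1 <= x -> smooth_step x = 1.
Proof.
move=> x1; have := smooth_step_den_gt0 x; rewrite /smooth_step.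
rewrite [flat 0 (-1 * x + 1)]flat_le0; last lra.
by rewrite addr0 => /gt_eqF H; rewrite divff// H.
Qed.

(** The derivative of [flat 0] is [flat 2]; in the quotient rule the remaining terms cancel and
    leave a sum of nonnegative products, from which the signs of the bump are read off. *)
Lemma derive1_smooth_step (R : realType) (x : R) : let a := 1 * x + 1 in let b := -1 * x + 1 in
  derive1 (@smooth_step R) x =
  (flat 2 a * flat 0 b + flat 0 a * flat 2 b) / (flat 0 a + flat 0 b) ^+ 2.
Proof.
move=> a b.
have d0 y : derive1 (flat 0) y = flat 2 y :> R.
  by rewrite derive1E; case: (is_derive_flat 0 y) => _ ->; rewrite mul0r subr0.
have Dd c : is_derive x (1:R) (fun y => flat 0 (c * y + 1)) (c * flat 2 (c * x + 1)).
  have [dc Dc] := @derive1_affine R (flat 0) c 1 x (smooth1_derivable (@smooth1_flat R 0)).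
  by split => //; rewrite -derive1E Dc d0.
have dn : (flat 0 (1 * x + 1) + flat 0 (-1 * x + 1)) != 0 :> R.
  by rewrite gt_eqF// smooth_step_den_gt0.
have DD := is_deriveD (Dd 1) (Dd (-1)).
have DV := @is_deriveV R ((fun y : R => flat 0 (1 * y + 1)) + (fun y : R => flat 0 (-1 * y + 1))) x _ _ dn DD.
have DM := is_deriveM (Dd 1) DV.
have [_ E] := DM; rewrite derive1E.
refine (etrans E _).
rewrite !fctE -/a -/b /GRing.scale/=.
rewrite -/a -/b in dn.
field.
exact: dn.
Qed.

Lemma derive1_smooth_step_ge0 (R : realType) (x : R) : 0 <= derive1 (@smooth_step R) x.
Proof.
by rewrite derive1_smooth_step divr_ge0 ?sqr_ge0// addr_ge0// mulr_ge0// flat_ge0.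
Qed.

Lemma derive1_smooth_step0 (R : realType) : 0 < derive1 (@smooth_step R) 0.
Proof.
rewrite derive1_smooth_step !mulr0 !add0r divr_gt0//.
  by rewrite addr_gt0// mulr_gt0// flat_gt0.
by rewrite exprn_gt0// addr_gt0// flat_gt0.
Qed.

(* The threshold is 8 = 2 ^ 3 because the largest weight of the kinetic dilation
   is 3: doubling the scale spreads a support in [-1, 1] to at most [-8, 8]. *)
Definition bump (R : realType) (h : R -> R) :=
  smooth1 h /\ forall x, 8 < `|x| -> h x = 0.

Lemma bump_derive (R : realType) (h : R -> R) : bump h -> bump (derive1 h).
Proof.
move=> [sh h0]; split; first exact: smooth1_derive.
move=> x x8; rewrite derive1E.
have -> : 'D_1 h x = 'D_1 (cst 0 : R -> R) x.
  apply: near_eq_derive; near=> y; rewrite h0//.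
  near: y; have := @norm_continuous _ _ x.
  move/(_ [set r | 8 < r]); apply; exact: lt_nbhsr.
by rewrite derive_cst.
Unshelve. all: by end_near. Qed.

Lemma bump_mulx (R : realType) (h : R -> R) : bump h -> bump (fun x => x * h x).
Proof.
move=> [sh h0]; split; first by apply: smooth1M => //; exact: smooth1_id.
by move=> x /h0 ->; rewrite mulr0.
Qed.

Lemma smooth1_continuous (R : realType) (h : R -> R) : smooth1 h -> continuous h.
Proof.
move=> sh x; apply: differentiable_continuous; apply/derivable1_diffP.
exact: smooth1_derivable.
Qed.

Lemma bump_bounded (R : realType) (h : R -> R) : bump h ->
  exists2 C : R, 0 <= C & forall x, `|h x| <= C.
Proof.
move=> [sh h0].
have ch : continuous (fun x => `|h x|).
  by move=> x; apply: continuous_comp; [exact: smooth1_continuous|exact: norm_continuous].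
have [//||c _ cP] := @EVT_max R (fun x => `|h x|) (-8) 8; first lra.
  exact: continuous_subspaceT.
exists `|h c| => // x; have [x8|x8] := ltP 8 `|x|.
  by rewrite h0// normr0.
by apply: cP; rewrite in_itv/= -ler_norml.
Qed.

Definition step_bump (R : realType) : R -> R := derive1 (@smooth_step R).

Lemma step_bump_eq0 (R : realType) (x : R) : 1 < `|x| -> step_bump x = 0.
Proof.
move=> x1; rewrite /step_bump derive1E.
have [x0|x0] := ltP 0 x.
  have -> : 'D_1 (@smooth_step R) x = 'D_1 (cst 1 : R -> R) x.
    apply: near_eq_derive; near=> y; rewrite smooth_step_ge//; apply: ltW.
    near: y; apply: lt_nbhsr; by rewrite gtr0_norm in x1.
  by rewrite derive_cst.
have -> : 'D_1 (@smooth_step R) x = 'D_1 (cst 0 : R -> R) x.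
  apply: near_eq_derive; near=> y; rewrite smooth_step_le//; apply: ltW.
  near: y; apply: lt_nbhsl; by rewrite ler0_norm// in x1; lra.
by rewrite derive_cst.
Unshelve. all: by end_near. Qed.

Lemma smooth1_step_bump (R : realType) : smooth1 (@step_bump R).
Proof. by apply: smooth1_derive; exact: smooth1_smooth_step. Qed.

Lemma bump_step_bump (R : realType) : bump (@step_bump R).
Proof.
split; first exact: smooth1_step_bump.
by move=> x x8; apply: step_bump_eq0; lra.
Qed.

(* The difference of two rescalings of the same mollifier is the derivative of
   the compactly supported [step_gap], since both have the same mass. *)
Definition step_gap (R : realType) (d : nat) (x : R) : R :=
  smooth_step x - smooth_step (2^-1 ^+ d * x).

Definition step_bump_dil (R : realType) (d : nat) (x : R) : R :=
  2^-1 ^+ d * step_bump (2^-1 ^+ d * x).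

Lemma derive1_step_gap (R : realType) d (x : R) :
  derive1 (step_gap d) x = step_bump x - step_bump_dil d x.
Proof.
have ds y := smooth1_derivable (x := y) (@smooth1_smooth_step R).
have [dd Dd] := @derive1_affine R (@smooth_step R) (2^-1 ^+ d) 0 x (ds _).
have E : step_gap d = @smooth_step R - (fun y => smooth_step (2^-1 ^+ d * y + 0)).
  by apply/funext => y; rewrite !fctE /step_gap addr0.
rewrite E derive1E; refine (etrans (deriveB (ds _) dd) _).
by rewrite -!derive1E Dd addr0.
Qed.

Lemma half_pow_ge (R : realType) d : (d <= 3)%N -> 8^-1 <= 2^-1 ^+ d :> R.
Proof.
move=> d3; have -> : 8^-1 = 2^-1 ^+ 3 :> R by field.
by apply: ler_wiXn2l => //; lra.
Qed.

Lemma half_pow_norm (R : realType) d (x : R) : (d <= 3)%N -> 8 < `|x| ->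
  1 < `|2^-1 ^+ d * x|.
Proof.
move=> d3 x8; rewrite normrM ger0_norm; last by rewrite exprn_ge0//; lra.
apply: (@lt_le_trans _ _ (8^-1 * `|x|)); first lra.
by rewrite ler_wpM2r// half_pow_ge.
Qed.

Lemma bump_step_bump_dil (R : realType) d : (d <= 3)%N ->
  bump (@step_bump_dil R d).
Proof.
move=> d3; split.
  apply: smooth1M; first exact: smooth1_cst.
  under eq_fun => y do rewrite -[2^-1 ^+ d * y]addr0.
  by apply: smooth1_affine; exact: smooth1_step_bump.
by move=> x x8; rewrite /step_bump_dil step_bump_eq0 ?mulr0// half_pow_norm.
Qed.

Lemma bump_step_gap (R : realType) d : (d <= 3)%N -> bump (@step_gap R d).
Proof.
move=> d3; split.
  apply: smooth1D; first exact: smooth1_smooth_step.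
  rewrite (_ : (fun x => _) = (fun x => -1 * smooth_step (2^-1 ^+ d * x + 0))); last first.
    by apply/funext => x; rewrite addr0 mulN1r.
  apply: smooth1M; first exact: smooth1_cst.
  by apply: smooth1_affine; exact: smooth1_smooth_step.
move=> x x8; have := half_pow_norm d3 x8; rewrite /step_gap.
have d0 : 0 < 2^-1 ^+ d :> R by rewrite exprn_gt0//; lra.
have [x0|x0] := ltP 0 x.
  rewrite gtr0_norm ?mulr_gt0// => y1; rewrite gtr0_norm// in x8.
  by rewrite !smooth_step_ge ?subrr//; lra.
have y0 : 2^-1 ^+ d * x <= 0 by rewrite pmulr_rle0.
rewrite ler0_norm// => y1; rewrite ler0_norm// in x8.
by rewrite !smooth_step_le ?subrr//; lra.
Qed.

Lemma step_bump_ge0 (R : realType) (x : R) : 0 <= step_bump x.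
Proof. exact: derive1_smooth_step_ge0. Qed.

(** Serves to bound the mass of the mollifiers from below by the volume of a slab, without computing
    their integral. The same [d] is used as a radius and as a value. *)
Lemma step_bump_lb (R : realType) :
  exists2 d : R, 0 < d <= 1 & forall x, `|x| <= d -> d <= step_bump x.
Proof.
have b0 := derive1_smooth_step0 R; rewrite -/(step_bump 0) in b0.
have cb := smooth1_continuous (@smooth1_step_bump R).
have /cvgrPdist_lt/(_ (step_bump 0 / 2)) : step_bump x @[x --> (0:R)] --> step_bump (0:R) by exact: cb.
case; first by rewrite divr_gt0.
move=> e /= e0 eP.
pose d := Num.min 1 (Num.min (e / 2) (step_bump (0:R) / 2)).
have d0 : 0 < d by rewrite /d !lt_min; apply/and3P; split; rewrite ?divr_gt0.
exists d; first by rewrite d0 /d ge_min lexx.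
move=> x xd.
have : `|step_bump 0 - step_bump x| < step_bump 0 / 2.
  apply: eP; rewrite /= sub0r normrN (le_lt_trans xd)//.
  by rewrite /d !gt_min; apply/orP; right; apply/orP; left; lra.
rewrite ltr_distl => /andP[_]; have : d <= step_bump 0 / 2.
  by rewrite /d !ge_min; apply/orP; right; apply/orP; right.
move: (step_bump 0) (step_bump x) => u v; clear; lra.
Qed.

(** * Kinetic coordinates and product test functions *)

Definition weight (n : nat) (j : 'I_(1 + n + n)) : nat :=
  match fintype.split j with
  | inl k => match fintype.split k with inl _ => 2 | inr _ => 3 end
  | inr _ => 1
  end.

(** Velocity of the free transport through [z0], coordinate by coordinate. It vanishes in the [t]
    and [v] slots so that a single formula gives all coordinates of [lin]. *)
Definition slope (R : realType) (n : nat) (z0 : 'rV[R]_(1 + n + n))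
    (j : 'I_(1 + n + n)) : R :=
  match fintype.split j with
  | inl k => match fintype.split k with inl _ => 0 | inr i => z0 ord0 (vidx i) end
  | inr _ => 0
  end.

(* Coordinates of [z0^-1 z] for the group law of kinetic translations, before
   and after rescaling by [s]. *)
Definition lin (R : realType) (n : nat) (z0 : 'rV[R]_(1 + n + n)) j
    (v : 'rV[R]_(1 + n + n)) : R :=
  v ord0 j - v ord0 (tidx n) * slope z0 j.

Definition coordk (R : realType) (n : nat) (z0 : 'rV[R]_(1 + n + n)) (s : R) j
    (z : 'rV[R]_(1 + n + n)) : R :=
  s^-1 ^+ weight j * lin z0 j (z - z0).

Definition tens (R : realType) (n : nat) (h : 'I_(1 + n + n) -> R -> R)
    (z0 : 'rV[R]_(1 + n + n)) (s : R) (z : 'rV[R]_(1 + n + n)) : R :=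
  \prod_j h j (coordk z0 s j z).

(** Lets an operator on functions of one variable act on the [j]-th tensor factor. Operators on
    different factors commute, so commutators of vector fields reduce to computations in one
    factor. *)
Definition opf (R : realType) (n : nat) (j : 'I_n) (O : (R -> R) -> R -> R)
    (h : 'I_n -> R -> R) : 'I_n -> R -> R :=
  fun k => if k == j then O (h k) else h k.

Definition D1 (R : realType) (g : R -> R) : R -> R := derive1 g.

Definition mulX (R : realType) (g : R -> R) : R -> R := fun x => x * g x.

Lemma splitP_kin (n : nat) (P : 'I_(1 + n + n) -> Prop) :
  P (tidx n) -> (forall i, P (xidx i)) -> (forall i, P (vidx i)) ->
  forall j, P j.
Proof.
move=> Pt Px Pv j; rewrite -(fintype.splitK j); case: (fintype.split j) => [k|i]; last exact: Pv.
rewrite /= -(fintype.splitK k); case: (fintype.split k) => [i|i]; last exact: Px.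
by rewrite [i]ord1; exact: Pt.
Qed.

Lemma split_lshift (m n : nat) (i : 'I_m) : fintype.split (lshift n i) = inl i.
Proof. exact: (unsplitK (inl _ i)). Qed.

Lemma split_rshift (m n : nat) (i : 'I_n) : fintype.split (rshift m i) = inr i.
Proof. exact: (unsplitK (inr _ i)). Qed.

Lemma weight_t n : weight (tidx n) = 2.
Proof. by rewrite /weight /tidx !split_lshift. Qed.
Lemma weight_x n (i : 'I_n) : weight (xidx i) = 3.
Proof. by rewrite /weight /xidx split_lshift split_rshift. Qed.
Lemma weight_v n (i : 'I_n) : weight (vidx i) = 1.
Proof. by rewrite /weight /vidx split_rshift. Qed.
Lemma weight_le3 n (j : 'I_(1 + n + n)) : (weight j <= 3)%N.
Proof.
by move: j; apply: splitP_kin => [|i|i]; rewrite ?weight_t ?weight_x ?weight_v.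
Qed.
Lemma slope_t (R : realType) n (z : 'rV[R]_(1 + n + n)) : slope z (tidx n) = 0.
Proof. by rewrite /slope /tidx !split_lshift. Qed.
Lemma slope_x (R : realType) n (z : 'rV[R]_(1 + n + n)) i :
  slope z (xidx i) = z ord0 (vidx i).
Proof. by rewrite /slope /xidx split_lshift split_rshift. Qed.
Lemma slope_v (R : realType) n (z : 'rV[R]_(1 + n + n)) i : slope z (vidx i) = 0.
Proof. by rewrite /slope /vidx split_rshift. Qed.

Lemma sum_kin (R : realType) n (F : 'I_(1 + n + n) -> R) :
  \sum_j F j = F (tidx n) + \sum_(i < n) F (xidx i) + \sum_(i < n) F (vidx i).
Proof. by rewrite !big_split_ord/= big_ord1. Qed.

Lemma lin_t (R : realType) n (z0 v : 'rV[R]_(1 + n + n)) :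
  lin z0 (tidx n) v = v ord0 (tidx n).
Proof. by rewrite /lin slope_t mulr0 subr0. Qed.
Lemma lin_v (R : realType) n (z0 v : 'rV[R]_(1 + n + n)) i :
  lin z0 (vidx i) v = v ord0 (vidx i).
Proof. by rewrite /lin slope_v mulr0 subr0. Qed.

(** The slope is frozen at [z0], so [coordk z0 s j] is affine in [z], and along a line only the
    derivative of [g] after an affine map is involved. *)
Lemma is_derive_coordk (R : realType) n (g : R -> R) (z0 : 'rV[R]_(1 + n + n)) s j z v :
  smooth1 g ->
  is_derive z v (fun z => g (coordk z0 s j z))
    (s^-1 ^+ weight j * lin z0 j v * derive1 g (coordk z0 s j z)).
Proof.
move=> sg; set a := s^-1 ^+ weight j * lin z0 j v.
have E : (fun h : R => g (coordk z0 s j (h *: v + z))) =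
         (fun h : R => g (a * h + coordk z0 s j z)).
  apply/funext => h; congr g; rewrite /a /coordk /lin !mxE; ring.
have [d1 D1] := @derive1_affine R g a (coordk z0 s j z) 0 (smooth1_derivable sg).
have d : derivable (fun z => g (coordk z0 s j z)) z v.
  by apply/derivable1P; rewrite E.
split => //.
rewrite mulr0 add0r in D1; rewrite -D1 derive1E -E /derive.
congr (lim (_ @ 0^')); apply/funext => h /=.
by rewrite addr0 scale0r add0r [_%:A]mulr1.
Qed.

Lemma is_derive_prod (R : realType) N (V : normedModType R) (r : seq 'I_N) (g : 'I_N -> V -> R)
    (dg : 'I_N -> R) (z v : V) : uniq r ->
  (forall j, is_derive z v (g j) (dg j)) ->
  is_derive z v (fun z => \prod_(j <- r) g j z)
    (\sum_(j <- r) dg j * \prod_(k <- r | k != j) g k z).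
Proof.
move=> + Dg; elim: r => [_|i r IH /= /andP[ir ur]].
  rewrite big_nil; under eq_fun do rewrite big_nil; exact: is_derive_cst.
under eq_fun do rewrite big_cons.
have := is_deriveM (Dg i) (IH ur); move/is_derive_eq; apply.
rewrite big_cons big_cons eqxx /= /GRing.scale/= addrC; congr (_ + _).
  rewrite mulrC; congr (_ * _); rewrite big_seq [RHS]big_seq_cond; apply: eq_bigl => k.
  by case: (boolP (k \in r)) => //= kr; apply/esym; apply: contraNneq ir => <-.
rewrite mulr_sumr big_seq [RHS]big_seq; apply: eq_bigr => j jr.
rewrite big_cons ifT; last by apply: contraNneq ir => ->.
by rewrite mulrCA.
Qed.

Lemma is_derive_tens (R : realType) n (h : 'I_(1 + n + n) -> R -> R) z0 s z v :
  (forall j, smooth1 (h j)) ->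
  is_derive z v (tens h z0 s)
    (\sum_j s^-1 ^+ weight j * lin z0 j v * tens (opf j (@D1 R) h) z0 s z).
Proof.
move=> sh; have := @is_derive_prod R (1 + n + n) _ (index_enum _)
   (fun j z => h j (coordk z0 s j z)) _ z v (index_enum_uniq _)
   (fun j => is_derive_coordk z0 s j z v (sh j)).
move/is_derive_eq; apply; apply: eq_bigr => j _.
rewrite /tens [in RHS](bigD1 j)//= /opf eqxx -[LHS]mulrA; congr (_ * (_ * _)).
by apply: eq_bigr => k /negbTE ->.
Qed.

Lemma tens_mulX (R : realType) n (h : 'I_(1 + n + n) -> R -> R) z0 s z j :
  coordk z0 s j z * tens h z0 s z = tens (opf j (@mulX R) h) z0 s z.
Proof.
rewrite /tens (bigD1 j)//= [RHS](bigD1 j)//= /opf eqxx /mulX mulrA; congr (_ * _).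
by apply: eq_bigr => k /negbTE ->.
Qed.

Lemma tensB (R : realType) n (h : 'I_(1 + n + n) -> R -> R) z0 s z j (O1 O2 : (R -> R) -> R -> R) :
  tens (opf j (fun g => O1 g + O2 g) h) z0 s z =
  tens (opf j O1 h) z0 s z + tens (opf j O2 h) z0 s z.
Proof.
rewrite /tens (bigD1 j)//= [X in _ = X + _](bigD1 j)//= [X in _ = _ + X](bigD1 j)//= /opf eqxx.
rewrite fctE mulrDl; congr (_ * _ + _ * _).
  by apply: eq_bigr => k /negbTE ->.
by apply: eq_bigr => k /negbTE ->.
Qed.

Lemma opfC (R : realType) n (h : 'I_n -> R -> R) j k O1 O2 : j != k ->
  opf j O1 (opf k O2 h) = opf k O2 (opf j O1 h).
Proof.
move=> jk; apply/funext => i; rewrite /opf; case: eqP => [->|//]; by rewrite (negbTE jk).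
Qed.

Lemma opf_opf (R : realType) n (h : 'I_n -> R -> R) j O1 O2 :
  opf j O1 (opf j O2 h) = opf j (fun g => O1 (O2 g)) h.
Proof. by apply/funext => i; rewrite /opf; case: ifP => [->|->]. Qed.

Lemma vidx_inj n : injective (@vidx n).
Proof. by move=> i j /rshift_inj. Qed.
Lemma tidx_neq_x n (i : 'I_n) : (tidx n == xidx i) = false.
Proof. by rewrite /tidx /xidx eq_lshift eq_lrshift. Qed.
Lemma tidx_neq_v n (i : 'I_n) : (tidx n == vidx i) = false.
Proof. by rewrite /tidx /vidx eq_lrshift. Qed.
Lemma xidx_neq_v n (i k : 'I_n) : (xidx k == vidx i) = false.
Proof. by rewrite /xidx /vidx eq_lrshift. Qed.

Lemma lin_delta (R : realType) n (z0 : 'rV[R]_(1 + n + n)) j k :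
  lin z0 j (delta_mx ord0 k) = (j == k)%:R - (tidx n == k)%:R * slope z0 j.
Proof. by rewrite /lin !mxE eqxx. Qed.

Section TensDerivatives.
Context (R : realType) (n : nat) (h : 'I_(1 + n + n) -> R -> R)
  (z0 : 'rV[R]_(1 + n + n)) (s : R) (z : 'rV[R]_(1 + n + n)).

Lemma pd_tens (sh : forall j, smooth1 (h j)) k : pd k (tens h z0 s) z =
  \sum_j s^-1 ^+ weight j * lin z0 j (delta_mx ord0 k) * tens (opf j (@D1 R) h) z0 s z.
Proof. by rewrite /pd; case: (is_derive_tens z0 s z (delta_mx ord0 k) sh). Qed.

Lemma pd_v_tens (sh : forall j, smooth1 (h j)) i : pd (vidx i) (tens h z0 s) z =
  s^-1 * tens (opf (vidx i) (@D1 R) h) z0 s z.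
Proof.
rewrite pd_tens// (bigD1 (vidx i))//= big1 ?addr0; last first.
  by move=> j /negbTE jv; rewrite lin_delta jv tidx_neq_v mul0r subr0 mulr0 mul0r.
by rewrite lin_delta eqxx tidx_neq_v mul0r subr0 mulr1 weight_v expr1.
Qed.

Lemma pd_x_tens (sh : forall j, smooth1 (h j)) i : pd (xidx i) (tens h z0 s) z =
  s^-1 ^+ 3 * tens (opf (xidx i) (@D1 R) h) z0 s z.
Proof.
rewrite pd_tens// (bigD1 (xidx i))//= big1 ?addr0; last first.
  by move=> j /negbTE jv; rewrite lin_delta jv tidx_neq_x mul0r subr0 mulr0 mul0r.
by rewrite lin_delta eqxx tidx_neq_x mul0r subr0 mulr1 weight_x.
Qed.

Lemma pd_t_tens (sh : forall j, smooth1 (h j)) : pd (tidx n) (tens h z0 s) z =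
  s^-1 ^+ 2 * tens (opf (tidx n) (@D1 R) h) z0 s z -
  \sum_i z0 ord0 (vidx i) * (s^-1 ^+ 3 * tens (opf (xidx i) (@D1 R) h) z0 s z).
Proof.
rewrite pd_tens// sum_kin [X in _ + X]big1 ?addr0; last first.
  move=> i _; rewrite lin_delta slope_v eq_sym tidx_neq_v mulr0 subr0 mulr0 mul0r//.
rewrite lin_delta eqxx slope_t mulr0 subr0 mulr1 weight_t; congr (_ + _).
rewrite -sumrN; apply: eq_bigr => i _.
rewrite lin_delta slope_x weight_x eqxx eq_sym tidx_neq_x /= mulr0n mulr1n; ring.
Qed.

(** In the slanted coordinates $\partial_t$ produces $-v_0\cdot\partial_x$, which turns the
    coefficient $v$ of the transport field into $v-v_0$, that is $s$ times the rescaled velocity.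
    This $s$ brings $s^{-3}$ down to the $s^{-2}$ of the time derivative and explains the factors
    [mulX]. *)
Lemma transport_tens (sh : forall j, smooth1 (h j)) : s != 0 ->
  pd (tidx n) (tens h z0 s) z + \sum_i z ord0 (vidx i) * pd (xidx i) (tens h z0 s) z =
  s^-1 ^+ 2 * (tens (opf (tidx n) (@D1 R) h) z0 s z +
    \sum_i tens (opf (vidx i) (@mulX R) (opf (xidx i) (@D1 R) h)) z0 s z).
Proof.
move=> s0; rewrite pd_t_tens// mulrDr -addrA; congr (_ + _).
rewrite mulr_sumr addrC -sumrB; apply: eq_bigr => i _.
rewrite pd_x_tens// -tens_mulX /coordk lin_v !mxE weight_v expr1.
by field.
Qed.

End TensDerivatives.

(** The linear span of the smooth products in a fixed frame. It is closed under every [pd], so the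
    iterated derivatives required by [smooth] never leave it. *)
Inductive tens_span (R : realType) n (z0 : 'rV[R]_(1 + n + n)) (s : R) :
  ('rV[R]_(1 + n + n) -> R) -> Prop :=
| tens_span1 h of (forall j, smooth1 (h j)) : tens_span z0 s (tens h z0 s)
| tens_span0 : tens_span z0 s (fun=> 0)
| tens_spanD f g of tens_span z0 s f & tens_span z0 s g :
    tens_span z0 s (fun z => f z + g z)
| tens_spanZ c f of tens_span z0 s f : tens_span z0 s (fun z => c * f z).

Lemma tens_span_sum (R : realType) n (z0 : 'rV[R]_(1 + n + n)) s (I : Type)
    (r : seq I) (F : I -> 'rV[R]_(1 + n + n) -> R) :
  (forall i, tens_span z0 s (F i)) -> tens_span z0 s (fun z => \sum_(i <- r) F i z).
Proof.
move=> HF; elim: r => [|i r IH].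
  by under eq_fun do rewrite big_nil; exact: tens_span0.
by under eq_fun do rewrite big_cons; exact: tens_spanD.
Qed.

Lemma smooth1_opf_D1 (R : realType) n (h : 'I_n -> R -> R) j :
  (forall i, smooth1 (h i)) -> forall i, smooth1 (opf j (@D1 R) h i).
Proof. by move=> sh i; rewrite /opf; case: ifP => // _; exact: smooth1_derive. Qed.

Lemma tens_span_derivable (R : realType) n (z0 : 'rV[R]_(1 + n + n)) s g z v :
  tens_span z0 s g -> derivable g z v.
Proof.
elim=> [h sh||f1 f2 _ d1 _ d2|c f _ d].
- by case: (is_derive_tens z0 s z v sh).
- exact: derivable_cst.
- exact: derivableD.
- exact: (derivableM (derivable_cst c z v) d).
Qed.

Lemma continuous_coordk (R : realType) n (z0 : 'rV[R]_(1 + n + n)) s j :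
  continuous (coordk z0 s j).
Proof.
move=> z; apply: (@continuousM R _ (cst (s^-1 ^+ weight j)) _ z).
  exact: cst_continuous.
have c k : {for z, continuous (fun z : 'rV[R]_(1 + n + n) => (z - z0) ord0 k)}.
  rewrite (_ : (fun _ => _) = (fun z : 'rV[R]_(1 + n + n) => z ord0 k - z0 ord0 k)); last first.
    by apply/funext => w; rewrite !mxE.
  apply: (@continuousB R R _ (fun w : 'rV[R]_(1 + n + n) => w ord0 k) (cst (z0 ord0 k)) z); first exact: coord_continuous.
  exact: cst_continuous.
rewrite /lin; apply: (@continuousB R R _ _ _ z); first exact: c.
apply: (@continuousM R _ _ _ z); first exact: c.
exact: cst_continuous.
Qed.

Lemma continuous_tens (R : realType) n (h : 'I_(1 + n + n) -> R -> R) z0 s :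
  (forall j, continuous (h j)) -> continuous (tens h z0 s).
Proof.
move=> ch; rewrite /tens; elim: (index_enum _) => [|i r IH].
  by under eq_fun do rewrite big_nil; exact: cst_continuous.
under eq_fun do rewrite big_cons; move=> z.
apply: (@continuousM R _ _ _ z); last exact: IH.
apply: (continuous_comp (f := coordk z0 s i)); first exact: continuous_coordk.
exact: ch.
Qed.

Lemma tens_span_continuous (R : realType) n (z0 : 'rV[R]_(1 + n + n)) s g :
  tens_span z0 s g -> continuous g.
Proof.
elim=> [h sh||f1 f2 _ d1 _ d2|c f _ d] z.
- by apply: continuous_tens => j; exact: smooth1_continuous.
- exact: cst_continuous.
- exact: (@continuousD R R _ _ _ z (d1 z) (d2 z)).
- by apply: (@continuousM R _ (cst c) f z); [exact: cst_continuous|exact: d].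
Qed.

Lemma tens_span_pd (R : realType) n (z0 : 'rV[R]_(1 + n + n)) s g i :
  tens_span z0 s g -> tens_span z0 s (pd i g).
Proof.
elim=> [h sh||f1 f2 s1 d1 s2 d2|c f s0 d].
- rewrite (_ : pd i _ = fun z => \sum_j s^-1 ^+ weight j * lin z0 j (delta_mx ord0 i) * tens (opf j (@D1 R) h) z0 s z).
    apply: tens_span_sum => j; apply: tens_spanZ; apply: tens_span1.
    exact: smooth1_opf_D1.
  by apply/funext => z; rewrite pd_tens.
- rewrite (_ : pd i _ = fun=> 0); first exact: tens_span0.
  by apply/funext => z; rewrite /pd; exact: derive_cst.
- rewrite (_ : pd i _ = fun z => pd i f1 z + pd i f2 z); first exact: tens_spanD.
  apply/funext => z; rewrite /pd.
  exact: (deriveD (tens_span_derivable s1) (tens_span_derivable s2)).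
- rewrite (_ : pd i _ = fun z => c * pd i f z); first exact: tens_spanZ.
  apply/funext => z; rewrite /pd.
  exact: (deriveZ c (tens_span_derivable s0)).
Qed.

Lemma tens_span_smooth (R : realType) n (z0 : 'rV[R]_(1 + n + n)) s g :
  tens_span z0 s g -> smooth g.
Proof.
move=> sg r; have {sg} : tens_span z0 s (pds r g).
  by elim: r => [//|i r IH]; exact: tens_span_pd.
move=> sg; split; first exact: tens_span_continuous sg.
by move=> i x; exact: tens_span_derivable sg.
Qed.

Lemma tens_neq0 (R : realType) n (h : 'I_(1 + n + n) -> R -> R) z0 s z :
  (forall j, bump (h j)) -> tens h z0 s z != 0 ->
  forall j, `|coordk z0 s j z| <= 8.
Proof.
move=> bh t0 j; rewrite leNgt; apply: contra t0 => c8.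
by rewrite /tens (bigD1 j)//= (bh j).2// mul0r.
Qed.

Lemma coordk_le (R : realType) n (z0 : 'rV[R]_(1 + n + n)) s j z (c : R) : 0 < s ->
  (`|coordk z0 s j z| <= c) = (`|lin z0 j (z - z0)| <= c * s ^+ weight j).
Proof.
move=> s0; have sw : 0 < s ^+ weight j by rewrite exprn_gt0.
rewrite /coordk normrM exprVn [`|_ ^- _|]gtr0_norm ?invr_gt0//.
by rewrite ler_pdivrMl 1?[in RHS]mulrC.
Qed.

Lemma test_fun_tens (R : realType) n (h : 'I_(1 + n + n) -> R -> R) z0 s :
  0 < s -> (forall j, bump (h j)) -> test_fun (tens h z0 s).
Proof.
move=> s0 bh; split.
  by apply: (@tens_span_smooth _ _ z0 s); apply: tens_span1 => j; case: (bh j).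
(* Centre, half-width $8s^{w_j}$, and drift of the slanted coordinate during a time of at most
   $8s^2$. The sum of the [b j] bounds the sup norm. *)
pose b j := `|z0 ord0 j| + 8 * s ^+ weight j + 8 * s ^+ 2 * `|slope z0 j|.
exists (\sum_j b j) => z; apply: contraTeq => t0; rewrite -leNgt.
have sw k : 0 <= s ^+ k by rewrite exprn_ge0// ltW.
have b0 j : 0 <= b j by rewrite /b; do !apply: addr_ge0 => //; do !apply: mulr_ge0 => //.
have zb j : `|z ord0 j| <= b j.
  have := tens_neq0 bh t0 j; have := tens_neq0 bh t0 (tidx n).
  rewrite !coordk_le// lin_t weight_t !mxE /lin !mxE => ht hj.
  have -> : z ord0 j = z0 ord0 j + (z ord0 j - z0 ord0 j -
      (z ord0 (tidx n) - z0 ord0 (tidx n)) * slope z0 j) +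
      (z ord0 (tidx n) - z0 ord0 (tidx n)) * slope z0 j by ring.
  apply: (le_trans (ler_normD _ _)); apply: lerD.
    by apply: (le_trans (ler_normD _ _)); exact: lerD.
  by rewrite normrM; apply: ler_wpM2r.
rewrite /Num.Def.normr/= mx_normrE; apply: bigmax_le; first exact: sumr_ge0.
move=> [i j] _ /=; rewrite ord1; apply: (le_trans (zb j)).
by rewrite (bigD1 j)//= lerDl sumr_ge0.
Qed.

Lemma tens_bound (R : realType) n (h : 'I_(1 + n + n) -> R -> R) :
  (forall j, bump (h j)) -> exists2 C : R, 0 <= C & forall z0 s z, `|tens h z0 s z| <= C.
Proof.
move=> bh; have /choice[c cP] j : exists C : R, 0 <= C /\ forall x, `|h j x| <= C.
  by have [C C0 HC] := bump_bounded (bh j); exists C.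
exists (\prod_j c j); first by apply: prodr_ge0 => j _; case: (cP j).
move=> z0 s z; rewrite /tens normr_prod; apply: ler_prod => j _.
by rewrite normr_ge0; case: (cP j) => _ ->.
Qed.

(** * Difference of the mollifiers at consecutive dyadic scales *)

Lemma tens_telescope (R : realType) n (a b : 'I_(1 + n + n) -> R -> R) z0 s z
    (P := fun m : nat => fun k : 'I_(1 + n + n) => if (k < m)%N then b k else a k) :
  tens a z0 s z - tens b z0 s z =
  \sum_(i < 1 + n + n) (tens (P i) z0 s z - tens (P i.+1) z0 s z).
Proof.
have -> : tens a z0 s z = tens (P 0) z0 s z by [].
have -> : tens b z0 s z = tens (P (1 + n + n)%N) z0 s z.
  by rewrite /tens; apply: eq_bigr => k _; rewrite /P ltn_ord.
have := telescope_sumr (fun m => tens (P m) z0 s z) (leq0n (1 + n + n)).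
rewrite big_mkord => E; rewrite -opprB -E -sumrN.
by apply: eq_bigr => i _; rewrite opprB.
Qed.

(** The exponent $4n+2$ is the homogeneous dimension, the sum of all weights computed in
    [sum_weight]. *)
Definition mollk (R : realType) n (z0 : 'rV[R]_(1 + n + n)) (s : R)
    (z : 'rV[R]_(1 + n + n)) : R :=
  s^-1 ^+ (4 * n + 2) * tens (fun _ => @step_bump R) z0 s z.

(* Mollifiers at scales [s] and [2 s] are compared by exchanging the factors of
   the product one at a time; the [i]-th exchange produces [D1] of [gapfam i]. *)
Definition gapfam (R : realType) n (i : 'I_(1 + n + n)) : 'I_(1 + n + n) -> R -> R :=
  fun k => if (k < i)%N then @step_bump_dil R (weight k)
           else if k == i then @step_gap R (weight k) else @step_bump R.

Lemma bump_gapfam (R : realType) n (i k : 'I_(1 + n + n)) : bump (@gapfam R n i k).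
Proof.
rewrite /gapfam; case: ifP => _; first by apply: bump_step_bump_dil; exact: weight_le3.
by case: ifP => _; [apply: bump_step_gap; exact: weight_le3|exact: bump_step_bump].
Qed.

Lemma sum_weight n : (\sum_(j < 1 + n + n) weight j = 4 * n + 2)%N.
Proof.
rewrite !big_split_ord/= big_ord1 weight_t.
under eq_bigr do rewrite weight_x.
under [X in (_ + X)%N]eq_bigr do rewrite weight_v.
by rewrite !sum_nat_const card_ord; lia.
Qed.

Lemma prod_weight (R : realType) n (s : R) :
  \prod_(j < 1 + n + n) s ^+ weight j = s ^+ (4 * n + 2).
Proof. by rewrite prodrXr sum_weight. Qed.

Lemma coordk2 (R : realType) n (z0 z : 'rV[R]_(1 + n + n)) s j :
  coordk z0 (2 * s) j z = 2^-1 ^+ weight j * coordk z0 s j z.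
Proof. by rewrite /coordk invfM exprMn mulrA. Qed.

(** The factors $2^{-w_j}$ in [step_bump_dil] multiply to $2^{-(4n+2)}$, the change of normalisation
    between the scales. Both mollifiers thus become products in the frame of scale [s], where
    [tens_telescope] applies. *)
Lemma mollkB (R : realType) n (z0 z : 'rV[R]_(1 + n + n)) s :
  mollk z0 s z - mollk z0 (2 * s) z =
  s^-1 ^+ (4 * n + 2) * \sum_i tens (opf i (@D1 R) (@gapfam R n i)) z0 s z.
Proof.
have -> : mollk z0 (2 * s) z =
    s^-1 ^+ (4 * n + 2) * tens (fun j => @step_bump_dil R (weight j)) z0 s z.
  rewrite /mollk invfM exprMn mulrAC mulrC; congr (_ * _).
  rewrite -prod_weight /tens -big_split/=; apply: eq_bigr => j _.
  by rewrite coordk2.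
rewrite /mollk -mulrBr; congr (_ * _); rewrite tens_telescope.
apply: eq_bigr => i _; rewrite /tens (bigD1 i)//= [X in _ - X](bigD1 i)//=.
rewrite [RHS](bigD1 i)//= ltnn ltnS leqnn /opf eqxx.
have -> : D1 (@gapfam R n i i) = fun x => step_bump x - step_bump_dil (weight i) x.
  apply/funext => x; rewrite /D1 -derive1_step_gap /gapfam ltnn eqxx.
  by congr (derive1 _ x).
rewrite mulrBl; congr (_ * _ - _ * _).
  apply: eq_bigr => k ki; rewrite (negbTE ki) /gapfam (negbTE ki).
  by case: ifP.
apply: eq_bigr => k ki; rewrite (negbTE ki) /gapfam (negbTE ki) ltnS leq_eqVlt.
by rewrite (inj_eq val_inj) (negbTE ki) /=; case: ifP.
Qed.

(** * Measure of kinetic slabs *)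

Section LebesgueSpace.
Context (R : realType) (N : nat).

Lemma measurable_hbox (a b : 'rV[R]_N) : measurable (hbox a b : set (Rspace R N)).
Proof. by apply: sub_sigma_algebra; exists a, b. Qed.

(** The sigma-algebra is generated by bounded boxes, so a half-space is exhausted by boxes whose
    other sides grow with [m]. *)
Lemma measurable_coord (j : 'I_N) :
  measurable_fun setT (fun z : Rspace R N => z ord0 j).
Proof.
apply: (measurability _ (RGenOInfty.measurableE R)).
move=> _ [_ [x ->] <-]; rewrite setTI.
rewrite (_ : _ @^-1` _ = \bigcup_m
   hbox (\row_k (if k == j then x else - m%:R)) (\row_k m%:R)).
  by apply: bigcupT_measurable => m; exact: measurable_hbox.
apply/seteqP; split => [z /=|z [m _ /(_ j)]]; last first.
  by rewrite !mxE eqxx /= in_itv/= andbT => /andP[].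
rewrite in_itv/= andbT => xz.
exists (Num.bound (1 + \sum_k `|z ord0 k|)) => // k; rewrite !mxE.
have zk : 1 + `|z ord0 k| < (Num.bound (1 + \sum_k `|z ord0 k|))%:R.
  apply: le_lt_trans (archi_boundP _); last by rewrite addr_ge0// sumr_ge0.
  by rewrite lerD2l (bigD1 k)//= lerDl sumr_ge0.
have := ler_norm (z ord0 k); have := ler_norm (- z ord0 k); rewrite normrN => h1 h2.
apply/andP; split; last by lra.
by case: eqP => [->//|_]; lra.
Qed.

Definition cube (m : nat) : set (Rspace R N) :=
  hbox (\row_k - m%:R) (\row_k m%:R).

Lemma cube_measure (mu : {measure set (Rspace R N) -> \bar R}) m :
  is_lebesgue mu -> mu (cube m) = ((2 * m%:R) ^+ N)%:E.
Proof.
move=> Lmu; rewrite /cube Lmu; last by move=> i; rewrite !mxE; have := ler0n R m; lra.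
congr EFin; rewrite -[in RHS](card_ord N) -prodr_const; apply: eq_bigr => i _.
by rewrite !mxE; ring.
Qed.

Lemma bigcup_cube : \bigcup_m cube m = setT.
Proof.
apply/seteqP; split => // z _.
exists (Num.bound (1 + \sum_k `|z ord0 k|)) => // k; rewrite !mxE.
have zk : 1 + `|z ord0 k| < (Num.bound (1 + \sum_k `|z ord0 k|))%:R.
  apply: le_lt_trans (archi_boundP _); last by rewrite addr_ge0// sumr_ge0.
  by rewrite lerD2l (bigD1 k)//= lerDl sumr_ge0.
have := ler_norm (z ord0 k); have := ler_norm (- z ord0 k); rewrite normrN => h1 h2.
by apply/andP; split; lra.
Qed.

Lemma lebesgue_sigma_finite (mu : {measure set (Rspace R N) -> \bar R}) :
  is_lebesgue mu -> sigma_finite setT mu.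
Proof.
move=> Lmu; exists cube; first by rewrite bigcup_cube.
move=> m; split; first exact: measurable_hbox.
by rewrite cube_measure// ltry.
Qed.

End LebesgueSpace.

Lemma step_cover (R : realType) (tau : nat -> R) K x : tau 0 < x <= tau K ->
  exists2 i, (i < K)%N & tau i < x <= tau i.+1.
Proof.
elim: K => [|K IH] /andP[h1 h2]; first by move: (lt_le_trans h1 h2); rewrite ltxx.
have [xK|xK] := leP x (tau K); last by exists K => //; rewrite xK h2.
by have [|i iK Hi] := IH _; [rewrite h1 xK|exists i => //; exact: ltnW].
Qed.

Section Slices.
Context (R : realType) (n : nat) (z0 : 'rV[R]_(1 + n + n)) (c : 'I_(1 + n + n) -> R)
  (K : nat).
Hypotheses (c0 : forall j, 0 < c j) (K0 : (0 < K)%N).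

(* The slab {z : |lin z0 j (z - z0)| <= c j} is slanted in the position
   directions; over a short time interval it is nearly a straight box. *)
Definition slice_time (i : nat) : R := c (tidx n) * (2 * i%:R / K%:R - 1).

Definition slice (i : nat) : set (Rspace R (1 + n + n)) :=
  hbox (\row_j (z0 ord0 j + if j == tidx n then slice_time i
                            else slice_time i * slope z0 j - c j))
       (\row_j (z0 ord0 j + if j == tidx n then slice_time i.+1
                            else slice_time i * slope z0 j + c j)).

Lemma slice_timeS i : slice_time i.+1 - slice_time i = 2 * c (tidx n) / K%:R.
Proof.
have K1 : K%:R != 0 :> R by rewrite pnatr_eq0 -lt0n.
by rewrite /slice_time -natr1; field.
Qed.

Lemma slice_time_le i k : (i <= k)%N -> slice_time i <= slice_time k.
Proof.
move=> ik; rewrite /slice_time ler_pM2l// lerD2r ler_pM2r ?invr_gt0 ?ltr0n//.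
by rewrite ler_pM2l ?ler_nat.
Qed.

Lemma slice_measure (mu : {measure set (Rspace R (1 + n + n)) -> \bar R}) i :
  is_lebesgue mu -> mu (slice i) = ((\prod_j (2 * c j)) / K%:R)%:E.
Proof.
have K1 : 0 < K%:R :> R by rewrite ltr0n.
have st := slice_timeS i.
have st0 : 0 <= 2 * c (tidx n) / K%:R by rewrite divr_ge0 ?mulr_ge0// ltW.
move=> Lmu; rewrite /slice Lmu; last first.
  move=> j; rewrite !mxE lerD2l; case: ifP => _; first by rewrite -subr_ge0 st.
  by have := c0 j; lra.
congr EFin; rewrite (bigD1 (tidx n))//= [in RHS](bigD1 (tidx n))//= mulrAC.
congr (_ * _); first by rewrite !mxE eqxx -st; ring.
by apply: eq_bigr => j /negbTE jt; rewrite !mxE jt; ring.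
Qed.

Lemma slice_trivIset : trivIset setT slice.
Proof.
apply: ltn_trivIset => k i ik; apply/seteqP; split => // z [/(_ (tidx n)) + /(_ (tidx n))].
rewrite !mxE eqxx => /andP[_ h1] /andP[h2 _].
have := slice_time_le ik; lra.
Qed.

Lemma slices_measure (mu : {measure set (Rspace R (1 + n + n)) -> \bar R}) :
  is_lebesgue mu -> mu (\big[setU/set0]_(i < K) slice i) = (\prod_j (2 * c j))%:E.
Proof.
move=> Lmu; rewrite measure_bigsetU//; last exact: slice_trivIset.
  rewrite (eq_bigr (fun=> (\prod_j (2 * c j) / K%:R)%:E)); last first.
    by move=> i _; exact: slice_measure.
  rewrite sumEFin sumr_const card_ord -[_ *+ K]mulr_natr divfK// pnatr_eq0 -lt0n//.
by move=> i; exact: measurable_hbox.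
Qed.

End Slices.

Definition slab (R : realType) n (z0 : 'rV[R]_(1 + n + n)) (a : 'I_(1 + n + n) -> R) :
  set (Rspace R (1 + n + n)) := [set z | forall j, `|lin z0 j (z - z0)| <= a j].

(** Slices must be short enough for the drift within one of them to stay below half the width. The
    factor 4 is the slice length for half-widths [2 * a j], needed in [slab_ub]; the slices of
    [slab_lb], with half-widths [a j / 2], are shorter. *)
Lemma exists_slices (R : realType) n (z0 : 'rV[R]_(1 + n + n)) (a : 'I_(1 + n + n) -> R) :
  (forall j, 0 < a j) ->
  exists K : nat, (0 < K)%N /\ forall j, 4 * a (tidx n) / K%:R * `|slope z0 j| < a j / 2.
Proof.
move=> a0; pose b j := 8 * a (tidx n) * `|slope z0 j| / a j.
have b0 j : 0 <= b j by rewrite divr_ge0 ?mulr_ge0// ltW.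
have bK j : b j < (Num.bound (\sum_j b j))%:R.
  apply: le_lt_trans (archi_boundP _); last exact: sumr_ge0.
  by rewrite (bigD1 j)//= lerDl sumr_ge0.
have K0 : 0 < (Num.bound (\sum_j b j))%:R :> R by apply: le_lt_trans (bK (tidx n)).
exists (Num.bound (\sum_j b j)); split; first by rewrite ltr0n in K0.
move=> j; have := bK j; rewrite /b ltr_pdivrMr// => H.
rewrite mulrAC ltr_pdivrMr//; lra.
Qed.

Section SlabMeasure.
Context (R : realType) (n : nat).
Local Notation E := (Rspace R (1 + n + n)).

Lemma measurable_slab (z0 : 'rV[R]_(1 + n + n)) a : measurable (slab z0 a).
Proof.
have -> : slab z0 a = \bigcap_(j in [set: 'I_(1 + n + n)]) [set z | `|lin z0 j (z - z0)| <= a j].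
  by apply/seteqP; split => z /= H j; [move=> _|]; exact: H.
apply: fin_bigcap_measurable => // j _.
rewrite -[X in measurable X]setTI.
apply: measurable_fun_le => //; apply: measurableT_comp => //.
rewrite /lin; under eq_fun do rewrite !mxE.
by apply: measurable_funB; [|apply: measurable_funM => //];
  apply: measurable_funB => //; exact: measurable_coord.
Qed.

(** A slab is a sheared box of volume $\prod_j 2a_j$, but the measure is prescribed on straight
    boxes only. Slices of half the size fit inside, since the drift within a slice uses up at most
    the other half; this costs a constant and avoids a change of variables. *)
Lemma slab_lb (mu : {measure set E -> \bar R}) (z0 : 'rV[R]_(1 + n + n)) a :
  is_lebesgue mu -> (forall j, 0 < a j) -> ((\prod_j a j)%:E <= mu (slab z0 a))%E.
Proof.
move=> Lmu a0; have [K [K0 HK]] := exists_slices z0 a0.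
have c0 j : 0 < a j / 2 by rewrite divr_gt0.
have -> : \prod_j a j = \prod_j (2 * (a j / 2)) by apply: eq_bigr => j _; field.
rewrite -(slices_measure z0 c0 K0 Lmu); apply: le_measure; rewrite ?inE.
- by apply: bigsetU_measurable => i _; exact: measurable_hbox.
- exact: measurable_slab.
have K1 : 0 < K%:R :> R by rewrite ltr0n.
rewrite -bigcup_mkord => z [i /= iK Hz] j.
have := Hz (tidx n); have := Hz j; rewrite /lin !mxE eqxx.
set t := z ord0 (tidx n) - z0 ord0 (tidx n) => hj /andP[t1 t2].
have T1 : slice_time (fun j => a j / 2) K i < t by rewrite /t; lra.
have T2 : t <= slice_time (fun j => a j / 2) K i.+1 by rewrite /t; lra.
have ST := slice_timeS (fun j => a j / 2) K0 i.
have L0 := slice_time_le c0 K0 (leq0n i).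
have LK := slice_time_le c0 K0 iK.
have E0 : slice_time (fun j => a j / 2) K 0 = - (a (tidx n) / 2).
  by rewrite /slice_time mulr0 mul0r sub0r mulrN1.
have EK : slice_time (fun j => a j / 2) K K = a (tidx n) / 2.
  by rewrite /slice_time; field; rewrite gt_eqF.
case: (eqVneq j (tidx n)) hj => [-> _|jt hj].
  have at0 := a0 (tidx n); rewrite slope_t mulr0 subr0 -/t ler_norml; rewrite E0 in L0; rewrite EK in LK.
  by apply/andP; split; lra.
move: hj => /andP[h1 h2].
set ti := slice_time _ _ _ in T1 T2 ST L0 LK h1 h2 *.
have -> : z ord0 j - z0 ord0 j - t * slope z0 j =
  (z ord0 j - z0 ord0 j - ti * slope z0 j) - (t - ti) * slope z0 j by ring.
have hA : `|z ord0 j - z0 ord0 j - ti * slope z0 j| <= a j / 2.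
  by rewrite ler_norml; apply/andP; split; lra.
have hB : `|(t - ti) * slope z0 j| <= a j / 2.
  rewrite normrM; apply: le_trans (ltW (HK j)); apply: ler_wpM2r => //.
  rewrite ger0_norm; last lra.
  have at0 : 0 < a (tidx n) / K%:R by rewrite divr_gt0.
  rewrite (_ : 2 * (a (tidx n) / 2) / K%:R = a (tidx n) / K%:R) in ST; last by field; rewrite gt_eqF.
  rewrite -mulrA; move: (a (tidx n) / K%:R) at0 ST => u at0 ST; lra.
apply: le_trans (ler_normB _ _) _; lra.
Qed.

(** Conversely, slices of twice the size cover the slab. *)
Lemma slab_ub (mu : {measure set E -> \bar R}) (z0 : 'rV[R]_(1 + n + n)) a :
  is_lebesgue mu -> (forall j, 0 < a j) ->
  (mu (slab z0 a) <= (\prod_j (4 * a j))%:E)%E.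
Proof.
move=> Lmu a0; have [K [K0 HK]] := exists_slices z0 a0.
have c0 j : 0 < 2 * a j by rewrite mulr_gt0.
have -> : \prod_j (4 * a j) = \prod_j (2 * (2 * a j)) by apply: eq_bigr => j _; ring.
rewrite -(slices_measure z0 c0 K0 Lmu); apply: le_measure; rewrite ?inE.
- exact: measurable_slab.
- by apply: bigsetU_measurable => i _; exact: measurable_hbox.
have K1 : 0 < K%:R :> R by rewrite ltr0n.
rewrite -bigcup_mkord => z Hz /=.
have := Hz (tidx n); rewrite lin_t !mxE ler_norml => /andP[t1 t2].
set t := z ord0 (tidx n) - z0 ord0 (tidx n) in t1 t2 *.
have E0 : slice_time (fun j => 2 * a j) K 0 = - (2 * a (tidx n)).
  by rewrite /slice_time mulr0 mul0r sub0r mulrN1.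
have EK : slice_time (fun j => 2 * a j) K K = 2 * a (tidx n).
  by rewrite /slice_time; field; rewrite gt_eqF.
have at0 := a0 (tidx n).
(* The time range is doubled as well, so the left end $-2a_t$ lies strictly below every time in the
   slab, as half-open intervals require. *)
have [|i iK /andP[T1 T2]] := @step_cover R (slice_time (fun j => 2 * a j) K) K t.
  by rewrite E0 EK; apply/andP; split; lra.
exists i => // j; rewrite !mxE.
have ST := slice_timeS (fun j => 2 * a j) K0 i.
case: (eqVneq j (tidx n)) => [->|jt].
  by rewrite /t in T1 T2; apply/andP; split; lra.
have := Hz j; rewrite /lin !mxE -/t => hj.
set ti := slice_time _ _ _ in T1 T2 ST *.
have E1 : z ord0 j - z0 ord0 j - t * slope z0 j =
  (z ord0 j - z0 ord0 j - ti * slope z0 j) - (t - ti) * slope z0 j by ring.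
have hB : `|(t - ti) * slope z0 j| <= a j / 2.
  rewrite normrM; apply: le_trans (ltW (HK j)); apply: ler_wpM2r => //.
  rewrite ger0_norm; last lra.
  have at1 : 0 < a (tidx n) / K%:R by rewrite divr_gt0.
  rewrite (_ : 2 * (2 * a (tidx n)) / K%:R = 4 * a (tidx n) / K%:R) in ST; last by field; rewrite gt_eqF.
  lra.
move: hj hB; rewrite E1 !ler_norml => /andP[h1 h2] /andP[h3 h4].
have := a0 j; move: ((t - ti) * _) h1 h2 h3 h4 => u h1 h2 h3 h4 aj.
by apply/andP; split; lra.
Qed.

End SlabMeasure.

(** * Kinetic integration by parts *)

Section IntegralEFin.
Context d (T : measurableType d) (R : realType) (mu : {measure set T -> \bar R}).
Implicit Types f g : T -> R.

Lemma le_integral_EFin f g : measurable_fun setT f -> measurable_fun setT g ->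
  (forall z, 0 <= f z <= g z) ->
  (\int[mu]_z (f z)%:E <= \int[mu]_z (g z)%:E)%E.
Proof.
move=> mf mg fg; apply: ge0_le_integral => //.
- by move=> z _; rewrite lee_fin; case/andP: (fg z).
- exact/measurable_EFinP.
- exact/measurable_EFinP.
- by move=> z _; rewrite lee_fin; case/andP: (fg z).
Qed.

Lemma integralZ_EFin c f : 0 <= c -> measurable_fun setT f -> (forall z, 0 <= f z) ->
  (\int[mu]_z (c * f z)%:E = c%:E * \int[mu]_z (f z)%:E)%E.
Proof.
move=> c0 mf f0; under eq_integral do rewrite EFinM.
rewrite ge0_integralZl_EFin//; last exact/measurable_EFinP.
by move=> z _; rewrite lee_fin.
Qed.

Lemma integralD_EFin f g : measurable_fun setT f -> measurable_fun setT g ->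
  (forall z, 0 <= f z) -> (forall z, 0 <= g z) ->
  (\int[mu]_z (f z + g z)%:E = \int[mu]_z (f z)%:E + \int[mu]_z (g z)%:E)%E.
Proof.
move=> mf mg f0 g0; under eq_integral do rewrite EFinD.
by rewrite ge0_integralD//;
  [move=> z _; rewrite lee_fin|exact/measurable_EFinP|
   move=> z _; rewrite lee_fin|exact/measurable_EFinP].
Qed.

Lemma abse_integral_le f g : measurable_fun setT f -> measurable_fun setT g ->
  (forall z, `|f z| <= g z) ->
  (`|\int[mu]_z (f z)%:E| <= \int[mu]_z (g z)%:E)%E.
Proof.
move=> mf mg fg; apply: (le_trans (le_abse_integral mu measurableT _)).
  exact/measurable_EFinP.
under eq_integral do rewrite abse_EFin.
apply: le_integral_EFin => //; first exact: measurableT_comp.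
by move=> z; rewrite normr_ge0 fg.
Qed.

Lemma integrable_indic_fin (A : set T) : measurable A -> (mu A < +oo)%E ->
  mu.-integrable setT (fun z => (\1_A z)%:E).
Proof.
move=> mA muA; apply/integrableP; split.
  by apply/measurable_EFinP; exact: measurable_indic.
under eq_integral do rewrite gee0_abs ?lee_fin//.
by rewrite integral_indic// setIT.
Qed.

End IntegralEFin.

Section KineticData.
Context (R : realType) (n : nat).
Local Notation E := (Rspace R (1 + n + n)).
Implicit Types (mu : {measure set E -> \bar R}) (f : E -> R) (G S : 'I_n -> E -> R).

Record kinetic_data mu f G S : Prop := KineticData {
  kd_leb : is_lebesgue mu;
  kd_f : L2 mu f;
  kd_G : forall i, L2 mu (G i);
  kd_pd : forall i, weak_pd mu (vidx i) f (G i);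
  kd_S : forall i, L2 mu (S i);
  kd_eq : kinetic_eq mu f S }.

(** The function $F$ of the overview, with sums of absolute values in place of Euclidean norms;
    [src_le_euclid] makes the conversion at the end. *)
Definition src G S (z : E) : R := \sum_i (`|G i z| + `|S i z|).

(** The half-widths $8s^{w_j}$ match the support condition in [bump]: every product of bumps at
    scale [s] vanishes off this set. *)
Definition kslab (z0 : 'rV[R]_(1 + n + n)) (s : R) : set E :=
  slab z0 (fun j => 8 * s ^+ weight j).

Lemma src_ge0 G S z : 0 <= src G S z.
Proof. by apply: sumr_ge0 => i _; rewrite addr_ge0. Qed.

Lemma normG_le_src G S i z : `|G i z| <= src G S z.
Proof.
rewrite /src (bigD1 i)//= -addrA lerDl; apply: addr_ge0 => //.
by apply: sumr_ge0 => j _; exact: addr_ge0.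
Qed.

Lemma normS_le_src G S z : \sum_i `|S i z| <= src G S z.
Proof. by apply: ler_sum => i _; rewrite lerDr. Qed.

Lemma L2_measurable mu f : L2 mu f -> measurable_fun setT f.
Proof. by case. Qed.

Lemma Lnorm2_sqr mu f :
  (\int[mu]_z ((f z) ^+ 2)%:E = (Lnorm mu 2%:E (EFin \o f)) ^+ 2)%E.
Proof.
rewrite unlock /=.
have -> : (\int[mu]_x (`|(f x)%:E| `^ 2) = \int[mu]_z ((f z) ^+ 2)%:E)%E.
  apply: eq_integral => z _; rewrite poweR_EFin; congr EFin.
  by rewrite (powR_mulrn 2)// real_normK// num_real.
have i0 : (0 <= \int[mu]_z ((f z) ^+ 2)%:E)%E.
  by apply: integral_ge0 => z _; rewrite lee_fin sqr_ge0.
rewrite -[RHS]/(_ * _)%E -poweRD; last first.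
  by apply: add_neq0_poweRD_def; rewrite (_ : 2^-1 + 2^-1 = 1)%R ?oner_neq0//; field.
by rewrite (_ : 2^-1 + 2^-1 = 1)%R ?poweRe1//; field.
Qed.

Lemma L2_sqr_integrable mu f : L2 mu f ->
  mu.-integrable setT (fun z => ((f z) ^+ 2)%:E).
Proof.
move=> Lf; have [mf Lf2] := Lf; apply/integrableP; split.
  by apply/measurable_EFinP; exact: measurable_funX.
under eq_integral do rewrite gee0_abs ?lee_fin ?sqr_ge0//.
rewrite Lnorm2_sqr -[X in (X < _)%E]/(_ * _)%E; apply: lte_mul_pinfty => //; first exact: Lnorm_ge0.
by rewrite ge0_fin_numE//; exact: Lnorm_ge0.
Qed.

Lemma measurable_kslab z0 s : measurable (kslab z0 s).
Proof. exact: measurable_slab. Qed.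

Lemma kslab_measure mu z0 s : is_lebesgue mu -> 0 < s ->
  (mu (kslab z0 s) <= (32 ^+ (1 + n + n) * s ^+ (4 * n + 2))%:E)%E.
Proof.
move=> Lmu s0; apply: (le_trans (slab_ub z0 Lmu _)).
  by move=> j; rewrite mulr_gt0// exprn_gt0.
rewrite lee_fin -prod_weight -[X in 32 ^+ X](card_ord) -prodr_const -big_split/=.
by apply: ler_prod => j _; rewrite !mulr_ge0 ?exprn_ge0 ?(ltW s0)//= mulrA ler_pM2r ?exprn_gt0//; lra.
Qed.

Lemma tens_kslab (h : 'I_(1 + n + n) -> R -> R) : (forall j, bump (h j)) ->
  exists2 C : R, 0 <= C & forall z0 s z, 0 < s ->
    `|tens h z0 s z| <= C * \1_(kslab z0 s) z.
Proof.
move=> bh; have [C C0 HC] := tens_bound bh; exists C => // z0 s z s0.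
have [->|t0] := eqVneq (tens h z0 s z) 0; first by rewrite normr0 mulr_ge0.
rewrite indicE mem_set ?mulr1// => j.
by rewrite -coordk_le//; exact: tens_neq0 t0 j.
Qed.

Lemma measurable_coordk z0 s j : measurable_fun setT (coordk z0 s j : E -> R).
Proof.
rewrite /coordk /lin; under eq_fun do rewrite !mxE.
apply: measurable_funM => //; apply: measurable_funB.
  by apply: measurable_funB => //; exact: measurable_coord.
by apply: measurable_funM => //; apply: measurable_funB => //; exact: measurable_coord.
Qed.

Lemma measurable_tens (h : 'I_(1 + n + n) -> R -> R) z0 s : (forall j, smooth1 (h j)) ->
  measurable_fun setT (tens h z0 s : E -> R).
Proof.
move=> sh; apply: measurable_prod => j _.
apply: measurableT_comp; last exact: measurable_coordk.
by apply: continuous_measurable_fun; exact: smooth1_continuous.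
Qed.

Lemma integrable_indic_kslab mu z0 s : is_lebesgue mu -> 0 < s ->
  mu.-integrable setT (fun z => (\1_(kslab z0 s) z)%:E).
Proof.
move=> Lmu s0; apply: integrable_indic_fin; first exact: measurable_kslab.
by rewrite (le_lt_trans (kslab_measure z0 Lmu s0))// ltry.
Qed.

(** On a set of finite measure $|g|\le g^2+1$ does the work of the Cauchy-Schwarz inequality. *)
Lemma integrable_mul_kslab mu g z0 s : is_lebesgue mu -> 0 < s -> L2 mu g ->
  mu.-integrable setT (fun z => (g z * \1_(kslab z0 s) z)%:E).
Proof.
move=> Lmu s0 Lg.
apply: (@le_integrable _ E R mu setT measurableT _
  (fun z => ((g z) ^+ 2 + \1_(kslab z0 s) z)%:E)).
- apply/measurable_EFinP/measurable_funM; first exact: L2_measurable Lg.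
  exact: measurable_indic (measurable_kslab _ _).
- move=> z _; rewrite lee_fin normrM [leRHS]ger0_norm ?addr_ge0 ?sqr_ge0//.
  rewrite indicE; case: (z \in _); last by rewrite normr0 mulr0 addr0 sqr_ge0.
  rewrite mulr1n normr1 mulr1 -(real_normK (num_real (g z))).
  have := sqr_ge0 (`|g z| - 1); have := normr_ge0 (g z); nra.
- under eq_fun do rewrite EFinD.
  by apply: integrableD => //; [exact: L2_sqr_integrable|exact: integrable_indic_kslab].
Qed.

Lemma integrable_mul_tens mu g h z0 s : is_lebesgue mu -> 0 < s -> L2 mu g ->
  (forall j, bump (h j)) ->
  mu.-integrable setT (fun z => (g z * tens h z0 s z)%:E).
Proof.
move=> Lmu s0 Lg bh; have [C C0 HC] := tens_kslab bh.
apply: (@le_integrable _ E R mu setT measurableT _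
  (fun z => C%:E * (g z * \1_(kslab z0 s) z)%:E)%E).
- apply/measurable_EFinP/measurable_funM; first exact: L2_measurable Lg.
  by apply: measurable_tens => j; case: (bh j).
- move=> z _; rewrite -EFinM !abse_EFin lee_fin !normrM (ger0_norm C0) mulrCA.
  by rewrite ler_wpM2l// (ger0_norm (_ : 0 <= \1_(kslab z0 s) z))// HC.
- by apply: integrableZl => //; exact: integrable_mul_kslab.
Qed.

Lemma measurable_src mu f G S : kinetic_data mu f G S -> measurable_fun setT (src G S).
Proof.
move=> KD; apply: measurable_sum => i; apply: measurable_funD; apply: measurableT_comp => //.
  exact: L2_measurable (kd_G KD i).
exact: L2_measurable (kd_S KD i).
Qed.

(* The gain is the factor [s], together with the absence of [f] on the right. *)
Definition small (Phi : 'rV[R]_(1 + n + n) -> R -> 'rV[R]_(1 + n + n) -> R) :=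
  exists2 C : R, 0 <= C & forall mu f G S, kinetic_data mu f G S ->
  forall z0 s, 0 < s -> mu.-integrable setT (fun z => (f z * Phi z0 s z)%:E) /\
  (`|\int[mu]_z (f z * Phi z0 s z)%:E| <=
    (C * s)%:E * \int[mu]_z (src G S z * \1_(kslab z0 s) z)%:E)%E.

Lemma smallD P Q : small P -> small Q -> small (fun z0 s z => P z0 s z + Q z0 s z).
Proof.
move=> [C C0 HP] [D D0 HQ]; exists (C + D); first exact: addr_ge0.
move=> mu f G S KD z0 s s0; have [iP bP] := HP _ _ _ _ KD z0 s s0.
have [iQ bQ] := HQ _ _ _ _ KD z0 s s0.
have E0 : (fun z => (f z * (P z0 s z + Q z0 s z))%:E) =
    (fun z => (f z * P z0 s z)%:E + (f z * Q z0 s z)%:E)%E.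
  by apply/funext => z; rewrite mulrDr EFinD.
rewrite E0; split; first exact: integrableD.
rewrite integralD//; apply: (le_trans (lee_abs_add _ _)).
rewrite mulrDl EFinD ge0_muleDl ?lee_fin ?mulr_ge0 ?(ltW s0)//.
exact: leeD.
Qed.

Lemma smallZ c P : small P -> small (fun z0 s z => c * P z0 s z).
Proof.
move=> [C C0 HP]; exists (`|c| * C); first exact: mulr_ge0.
move=> mu f G S KD z0 s s0; have [iP bP] := HP _ _ _ _ KD z0 s s0.
have E0 : (fun z => (f z * (c * P z0 s z))%:E) =
    (fun z => c%:E * (f z * P z0 s z)%:E)%E.
  by apply/funext => z; rewrite mulrCA EFinM.
rewrite E0; split; first exact: integrableZl.
rewrite integralZl// abseM -mulrA EFinM -muleA abse_EFin.
by apply: lee_wpmul2l => //; rewrite lee_fin.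
Qed.

Lemma small0 : small (fun _ _ _ => 0).
Proof.
exists 0 => // mu f G S KD z0 s s0.
have -> : (fun z => (f z * 0)%:E) = (cst 0%E : E -> \bar R).
  by apply/funext => z; rewrite mulr0.
by split; [exact: integrable0|rewrite integral0 abse0 mul0r mul0e].
Qed.

Lemma small_sum (I : Type) (r : seq I) P :
  (forall i, small (P i)) -> small (fun z0 s z => \sum_(i <- r) P i z0 s z).
Proof.
move=> HP; elim: r => [|i r IH].
  rewrite (_ : (fun _ _ _ => _) = (fun _ _ _ => 0)); first exact: small0.
  by do 3 apply/funext => ?; rewrite big_nil.
rewrite (_ : (fun _ _ _ => _) = (fun z0 s z => P i z0 s z + \sum_(i <- r) P i z0 s z)).
  exact: smallD.
by do 3 apply/funext => ?; rewrite big_cons.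
Qed.

Lemma bump_opf (h : 'I_(1 + n + n) -> R -> R) j O :
  (forall g : R -> R, bump g -> bump (O g)) -> (forall i, bump (h i)) ->
  forall i, bump (opf j O h i).
Proof. by move=> HO bh i; rewrite /opf; case: ifP => // _; exact: HO. Qed.

Lemma bump_opf_D1 (h : 'I_(1 + n + n) -> R -> R) j : (forall i, bump (h i)) ->
  forall i, bump (opf j (@D1 R) h i).
Proof. by apply: bump_opf => g; exact: bump_derive. Qed.

Lemma bump_opf_mulX (h : 'I_(1 + n + n) -> R -> R) j : (forall i, bump (h i)) ->
  forall i, bump (opf j (@mulX R) h i).
Proof. by apply: bump_opf => g; exact: bump_mulx. Qed.

Lemma bump_smooth1 (h : 'I_(1 + n + n) -> R -> R) : (forall i, bump (h i)) ->
  forall i, smooth1 (h i).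
Proof. by move=> bh i; case: (bh i). Qed.

(** Differentiating the velocity factor is $s\,\partial_{v_i}$ of the product; the weak derivative
    moves it from the test function to $G_i$ and leaves the factor $s$. *)
Lemma small_v h i : (forall j, bump (h j)) -> small (tens (opf (vidx i) (@D1 R) h)).
Proof.
move=> bh; have [C C0 HC] := tens_kslab bh; exists C => // mu f G S KD z0 s s0.
have bh' := bump_opf_D1 (vidx i) bh.
have If := integrable_mul_tens z0 (kd_leb KD) s0 (kd_f KD) bh'.
split => //.
have := kd_pd KD i (test_fun_tens z0 s0 bh).
have E0 : (\int[mu]_z (f z * pd (vidx i) (tens h z0 s) z)%:E =
    s^-1%:E * \int[mu]_z (f z * tens (opf (vidx i) (@D1 R) h) z0 s z)%:E)%E.
  rewrite -integralZl//; apply: eq_integral => z _.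
  rewrite pd_v_tens; last exact: bump_smooth1.
  by rewrite -EFinM mulrCA.
rewrite E0 => E1.
have -> : (\int[mu]_z (f z * tens (opf (vidx i) (@D1 R) h) z0 s z)%:E =
   s%:E * - \int[mu]_z (G i z * tens h z0 s z)%:E)%E.
  by rewrite -E1 muleA -EFinM divff ?mul1e// gt_eqF.
rewrite abseM abse_EFin gtr0_norm// abseN mulrC EFinM -muleA.
apply: lee_wpmul2l; first by rewrite lee_fin ltW.
have mF : measurable_fun setT (fun z => src G S z * \1_(kslab z0 s) z).
  apply: measurable_funM; first exact: measurable_src KD.
  exact: measurable_indic (measurable_kslab _ _).
rewrite -integralZ_EFin//; last by move=> z; rewrite mulr_ge0// src_ge0.
apply: abse_integral_le.
- apply: measurable_funM; first exact: L2_measurable (kd_G KD i).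
  by apply: measurable_tens; exact: bump_smooth1.
- exact: measurable_funM.
- move=> z; rewrite normrM mulrCA.
  by apply: ler_pM => //; [exact: normG_le_src|exact: HC].
Qed.

Definition transp h (z0 : 'rV[R]_(1 + n + n)) s z : R := tens (opf (tidx n) (@D1 R) h) z0 s z +
    \sum_i tens (opf (vidx i) (@mulX R) (opf (xidx i) (@D1 R) h)) z0 s z.

(** The transport field on a product is $s^{-2}$ times [transp]. The equation trades it for
    $\partial_v$ tested against $S$, which costs $s^{-1}$, so the net factor is $s^2\cdot
    s^{-1}=s$. *)
Lemma small_transp h : (forall j, bump (h j)) -> small (transp h).
Proof.
move=> bh.
have /choice[C HC] i : exists C : R, 0 <= C /\ forall z0 s z, 0 < s ->
    `|tens (opf (vidx i) (@D1 R) h) z0 s z| <= C * \1_(kslab z0 s) z.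
  by have [C C0 HC] := tens_kslab (bump_opf_D1 (vidx i) bh); exists C.
have C0 i : 0 <= C i by case: (HC i).
exists (\sum_i C i); first exact: sumr_ge0.
move=> mu f G S KD z0 s s0.
have If : mu.-integrable setT (fun z => (f z * transp h z0 s z)%:E).
  rewrite (_ : (fun _ => _) = fun z => ((f z * tens (opf (tidx n) (@D1 R) h) z0 s z)%:E +
     \sum_i (f z * tens (opf (vidx i) (@mulX R) (opf (xidx i) (@D1 R) h)) z0 s z)%:E)%E); last first.
    by apply/funext => z; rewrite sumEFin -EFinD mulrDr mulr_sumr.
  apply: integrableD => //.
    apply: integrable_mul_tens => //; [exact: kd_leb KD|exact: kd_f KD|exact: bump_opf_D1].
  apply: integrable_sum => // i _.
  apply: integrable_mul_tens => //; [exact: kd_leb KD|exact: kd_f KD|].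
  by apply: bump_opf_mulX; exact: bump_opf_D1.
split => //.
have := kd_eq KD (test_fun_tens z0 s0 bh).
have E0 : (\int[mu]_z (f z * (pd (tidx n) (tens h z0 s) z +
    \sum_i z ord0 (vidx i) * pd (xidx i) (tens h z0 s) z)%R)%:E =
    (s^-1 ^+ 2)%:E * \int[mu]_z (f z * transp h z0 s z)%:E)%E.
  rewrite -integralZl//; apply: eq_integral => z _.
  rewrite transport_tens; [|exact: bump_smooth1|by rewrite gt_eqF].
  by rewrite mulrCA EFinM.
rewrite E0 => E1.
have -> : (\int[mu]_z (f z * transp h z0 s z)%:E =
   (s ^+ 2)%:E * \int[mu]_z (\sum_i S i z * pd (vidx i) (tens h z0 s) z)%R%:E)%E.
  by rewrite -E1 muleA -EFinM exprVn divff ?mul1e// expf_neq0// gt_eqF.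
have s20 : 0 <= s ^+ 2 by rewrite sqr_ge0.
rewrite abseM abse_EFin ger0_norm//.
have mS : measurable_fun setT (fun z => \sum_i S i z * pd (vidx i) (tens h z0 s) z).
  apply: measurable_sum => i.
  apply: measurable_funM; first exact: L2_measurable (kd_S KD i).
  rewrite (_ : pd _ _ = fun z => s^-1 * tens (opf (vidx i) (@D1 R) h) z0 s z); last first.
    by apply/funext => z; rewrite pd_v_tens//; exact: bump_smooth1.
  by apply: measurable_funM => //; apply: measurable_tens; apply: smooth1_opf_D1; exact: bump_smooth1.
have mF : measurable_fun setT (fun z => src G S z * \1_(kslab z0 s) z).
  apply: measurable_funM; first exact: measurable_src KD.
  exact: measurable_indic (measurable_kslab _ _).
have sC0 : 0 <= (\sum_i C i) * s by rewrite mulr_ge0 ?sumr_ge0// ltW.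
rewrite (_ : _ * _ = (s ^+ 2)%:E * ((s^-1 * (\sum_i C i))%:E *
   \int[mu]_z (src G S z * \1_(kslab z0 s) z)%:E))%E; last first.
  rewrite muleA -EFinM; congr (_%:E * _)%E; field; by rewrite gt_eqF.
apply: lee_wpmul2l; first by rewrite lee_fin.
rewrite -integralZ_EFin//; last 2 first.
- by rewrite mulr_ge0 ?sumr_ge0// invr_ge0 ltW.
- by move=> z; rewrite mulr_ge0// src_ge0.
apply: abse_integral_le => //; first exact: measurable_funM.
move=> z; apply: (@le_trans _ _ (s^-1 * \sum_i (`|S i z| * (C i * \1_(kslab z0 s) z)))).
  apply: (le_trans (ler_norm_sum _ _ _)).
  rewrite mulr_sumr; apply: ler_sum => i _.
  rewrite pd_v_tens; last exact: bump_smooth1.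
  rewrite normrM [`|s^-1 * _|]normrM [`|s^-1|]gtr0_norm ?invr_gt0// mulrCA.
  apply: ler_wpM2l; first by rewrite invr_ge0 ltW.
  by apply: ler_wpM2l => //; case: (HC i) => _; exact.
rewrite -mulrA; apply: ler_wpM2l; first by rewrite invr_ge0 ltW.
apply: (@le_trans _ _ ((\sum_i `|S i z|) * ((\sum_i C i) * \1_(kslab z0 s) z))).
  rewrite mulr_suml; apply: ler_sum => i _; apply: ler_wpM2l => //.
  by apply: ler_wpM2r => //; rewrite (bigD1 i)//= lerDl sumr_ge0.
rewrite mulrCA; apply: ler_wpM2l; first exact: sumr_ge0.
by apply: ler_wpM2r => //; exact: normS_le_src.
Qed.

(** The relation $[D,x]=1$ in one factor; its first term is what makes the position derivative
    appear in [small_x]. *)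
Lemma D1_mulX (g : R -> R) : smooth1 g -> D1 (mulX g) = fun x => g x + mulX (D1 g) x.
Proof.
move=> sg; apply/funext => x; rewrite /D1 /mulX derive1E.
rewrite (_ : (fun x => x * g x) = (id : R -> R) * g)//.
have dg : derivable g x 1 by exact: smooth1_derivable.
refine (etrans (deriveM (@derivable_id R R x 1) dg) _).
by rewrite derive_id derive1E /GRing.scale/= mulr1 addrC.
Qed.

(* The commutator identity d_x = [d_v, d_t + v . d_x] in rescaled coordinates. *)
Lemma small_x h i : (forall j, bump (h j)) -> small (tens (opf (xidx i) (@D1 R) h)).
Proof.
move=> bh; pose Dv := opf (vidx i) (@D1 R).
have bDv : forall j, bump (Dv h j) by exact: bump_opf_D1.
have E0 : tens (opf (xidx i) (@D1 R) h) = fun z0 s z =>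
   (tens (Dv (opf (tidx n) (@D1 R) h)) z0 s z +
    \sum_k tens (Dv (opf (vidx k) (@mulX R) (opf (xidx k) (@D1 R) h))) z0 s z)
   + (-1) * transp (Dv h) z0 s z.
  apply/funext => z0; apply/funext => s; apply/funext => z.
  rewrite /transp /Dv opfC ?tidx_neq_v 1?eq_sym ?tidx_neq_v// mulN1r opprD addrACA subrr add0r.
  (* Only the summand of index [i] fails to commute with the velocity derivative; all others cancel
     in pairs. *)
  rewrite (bigD1 i)//= [X in _ = _ - X](bigD1 i)//= opprD addrACA -sumrB.
  rewrite [X in _ = _ + X]big1 ?addr0; last first.
    move=> k ki; rewrite opfC ?(inj_eq (@vidx_inj n)) 1?eq_sym//.
    by rewrite [opf (vidx i) _ (opf (xidx k) _ _)]opfC ?subrr// eq_sym xidx_neq_v.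
  rewrite [opf (xidx i) _ (opf (vidx i) _ h)]opfC ?xidx_neq_v// !opf_opf.
  set g := opf (xidx i) _ h.
  have sg : smooth1 (g (vidx i)).
    by have := bump_opf_D1 (xidx i) bh (vidx i); case.
  have -> : opf (vidx i) (fun k => D1 (mulX k)) g =
            opf (vidx i) (fun k => k + mulX (D1 k)) g.
    by apply/funext => k; rewrite /opf; case: eqP => // ->; rewrite D1_mulX.
  rewrite tensB addrK; congr (tens _ z0 s z).
  by apply/funext => k; rewrite [RHS]/opf; case: ifP.
rewrite E0; apply: smallD; last by apply: smallZ; exact: small_transp.
apply: smallD; first by apply: small_v; exact: bump_opf_D1.
by apply: small_sum => k; apply: small_v; apply: bump_opf_mulX; exact: bump_opf_D1.
Qed.

(** The time derivative is [transp] minus position derivatives multiplied by velocities. The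
    velocity is absorbed into the corresponding factor, which stays a bump, and [small_x]
    applies. *)
Lemma small_t h : (forall j, bump (h j)) -> small (tens (opf (tidx n) (@D1 R) h)).
Proof.
move=> bh.
have E0 : tens (opf (tidx n) (@D1 R) h) = fun z0 s z =>
   transp h z0 s z + (-1) * \sum_k tens (opf (xidx k) (@D1 R) (opf (vidx k) (@mulX R) h)) z0 s z.
  apply/funext => z0; apply/funext => s; apply/funext => z.
  rewrite /transp mulN1r -addrA -sumrB big1 ?addr0// => k _.
  by rewrite opfC ?subrr// eq_sym xidx_neq_v.
rewrite E0; apply: smallD; first exact: small_transp.
apply: smallZ; apply: small_sum => k; apply: small_x; exact: bump_opf_mulX.
Qed.

Lemma small_D1 h j : (forall j, bump (h j)) -> small (tens (opf j (@D1 R) h)).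
Proof.
move=> bh; move: j; apply: splitP_kin => [|i|i]; [exact: small_t|exact: small_x|exact: small_v].
Qed.

End KineticData.

(** * Mean oscillation over kinetic slabs *)

Section DoubleIntegral.
Context d (T : measurableType d) (R : realType)
  (mu : {sigma_finite_measure set T -> \bar R}).
Implicit Types (phi psi k : T * T -> R) (u : T -> R).
Local Open Scope ereal_scope.

Definition dint phi := \int[mu]_x \int[mu]_y (phi (x, y))%:E.

Lemma measurable_dint_inner phi : measurable_fun setT phi -> (forall p, 0 <= phi p)%R ->
  measurable_fun setT (fun x => \int[mu]_y (phi (x, y))%:E).
Proof.
move=> mphi phi0; apply: (measurable_fun_fubini_tonelli_F (EFin \o phi)).
  exact/measurable_EFinP.
by move=> p; rewrite lee_fin.
Qed.

Lemma le_dint phi psi : measurable_fun setT phi -> measurable_fun setT psi ->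
  (forall p, 0 <= phi p <= psi p)%R -> dint phi <= dint psi.
Proof.
move=> mphi mpsi pp.
have phi0 p : (0 <= phi p)%R by case/andP: (pp p).
have psi0 p : (0 <= psi p)%R by apply: le_trans (phi0 p) _; case/andP: (pp p).
apply: ge0_le_integral => //.
- by move=> x _; apply: integral_ge0 => y _; rewrite lee_fin.
- exact: measurable_dint_inner.
- exact: measurable_dint_inner.
move=> x _; apply: le_integral_EFin => //.
  exact: measurableT_comp mphi _.
exact: measurableT_comp mpsi _.
Qed.

Lemma dintD phi psi : measurable_fun setT phi -> measurable_fun setT psi ->
  (forall p, 0 <= phi p)%R -> (forall p, 0 <= psi p)%R ->
  dint (fun p => phi p + psi p)%R = dint phi + dint psi.
Proof.
move=> mphi mpsi phi0 psi0; rewrite /dint -ge0_integralD//; last 4 first.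
- by move=> x _; apply: integral_ge0 => y _; rewrite lee_fin.
- exact: measurable_dint_inner.
- by move=> x _; apply: integral_ge0 => y _; rewrite lee_fin.
- exact: measurable_dint_inner.
apply: eq_integral => x _; rewrite integralD_EFin//.
  exact: measurableT_comp mphi _.
exact: measurableT_comp mpsi _.
Qed.

Lemma dintZ c phi : (0 <= c)%R -> measurable_fun setT phi -> (forall p, 0 <= phi p)%R ->
  dint (fun p => c * phi p)%R = c%:E * dint phi.
Proof.
move=> c0 mphi phi0; rewrite /dint -ge0_integralZl_EFin//; last 2 first.
- by move=> x _; apply: integral_ge0 => y _; rewrite lee_fin.
- exact: measurable_dint_inner.
apply: eq_integral => x _; rewrite integralZ_EFin//.
exact: measurableT_comp mphi _.
Qed.

(** One half of Schur's test: a bound on a marginal of the kernel suffices when the density sits on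
    the other variable. The other half, [dint_right], follows by Tonelli's theorem. *)
Lemma dint_left u k c : measurable_fun setT u -> measurable_fun setT k ->
  (forall x, 0 <= u x)%R -> (forall p, 0 <= k p)%R ->
  (forall x, \int[mu]_y (k (x, y))%:E <= c%:E) ->
  dint (fun p => u p.1 * k p)%R <= c%:E * \int[mu]_x (u x)%:E.
Proof.
move=> mu_ mk u0 k0 kc.
have i0 x : 0 <= \int[mu]_y (k (x, y))%:E.
  by apply: integral_ge0 => y _; rewrite lee_fin.
have c0 : (0 <= c)%R by rewrite -lee_fin (le_trans (i0 point) (kc point)).
rewrite -ge0_integralZl_EFin//; last 2 first.
- by move=> x _; rewrite lee_fin.
- exact/measurable_EFinP.
apply: ge0_le_integral => //.
- by move=> x _; apply: integral_ge0 => y _; rewrite lee_fin mulr_ge0.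
- apply: (measurable_dint_inner (phi := fun p => u p.1 * k p)%R).
    by apply: measurable_funM => //; exact: measurableT_comp.
  by move=> p; rewrite mulr_ge0.
- by apply: measurable_funeM; exact/measurable_EFinP.
move=> x _; rewrite /= integralZ_EFin//; last exact: measurableT_comp mk _.
by rewrite muleC lee_wpmul2r// lee_fin.
Qed.

Lemma dint_swap phi : measurable_fun setT phi -> (forall p, 0 <= phi p)%R ->
  dint phi = dint (fun p => phi (p.2, p.1)).
Proof.
move=> mphi phi0; apply: (fubini_tonelli (EFin \o phi)).
  exact/measurable_EFinP.
by move=> p; rewrite lee_fin.
Qed.

Lemma dint_right u k c : measurable_fun setT u -> measurable_fun setT k ->
  (forall x, 0 <= u x)%R -> (forall p, 0 <= k p)%R ->
  (forall y, \int[mu]_x (k (x, y))%:E <= c%:E) ->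
  dint (fun p => u p.2 * k p)%R <= c%:E * \int[mu]_x (u x)%:E.
Proof.
move=> mu_ mk u0 k0 kc; rewrite dint_swap.
- apply: (@dint_left u (fun p => k (p.2, p.1))) => //.
  by apply: measurableT_comp mk _; exact: measurable_swap.
- by apply: measurable_funM => //; exact: measurableT_comp.
- by move=> p; rewrite mulr_ge0.
Qed.

End DoubleIntegral.

Section SlabKernel.
Context (R : realType) (n : nat).
Local Notation E := (Rspace R (1 + n + n)).

Definition kslab_rel (s : R) : set (E * E) := [set p | kslab p.1 s p.2].

Lemma measurable_slope j : measurable_fun setT (fun z : E => slope z j).
Proof.
move: j; apply: splitP_kin => [|i|i].
- by under eq_fun do rewrite slope_t; exact: measurable_cst.
- by under eq_fun do rewrite slope_x; exact: measurable_coord.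
- by under eq_fun do rewrite slope_v; exact: measurable_cst.
Qed.

Lemma measurable_kslab_rel s : measurable (kslab_rel s).
Proof.
have -> : kslab_rel s = \bigcap_(j in [set: 'I_(1 + n + n)])
    [set p : E * E | `|lin p.1 j (p.2 - p.1)| <= 8 * s ^+ weight j].
  by apply/seteqP; split => z /= H j; [move=> _|]; exact: H.
apply: fin_bigcap_measurable => // j _.
have m1 i : measurable_fun setT (fun p : E * E => p.1 ord0 i).
  exact: (measurableT_comp (measurable_coord i) measurable_fst).
have m2 i : measurable_fun setT (fun p : E * E => p.2 ord0 i).
  exact: (measurableT_comp (measurable_coord i) measurable_snd).
have ml : measurable_fun setT (fun p : E * E => lin p.1 j (p.2 - p.1)).
  rewrite /lin; under eq_fun do rewrite !mxE.
  apply: measurable_funB; first exact: measurable_funB.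
  apply: measurable_funM; first exact: measurable_funB.
  exact: (measurableT_comp (measurable_slope j) measurable_fst).
rewrite -[X in measurable X]setTI.
apply: measurable_fun_le => //.
exact: (measurableT_comp (@normr_measurable R setT) ml).
Qed.

(** Normalised indicator of the slab relation. It dominates the mollifiers up to a constant, and
    both its marginals are at most [kbound], uniformly in the scale. *)
Definition kker (s : R) (p : E * E) : R :=
  s^-1 ^+ (4 * n + 2) * \1_(kslab_rel s) p.

Lemma kkerE s z0 z : kker s (z0, z) = s^-1 ^+ (4 * n + 2) * \1_(kslab z0 s) z.
Proof. by rewrite /kker !indicE; congr (_ * _%:R); apply/idP/idP; rewrite !inE. Qed.

Lemma measurable_kker s : measurable_fun setT (kker s).
Proof. by apply: measurable_funM => //; exact: measurable_indic (measurable_kslab_rel s). Qed.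

Lemma kker_ge0 s p : 0 < s -> 0 <= kker s p.
Proof. by move=> s0; rewrite /kker mulr_ge0// exprn_ge0// invr_ge0 ltW. Qed.

(* 288 = 4 * 72, with the constants of [slab_ub] and [kslab_sym]. *)
Definition kbound : R := 288 ^+ (1 + n + n).

(* [kslab] is symmetric up to enlarging the constant: exchanging the two
   points changes the position coordinates by a product of a time and a
   velocity increment, whence 72 = 8 + 8 * 8. *)
Lemma kslab_sym (z0 z : E) (s : R) : 0 < s -> kslab z0 s z ->
  slab z (fun j => 72 * s ^+ weight j)%R z0.
Proof.
move=> s0 H; have s1 k : 0 <= s ^+ k by rewrite exprn_ge0// ltW.
have := H (tidx n); rewrite lin_t weight_t !mxE => ht.
have E0 j : lin z j (z0 - z) = - lin z0 j (z - z0) +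
   (z ord0 (tidx n) - z0 ord0 (tidx n)) * (slope z j - slope z0 j).
  by rewrite /lin !mxE; ring.
move=> j; rewrite E0.
have hs : `|(z ord0 (tidx n) - z0 ord0 (tidx n)) * (slope z j - slope z0 j)| <= 64 * s ^+ weight j.
  move: j; apply: splitP_kin => [|i|i].
  - by rewrite !slope_t subrr mulr0 normr0 mulr_ge0.
  - have := H (vidx i); rewrite lin_v weight_v !mxE !slope_x weight_x normrM => hv.
    have -> : 64 * s ^+ 3 = (8 * s ^+ 2) * (8 * s ^+ 1) by ring.
    exact: ler_pM.
  - by rewrite !slope_v subrr mulr0 normr0 mulr_ge0.
apply: (le_trans (ler_normD _ _)); rewrite normrN.
have := H j; move: (s ^+ weight j) (s1 (weight j)) hs => w; lra.
Qed.

Lemma slab_measure_le (mu : {measure set E -> \bar R}) (z0 : E) (s : R) : is_lebesgue mu -> 0 < s ->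
  (mu (slab z0 (fun j => 72 * s ^+ weight j)%R) <= (kbound * s ^+ (4 * n + 2))%:E)%E.
Proof.
move=> Lmu s0; apply: (le_trans (slab_ub z0 Lmu _)).
  by move=> j; rewrite mulr_gt0// exprn_gt0.
rewrite lee_fin -prod_weight /kbound -[X in 288 ^+ X](card_ord) -prodr_const -big_split/=.
apply: ler_prod => j _.
have : 0 <= s ^+ weight j by rewrite exprn_ge0// ltW.
by move=> w0; apply/andP; split; [rewrite !mulr_ge0|lra].
Qed.

Lemma kslab_measure_le (mu : {measure set E -> \bar R}) (z0 : E) (s : R) : is_lebesgue mu -> 0 < s ->
  (mu (kslab z0 s) <= (kbound * s ^+ (4 * n + 2))%:E)%E.
Proof.
move=> Lmu s0; apply: le_trans (slab_measure_le z0 Lmu s0).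
apply: le_measure; rewrite ?inE; [exact: measurable_kslab|exact: measurable_slab|].
move=> z Hz j; apply: (le_trans (Hz j)).
have : 0 <= s ^+ weight j by rewrite exprn_ge0// ltW.
lra.
Qed.

Lemma kker_integral2 (mu : {measure set E -> \bar R}) (s : R) (z0 : E) : is_lebesgue mu -> 0 < s ->
  (\int[mu]_z (kker s (z0, z))%:E <= kbound%:E)%E.
Proof.
move=> Lmu s0; have mk := measurable_kslab z0 s.
have sQ : 0 < s ^+ (4 * n + 2) by rewrite exprn_gt0.
have sV : 0 <= s^-1 ^+ (4 * n + 2) by rewrite exprn_ge0// invr_ge0 ltW.
under eq_integral do rewrite kkerE.
rewrite integralZ_EFin//.
rewrite integral_indic// setIT.
apply: (le_trans (lee_wpmul2l _ (kslab_measure_le z0 Lmu s0))); first by rewrite lee_fin.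
by rewrite -EFinM lee_fin exprVn mulrCA mulVf ?mulr1// gt_eqF.
Qed.

(** The centres whose slab contains [z] do not form a slab, but by [kslab_sym] they lie in a larger
    one centred at [z]. *)
Lemma kker_integral1 (mu : {measure set E -> \bar R}) (s : R) (z : E) : is_lebesgue mu -> 0 < s ->
  (\int[mu]_z0 (kker s (z0, z))%:E <= kbound%:E)%E.
Proof.
move=> Lmu s0; have mk := measurable_slab z (fun j => 72 * s ^+ weight j)%R.
have sQ : 0 < s ^+ (4 * n + 2) by rewrite exprn_gt0.
have sV : 0 <= s^-1 ^+ (4 * n + 2) by rewrite exprn_ge0// invr_ge0 ltW.
apply: (@le_trans _ _ (\int[mu]_z0 (s^-1 ^+ (4 * n + 2) *
    \1_(slab z (fun j => 72 * s ^+ weight j)%R) z0)%:E)%E).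
  apply: le_integral_EFin.
  - by apply: measurableT_comp (measurable_kker s) _.
  - by apply: measurable_funM => //; exact: measurable_indic.
  move=> z0; rewrite kker_ge0//= kkerE ler_wpM2l// !indicE.
  case: (boolP (z \in kslab z0 s)) => // zk.
  by rewrite mem_set//; apply: kslab_sym => //; rewrite inE in zk.
rewrite integralZ_EFin//.
rewrite integral_indic// setIT.
apply: (le_trans (lee_wpmul2l _ (slab_measure_le z Lmu s0))); first by rewrite lee_fin.
by rewrite -EFinM lee_fin exprVn mulrCA mulVf ?mulr1// gt_eqF.
Qed.

End SlabKernel.

Section Oscillation.
Context (R : realType) (n : nat).
Local Notation E := (Rspace R (1 + n + n)).
Local Notation cb m := (@cube R (1 + n + n) m).
Context (mu : {sigma_finite_measure set E -> \bar R}).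
Implicit Types (g h k : E -> R) (m : nat) (r : R).

(** The cube restricts the centre only. There the slopes are bounded, so slabs shrink uniformly to
    their centres as [r] tends to 0. *)
Definition oscker m r g (p : E * E) : R :=
  \1_(cb m) p.1 * (`|g p.2 - g p.1| * kker r p).

(* Mean continuity of [g] along the kinetic slabs as the scale tends to 0; it
   plays the role of Lebesgue's differentiation theorem. *)
Definition vanishing g := measurable_fun setT g /\
  forall m (e : R), 0 < e -> exists2 r0 : R, 0 < r0 &
    forall r, 0 < r <= r0 -> (dint mu (oscker m r g) <= e%:E)%E.

Lemma measurable_cube m : measurable (cb m).
Proof. exact: measurable_hbox. Qed.

Lemma measurable_oscker m r g : measurable_fun setT g -> measurable_fun setT (oscker m r g).
Proof.
move=> mg; apply: measurable_funM.
  exact: (measurableT_comp (measurable_indic (measurable_cube m)) measurable_fst).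
apply: measurable_funM; last exact: measurable_kker.
apply: (measurableT_comp (@normr_measurable R setT)).
by apply: measurable_funB;
  [exact: (measurableT_comp mg measurable_snd)|exact: (measurableT_comp mg measurable_fst)].
Qed.

Lemma oscker_ge0 m r g p : 0 < r -> 0 <= oscker m r g p.
Proof.
by move=> r0; rewrite /oscker; apply: mulr_ge0 => //; apply: mulr_ge0 => //; exact: kker_ge0.
Qed.

Lemma vanishing_dom g h k : vanishing g -> vanishing h -> measurable_fun setT k ->
  (forall z z0, `|k z - k z0| <= `|g z - g z0| + `|h z - h z0|) -> vanishing k.
Proof.
move=> [mg vg] [mh vh] mk kgh; split; first exact: mk.
move=> m e e0.
have e2 : 0 < e / 2 by rewrite divr_gt0.
have [r1 r10 H1] := vg m _ e2; have [r2 r20 H2] := vh m _ e2.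
exists (Num.min r1 r2); first by rewrite lt_min r10.
move=> r /andP[r0]; rewrite le_min => /andP[rr1 rr2].
apply: (@le_trans _ _ (dint mu (fun p => oscker m r g p + oscker m r h p))).
  apply: le_dint; first exact: measurable_oscker.
    by apply: measurable_funD; exact: measurable_oscker.
  move=> p; rewrite oscker_ge0//= /oscker -mulrDr ler_wpM2l// -mulrDl.
  by apply: ler_wpM2r; [exact: kker_ge0|exact: kgh].
rewrite dintD; [|exact: measurable_oscker|exact: measurable_oscker|
  by move=> p; exact: oscker_ge0|by move=> p; exact: oscker_ge0].
rewrite [e in leRHS]splitr EFinD; apply: leeD; [apply: H1|apply: H2]; exact/andP.
Qed.

Lemma vanishing_cst (c : R) : vanishing (fun=> c).
Proof.
split; first exact: measurable_cst.
move=> m e e0; exists 1 => // r /andP[r0 _].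
rewrite (_ : oscker m r _ = fun=> 0); last first.
  by apply/funext => p; rewrite /oscker subrr normr0 mul0r mulr0.
rewrite /dint; under eq_integral do rewrite integral0.
by rewrite integral0 lee_fin ltW.
Qed.

Lemma vanishingD g h : vanishing g -> vanishing h -> vanishing (fun z => g z + h z).
Proof.
move=> vg vh; apply: (vanishing_dom vg vh).
  by apply: measurable_funD; [case: vg|case: vh].
move=> z z0; rewrite opprD addrACA; exact: ler_normD.
Qed.

Lemma vanishingZ (c : R) g : vanishing g -> vanishing (fun z => c * g z).
Proof.
move=> [mg vg]; split; first exact: measurable_funM.
move=> m e e0; have c1 : 0 < `|c| + 1 by rewrite ltr_wpDl.
have [r0 r00 H] := vg m (e / (`|c| + 1)) (divr_gt0 e0 c1).
exists r0 => // r rr0; have r1 : 0 < r by case/andP: rr0.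
rewrite (_ : oscker m r _ = fun p => `|c| * oscker m r g p); last first.
  by apply/funext => p; rewrite /oscker -mulrBr normrM; ring.
rewrite dintZ//; [|exact: measurable_oscker|by move=> p; exact: oscker_ge0].
apply: (le_trans (lee_wpmul2l _ (H _ rr0))); first by rewrite lee_fin.
by rewrite -EFinM lee_fin mulrCA ger_pMr// ler_pdivrMr// mul1r lerDl.
Qed.

Lemma vanishing_sum (I : Type) (s : seq I) (g : I -> E -> R) :
  (forall i, vanishing (g i)) -> vanishing (fun z => \sum_(i <- s) g i z).
Proof.
move=> vg; elim: s => [|i s IH].
  rewrite (_ : (fun z => _) = fun=> 0); first exact: vanishing_cst.
  by apply/funext => z; rewrite big_nil.
rewrite (_ : (fun z => _) = (fun z => g i z + \sum_(j <- s) g j z)).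
  exact: vanishingD (vg i) IH.
by apply/funext => z; rewrite big_cons.
Qed.

(** For $r\le1$ every power $r^{w_j}$ is at most $r$: the width contributes $8r$, and the drift at
    most $8r^2\cdot m\le 8mr$. *)
Lemma kslab_cube m r z0 z : 0 < r <= 1 -> cb m z0 -> kslab z0 r z ->
  (forall j, `|z ord0 j - z0 ord0 j| <= (8 + 8 * m%:R) * r).
Proof.
move=> /andP[r0 r1] cz0 kz j.
have m0 : 0 <= m%:R :> R by [].
have z0m i : `|z0 ord0 i| <= m%:R.
  by have := cz0 i; rewrite !mxE => /andP[h1 h2]; rewrite ler_norml h2 ltW.
have sl : `|slope z0 j| <= m%:R.
  by move: j; apply: splitP_kin => [|i|i]; rewrite ?slope_t ?slope_x ?slope_v ?normr0.
have := kz (tidx n); rewrite lin_t weight_t !mxE => ht.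
have := kz j; rewrite /lin !mxE => hj.
have pw q : (0 < q)%N -> r ^+ q <= r.
  by case: q => // q _; rewrite exprS ger_pMr// exprn_ile1// ltW.
have w0 : (0 < weight j)%N.
  by move: (j); apply: splitP_kin => [|i|i]; rewrite ?weight_t ?weight_x ?weight_v.
have -> : z ord0 j - z0 ord0 j = (z ord0 j - z0 ord0 j -
   (z ord0 (tidx n) - z0 ord0 (tidx n)) * slope z0 j) +
   (z ord0 (tidx n) - z0 ord0 (tidx n)) * slope z0 j by ring.
apply: (le_trans (ler_normD _ _)); rewrite [leRHS]mulrDl; apply: lerD.
  by apply: (le_trans hj); rewrite ler_pM2l// pw.
rewrite normrM mulrAC; apply: ler_pM => //.
by apply: (le_trans ht); rewrite ler_pM2l// pw.
Qed.

Lemma cube_enlarge m r z0 z : 0 < r <= 1 -> cb m z0 -> kslab z0 r z ->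
  cb (9 * m + 9)%N z.
Proof.
move=> r01 cz0 kz j; have := kslab_cube r01 cz0 kz j.
have := cz0 j; rewrite !mxE => /andP[h1 h2].
have m0 : 0 <= m%:R :> R by [].
have : (8 + 8 * m%:R) * r <= 8 + 8 * m%:R by case/andP: r01 => _ r1; rewrite ger_pMr//; lra.
rewrite ler_norml natrD natrM => h3 /andP[h4 h5].
by apply/andP; split; lra.
Qed.

Lemma cube_mono m z : cb m z -> cb (9 * m + 9)%N z.
Proof.
move=> cz j; have := cz j; rewrite !mxE natrD natrM => /andP[h1 h2].
have m0 : 0 <= m%:R :> R by [].
by apply/andP; split; lra.
Qed.

Hypothesis Lmu : is_lebesgue mu.

Lemma kbound_gt0 : 0 < kbound R n.
Proof. by apply: exprn_gt0; rewrite ltr0n. Qed.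

(** Stability under local $L^1$ approximation. Replacing $g$ by $h$ costs $|g-h|$ at both points of
    the kernel; by the two halves of Schur's test each costs [kbound] times an integral over the
    enlarged cube. Hence $e=e/2+e/4+e/4$. *)
Lemma vanishing_approx g : measurable_fun setT g ->
  (forall m (e : R), 0 < e -> exists2 h, vanishing h &
     (\int[mu]_z (`|g z - h z| * \1_(cb m) z)%:E <= e%:E)%E) ->
  vanishing g.
Proof.
move=> mg H; split; first exact: mg.
move=> m e e0.
have kb := kbound_gt0.
have e4 : 0 < e / (4 * kbound R n) by rewrite divr_gt0 ?mulr_gt0.
have e2 : 0 < e / 2 by rewrite divr_gt0.
have [h [mh vh] gh] := H (9 * m + 9)%N _ e4.
have [r0 r00 Hr] := vh m _ e2.
exists (Num.min r0 1); first by rewrite lt_min r00 ltr01.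
move=> r /andP[rp]; rewrite le_min => /andP[rr0 r1].
pose u z := `|g z - h z| * \1_(cb (9 * m + 9)%N) z.
have mu_ : measurable_fun setT u.
  apply: measurable_funM; last exact: measurable_indic (measurable_cube _).
  by apply: (measurableT_comp (@normr_measurable R setT)); exact: measurable_funB.
have u0 z : 0 <= u z by rewrite mulr_ge0.
have mk := @measurable_kker R n r.
have mu1 : measurable_fun setT (fun p : E * E => u p.1 * kker r p).
  by apply: measurable_funM => //; exact: measurableT_comp.
have mu2 : measurable_fun setT (fun p : E * E => u p.2 * kker r p).
  by apply: measurable_funM => //; exact: measurableT_comp.
have u10 p : 0 <= u p.1 * kker r p by rewrite mulr_ge0// kker_ge0.
have u20 p : 0 <= u p.2 * kker r p by rewrite mulr_ge0// kker_ge0.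
apply: (@le_trans _ _ (dint mu (fun p => oscker m r h p + (u p.1 * kker r p + u p.2 * kker r p)))).
  apply: le_dint; first exact: measurable_oscker.
    by apply: measurable_funD; [exact: measurable_oscker|exact: measurable_funD].
  move=> p; rewrite oscker_ge0//=.
  have RHS0 : 0 <= oscker m r h p + (u p.1 * kker r p + u p.2 * kker r p).
    by rewrite !addr_ge0// oscker_ge0.
  rewrite {1}/oscker !indicE; case: (boolP (p.1 \in cb m)) => p1; last by rewrite mul0r.
  rewrite mul1r; rewrite /oscker indicE p1 mul1r.
  case: p p1 {RHS0} => z0 z /=; rewrite inE => p1.
  rewrite kkerE !indicE; case: (boolP (z \in kslab z0 r)); last by rewrite !mulr0 !addr0.
  rewrite inE => zk; rewrite mulr1.
  rewrite /u !indicE (mem_set (cube_mono p1)) (mem_set (cube_enlarge _ p1 zk)) ?rp//.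
  rewrite !mulr1 -!mulrDl ler_wpM2r ?exprn_ge0 ?invr_ge0 ?(ltW rp)//.
  have -> : g z - g z0 = (h z - h z0) + (- (g z0 - h z0) + (g z - h z)) by ring.
  apply: (le_trans (ler_normD _ _)); rewrite lerD2l.
  by apply: (le_trans (ler_normD _ _)); rewrite normrN.
rewrite dintD; [|exact: measurable_oscker|exact: measurable_funD|
  by move=> p; exact: oscker_ge0|by move=> p; exact: addr_ge0].
rewrite dintD//.
have b1 := dint_left mu_ mk u0 (fun p => kker_ge0 p rp) (fun z0 => kker_integral2 z0 Lmu rp).
have b2 := dint_right mu_ mk u0 (fun p => kker_ge0 p rp) (fun z => kker_integral1 z Lmu rp).
have kb0 : (0 <= (kbound R n)%:E)%E by rewrite lee_fin ltW.
have b3 := lee_wpmul2l kb0 gh.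
have -> : e%:E = ((e / 2)%:E + ((kbound R n)%:E * (e / (4 * kbound R n))%:E +
   (kbound R n)%:E * (e / (4 * kbound R n))%:E))%E.
  by rewrite -!EFinM -!EFinD; congr EFin; field; rewrite gt_eqF.
apply: leeD; first by apply: Hr; rewrite rp.
by apply: leeD; [exact: le_trans b1 b3|exact: le_trans b2 b3].
Qed.

(** The indicator oscillates only on slabs that meet both sides of the hyperplane; their centres in
    the cube fill a strip of volume $O(r)$. *)
Lemma vanishing_halfspace j (a : R) : vanishing (\1_[set z : E | z ord0 j <= a]).
Proof.
have mA : measurable [set z : E | z ord0 j <= a].
  rewrite -[X in measurable X]setTI; apply: measurable_fun_le => //.
  exact: measurable_coord.
split; first exact: measurable_indic.
move=> m e e0; have kb := kbound_gt0.
have m0 : 0 <= m%:R :> R by [].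
pose V : R := \prod_(k < 1 + n + n | k != j) (2 * m%:R).
have V0 : 0 <= V by apply: prodr_ge0 => k _; rewrite mulr_ge0.
(* [B * r] will be [kbound] times the volume of the strip. *)
pose B : R := kbound R n * (3 * (8 + 8 * m%:R) * V).
have B0 : 0 <= B by rewrite !mulr_ge0// ?ltW//; lra.
exists (Num.min 1 (e / (B + 1))).
  by rewrite lt_min ltr01 divr_gt0// ltr_wpDl.
move=> r /andP[rp]; rewrite le_min => /andP[r1 re].
pose del := (8 + 8 * m%:R) * r.
have del0 : 0 < del by rewrite mulr_gt0//; lra.
(* Centres of crossing slabs lie within [del] of the hyperplane. Boxes are open on the left, whence
   the larger margin [2 * del] there. *)
pose box : set E := hbox (\row_k (if k == j then a - 2 * del else - m%:R))
                 (\row_k (if k == j then a + del else m%:R)).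
have mb : measurable box by exact: measurable_hbox.
have mk := @measurable_kker R n r.
apply: (@le_trans _ _ (dint mu (fun p => \1_box p.1 * kker r p))).
  apply: le_dint; first by apply: measurable_oscker; exact: measurable_indic.
    apply: measurable_funM => //.
    exact: (measurableT_comp (measurable_indic mb) measurable_fst).
  move=> p; rewrite oscker_ge0//=.
  have RHS0 : 0 <= \1_box p.1 * kker r p by rewrite mulr_ge0// kker_ge0.
  rewrite /oscker indicE; case: (boolP (p.1 \in cb m)) => p1; last by rewrite mul0r.
  case: p p1 RHS0 => z0 z /=; rewrite inE => p1 RHS0; rewrite mul1r kkerE.
  rewrite [\1_(kslab _ _) z]indicE; case: (boolP (z \in kslab z0 r)); last by rewrite !mulr0.
  rewrite inE => zk; rewrite mulr1 ler_wpM2r ?exprn_ge0 ?invr_ge0 ?(ltW rp)//.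
  have := kslab_cube _ p1 zk j; rewrite rp r1 => /(_ isT).
  rewrite -/del ler_norml => /andP[h1 h2].
  rewrite !indicE.
  have bz0 : a - 2 * del < z0 ord0 j <= a + del -> box z0.
    move=> H k; rewrite !mxE; case: eqP => [->//|_].
    by have := p1 k; rewrite !mxE.
  have memE (y : E) : (y \in [set z : E | z ord0 j <= a]) = (y ord0 j <= a).
    by apply/idP/idP; rewrite inE.
  rewrite !memE; have [za|za] := leP (z ord0 j) a; have [z0a|z0a] := leP (z0 ord0 j) a;
    rewrite /= ?mulr1n ?mulr0n ?subrr ?normr0//.
  - by rewrite subr0 normr1 mem_set//; apply: bz0; apply/andP; split; lra.
  - by rewrite sub0r normrN normr1 mem_set//; apply: bz0; apply/andP; split; lra.
have b1 := dint_left (measurable_indic mb) mk (fun x => ler0n _ _) (fun p => kker_ge0 p rp)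
   (fun z0 => kker_integral2 z0 Lmu rp).
apply: (le_trans b1); rewrite integral_indic// setIT.
have mbox : (mu box <= (3 * del * V)%:E)%E.
  rewrite le_eqVlt; apply/orP; left; apply/eqP.
  refine (etrans (Lmu _) _); first by move=> k; rewrite !mxE; case: ifP => _; lra.
  congr EFin; rewrite (bigD1 j)//=; congr (_ * _); first by rewrite !mxE eqxx; ring.
  by apply: eq_bigr => k /negbTE kj; rewrite !mxE kj; ring.
apply: (le_trans (lee_wpmul2l _ mbox)); first by rewrite lee_fin ltW.
rewrite -EFinM lee_fin.
have -> : kbound R n * (3 * del * V) = B * r by rewrite /B /del; ring.
move: re; rewrite ler_pdivlMr ?ltr_wpDl// => re; apply: le_trans re.
by rewrite mulrDr mulrC lerDl mulr1 ltW.
Qed.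

End Oscillation.

Import HBSimple.
Local Opaque vanishing.

Section OscillationSets.
Context (R : realType) (n : nat).
Local Notation E := (Rspace R (1 + n + n)).
Local Notation cb m := (@cube R (1 + n + n) m).
Context (mu : {sigma_finite_measure set E -> \bar R}).
Hypothesis Lmu : is_lebesgue mu.
Implicit Types (A B : set E) (f g h : E -> R).

Lemma cube_finite m : (mu (cb m) < +oo)%E.
Proof.
apply: (@le_lt_trans _ _ ((2 * m%:R) ^+ (1 + n + n))%:E%E); last exact: ltry.
rewrite le_eqVlt; apply/orP; left; apply/eqP; exact: cube_measure.
Qed.

Lemma vanishing_setI A B : measurable A -> measurable B ->
  vanishing mu \1_A -> vanishing mu \1_B -> vanishing mu \1_(A `&` B).
Proof.
move=> mA mB vA vB; apply: (vanishing_dom vA vB).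
  by apply: measurable_indic; exact: measurableI.
move=> z z0; rewrite !indicE !in_setI.
by case: (z \in A); case: (z \in B); case: (z0 \in A); case: (z0 \in B);
  rewrite /= ?subrr ?subr0 ?sub0r ?normrN ?normr0 ?normr1 ?addr0 ?add0r ?ler01 ?lerDr.
Qed.

Lemma vanishing_setC A : measurable A -> vanishing mu \1_A -> vanishing mu \1_(~` A).
Proof.
move=> mA vA; rewrite (_ : \1_(~` A) = fun z => 1 + -1 * \1_A z).
  by apply: vanishingD; [exact: vanishing_cst|exact: vanishingZ].
apply/funext => z; rewrite !indicE in_setC.
by case: (z \in A) => /=; rewrite ?mulr1n ?mulr0n; ring.
Qed.

Lemma vanishing_setU A B : measurable A -> measurable B ->
  vanishing mu \1_A -> vanishing mu \1_B -> vanishing mu \1_(A `|` B).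
Proof.
move=> mA mB vA vB; rewrite -[A `|` B]setCK setCU.
apply: vanishing_setC; first by apply: measurableI; exact: measurableC.
by apply: vanishing_setI; [exact: measurableC|exact: measurableC|
  exact: vanishing_setC|exact: vanishing_setC].
Qed.

Lemma vanishing_hbox (a b : 'rV[R]_(1 + n + n)) : vanishing mu \1_(hbox a b : set E).
Proof.
pose H (s : seq 'I_(1 + n + n)) : set E :=
  [set z | forall j, j \in s -> a ord0 j < z ord0 j <= b ord0 j].
suff HH s : measurable (H s) /\ vanishing mu \1_(H s).
  have := (HH (enum 'I_(1 + n + n))).2; congr (vanishing _ \1_ _).
  by apply/seteqP; split => z /= Hz j; [apply: Hz; rewrite mem_enum|move=> _; exact: Hz].
elim: s => [|i s [mH vH]].
  rewrite (_ : H [::] = setT); last by apply/seteqP; split => // z _ j.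
  split; first exact: measurableT.
  by rewrite indicT; exact: vanishing_cst.
have -> : H (i :: s) = (~` [set z : E | z ord0 i <= a ord0 i] `&`
    [set z : E | z ord0 i <= b ord0 i]) `&` H s.
  apply/seteqP; split => z /=.
    move=> Hz; split; last by move=> j js; apply: Hz; rewrite inE js orbT.
    by have := Hz i (mem_head _ _) => /andP[h1 h2]; split => //; apply/negP; rewrite -ltNge.
  move=> [[/negP h1 h2] h3] j; rewrite inE => /orP[/eqP ->|]; last exact: h3.
  by rewrite -ltNge in h1; rewrite h1.
have mh (c : R) : measurable [set z : E | z ord0 i <= c].
  rewrite -[X in measurable X]setTI; apply: measurable_fun_le => //.
  exact: measurable_coord.
have mI : measurable (~` [set z : E | z ord0 i <= a ord0 i] `&` [set z : E | z ord0 i <= b ord0 i]).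
  by apply: measurableI => //; exact: measurableC.
split; first exact: measurableI mI mH.
apply: (vanishing_setI mI mH _ vH).
apply: (vanishing_setI (measurableC (mh _)) (mh _)).
  exact: (vanishing_setC (mh _) (vanishing_halfspace Lmu i _)).
exact: (vanishing_halfspace Lmu i _).
Qed.

(** On a cube, which has finite measure, continuity from above makes the part missed by finitely
    many sets small; local approximation is all that [vanishing_approx] asks for. *)
Lemma vanishing_bigcup (F : (set E)^nat) : (forall i, measurable (F i)) ->
  (forall i, vanishing mu \1_(F i)) -> vanishing mu \1_(\bigcup_i F i).
Proof.
move=> mF vF.
have mU : measurable (\bigcup_i F i) by exact: bigcupT_measurable.
pose U M := \big[setU/set0]_(i < M) F i.
have mUM M : measurable (U M) by exact: bigsetU_measurable.
have vU M : vanishing mu \1_(U M).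
  rewrite /U; elim: M => [|M IH].
    by rewrite big_ord0 indic0; exact: vanishing_cst.
  rewrite big_ord_recr/=; exact: (vanishing_setU (mUM M) (mF M) IH (vF M)).
apply: (vanishing_approx Lmu); first exact: measurable_indic.
move=> m e e0.
pose G M := cb m `&` (\bigcup_i F i `\` U M).
have mG M : measurable (G M).
  by apply: measurableI; [exact: measurable_cube|exact: measurableD].
have G0 : \bigcap_M G M = set0.
  apply/seteqP; split => // z Gz; have [_ [[i _ Fi] _]] := Gz 0 I.
  have [_ [_ nU]] := Gz i.+1 I; apply: nU.
  by rewrite /U -bigcup_mkord; exists i => /=.
have cG : (mu \o G) @ \oo --> mu (\bigcap_M G M).
  apply: nonincreasing_cvg_mu => //.
  - apply: le_lt_trans (cube_finite m); apply: le_measure; rewrite ?inE.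
    + exact: mG.
    + exact: measurable_cube.
    + by move=> z [].
  - by rewrite G0; exact: measurable0.
  - move=> M1 M2 M12; apply/subsetPset => z [cz [Fz nU]]; split => //; split => // U1.
    by apply: nU; move: U1; exact: subset_bigsetU.
rewrite G0 measure0 in cG.
have [M GM] : exists M, (mu (G M) < e%:E)%E.
  move: cG => /fine_cvgP[[M1 _ H1] /cvgrPdist_lt/(_ e e0)[M2 _ H2]].
  exists (maxn M1 M2); have := H1 _ (leq_maxl M1 M2); have := H2 _ (leq_maxr M1 M2).
  rewrite /= sub0r normrN => h2 h1; rewrite -(fineK h1) lte_fin.
  by apply: le_lt_trans h2; exact: ler_norm.
exists \1_(U M); first exact: vU.
apply: (le_trans _ (ltW GM)).
rewrite -[leRHS](_ : \int[mu]_z (\1_(G M) z)%:E = _)%E; last by rewrite integral_indic// setIT.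
apply: le_integral_EFin.
- apply: measurable_funM; last exact: measurable_indic (measurable_cube _).
  by apply: (measurableT_comp (@normr_measurable R setT)); apply: measurable_funB; exact: measurable_indic.
- exact: measurable_indic.
move=> z; rewrite mulr_ge0//= !indicE.
have UF : z \in U M -> z \in \bigcup_i F i.
  by rewrite !inE /U -bigcup_mkord => -[i _ Fi]; exists i.
rewrite /G in_setI in_setD.
case: (boolP (z \in \bigcup_i F i)) => zF; case: (boolP (z \in U M)) => zU;
  case: (z \in cb m); rewrite /= ?mulr0 ?mulr1 ?subrr ?subr0 ?normr0 ?normr1//.
by rewrite UF in zF.
Qed.

Lemma vanishing_measurable A : measurable A -> vanishing mu \1_A.
Proof.
move=> mA; apply: (@dynkin_induction _ E (@boxes R (1 + n + n)) (fun A => vanishing mu \1_A)).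
- reflexivity.
- move=> _ _ [a [b ->]] [a' [b' ->]].
  exists (\row_j Num.max (a ord0 j) (a' ord0 j)), (\row_j Num.min (b ord0 j) (b' ord0 j)).
  apply/seteqP; split => z /=.
    move=> [H1 H2] j; have := H1 j; have := H2 j; rewrite !mxE gt_max le_min.
    by move=> /andP[-> ->] /andP[-> ->].
  by move=> H; split => j; have := H j; rewrite !mxE gt_max le_min => /andP[/andP[h1 h2] /andP[h3 h4]];
    apply/andP.
- rewrite indicT; exact: vanishing_cst.
- move=> _ [a [b ->]]; exact: vanishing_hbox.
- move=> S mS vS; exact: vanishing_setC mS vS.
- move=> F mF _ vF; exact: vanishing_bigcup mF vF.
- exact: mA.
Qed.

Lemma vanishing_sfun (g : {sfun E >-> R}) : vanishing mu (fun z => g z).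
Proof.
rewrite (_ : (fun z => g z) = fun z => \sum_(y <- finmap.enum_fset (fset_set (range g))) (y * \1_(g @^-1` [set y]) z)).
  apply: vanishing_sum => y; apply: vanishingZ; apply: vanishing_measurable.
  exact: measurable_sfunP.
apply/funext => z; rewrite [LHS]fimfunE; exact: fsbig_finite.
Qed.

Lemma vanishing_L2 f : L2 mu f -> vanishing mu f.
Proof.
move=> Lf; have mf := L2_measurable Lf.
apply: (vanishing_approx Lmu) => // m e e0.
have mc := @measurable_cube R n m.
have If : mu.-integrable (cb m) (EFin \o f).
  apply: (@le_integrable _ E R mu (cb m) mc _ (fun z => ((f z) ^+ 2 + \1_(cb m) z)%:E)).
  - by apply/measurable_EFinP; exact: measurable_funTS.
  - move=> z cz; rewrite lee_fin indicE mem_set// mulr1n [leRHS]ger0_norm ?addr_ge0 ?sqr_ge0//.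
    rewrite -(real_normK (num_real (f z))).
    have := sqr_ge0 (`|f z| - 1); have := normr_ge0 (f z); nra.
  - apply: (integrableS measurableT mc (@subsetT _ _)).
    under eq_fun do rewrite EFinD.
    apply: integrableD => //; first exact: L2_sqr_integrable.
    by apply: integrable_indic_fin => //; exact: cube_finite.
have [g [_ _ cg]] := approximation_sfun_integrable mc If.
have [M GM] : exists M, (\int[mu]_(z in cb m) `|(f z)%:E - (g M z)%:E| < e%:E)%E.
  move: cg => /fine_cvgP[[M1 _ H1] /cvgrPdist_lt/(_ e e0)[M2 _ H2]].
  exists (maxn M1 M2); have := H1 _ (leq_maxl M1 M2); have := H2 _ (leq_maxr M1 M2).
  rewrite /= sub0r normrN => h2 h1; rewrite -(fineK h1) lte_fin.
  by apply: le_lt_trans h2; exact: ler_norm.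
exists (fun z => g M z); first exact: vanishing_sfun.
apply: le_trans (ltW GM); rewrite le_eqVlt; apply/orP; left; apply/eqP.
rewrite [RHS]integral_mkcond; apply: eq_integral => z _.
rewrite patchE indicE; case: ifP => _; last by rewrite mulr0.
by rewrite mulr1 -EFinB abse_EFin.
Qed.

End OscillationSets.

Transparent vanishing.

(** * Averages and level sets *)

Lemma measurable_gt_cst d (T : measurableType d) (R : realType) (g : T -> R) (c : R) :
  measurable_fun setT g -> measurable [set z | (c < g z)%R].
Proof.
move=> mg; rewrite (_ : [set z | (c < g z)%R] = ~` [set z | (g z <= c)%R]); last first.
  by apply/seteqP; split => z /=; [move=> h; apply/negP; rewrite -ltNge|move/negP; rewrite -ltNge].
apply: measurableC; rewrite -[X in measurable X]setTI.
by apply: measurable_fun_le => //; exact: measurable_cst.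
Qed.

Lemma norm_le_add (R : realDomainType) (u v b : R) : `|u - v| <= b -> `|u| <= `|v| + b.
Proof.
by move=> uv; rewrite -[u](subrK v) addrC; apply: (le_trans (ler_normD _ _)); rewrite lerD2l.
Qed.

Section Averages.
Context (R : realType) (n : nat).
Local Notation E := (Rspace R (1 + n + n)).
Implicit Types (mu : {measure set E -> \bar R}) (f g : E -> R) (G S : 'I_n -> E -> R).

(** [fine] would return 0 on an infinite integral; for [f] in $L^2$ and [s > 0] this is excluded by
    [mollk_integrable]. *)
Definition average mu f (z0 : E) (s : R) : R := fine (\int[mu]_z (f z * mollk z0 s z)%:E)%E.

Lemma measurable_kker_section (z0 : E) (s : R) : measurable_fun setT (fun z : E => kker s (z0, z)).
Proof. exact: measurableT_comp (@measurable_kker R n s) _. Qed.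

Lemma mollk_integrable mu f (z0 : E) (s : R) : is_lebesgue mu -> L2 mu f -> 0 < s ->
  mu.-integrable setT (fun z => (f z * mollk z0 s z)%:E).
Proof.
move=> Lmu Lf s0.
rewrite (_ : (fun _ => _) = fun z => ((s^-1 ^+ (4 * n + 2))%:E *
  (f z * tens (fun _ => @step_bump R) z0 s z)%:E)%E); last first.
  by apply/funext => z; rewrite -EFinM mulrCA.
apply: integrableZl => //; apply: integrable_mul_tens => // j.
exact: bump_step_bump.
Qed.

(** The profiles in [mollkB] depend neither on the centre nor on the scale, so a single constant,
    also independent of the measure and of the data, serves throughout. *)
Lemma average_step : exists2 C : R, 0 <= C & forall mu f G S, kinetic_data mu f G S ->
  forall z0 s, 0 < s ->
  (`|average mu f z0 s - average mu f z0 (2 * s)|%:E <=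
    (C * s)%:E * \int[mu]_z (src G S z * kker s (z0, z))%:E)%E.
Proof.
have [C C0 HC] : small (fun z0 s z => \sum_i tens (opf i (@D1 R) (@gapfam R n i)) z0 s z).
  by apply: small_sum => i; apply: small_D1 => j; exact: bump_gapfam.
exists C => // mu f G S KD z0 s s0; have [iP bP] := HC _ _ _ _ KD z0 s s0.
have Lmu := kd_leb KD; have Lf := kd_f KD.
have s20 : 0 < 2 * s by rewrite mulr_gt0.
have i1 := mollk_integrable z0 Lmu Lf s0; have i2 := mollk_integrable z0 Lmu Lf s20.
have [q q0 [mB kE]] : exists2 q : R, 0 <= q &
    (forall z, mollk z0 s z - mollk z0 (2 * s) z =
      q * \sum_i tens (opf i (@D1 R) (@gapfam R n i)) z0 s z) /\
    (forall z, kker s (z0, z) = q * \1_(kslab z0 s) z).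
  exists (s^-1 ^+ (4 * n + 2)); first by rewrite exprn_ge0// invr_ge0 ltW.
  by split=> z; [exact: mollkB|exact: kkerE].
have f1 := integrable_fin_num measurableT i1; have f2 := integrable_fin_num measurableT i2.
set I := (\int[mu]_z (f z * \sum_i tens (opf i (@D1 R) (@gapfam R n i)) z0 s z)%:E)%E in bP *.
have E1 : (average mu f z0 s - average mu f z0 (2 * s))%:E = (q%:E * I)%E.
  refine (etrans _ (integralZl measurableT iP q)).
  have a1 : (average mu f z0 s)%:E = (\int[mu]_z (f z * mollk z0 s z)%:E)%E := fineK f1.
  have a2 : (average mu f z0 (2 * s))%:E = (\int[mu]_z (f z * mollk z0 (2 * s) z)%:E)%E := fineK f2.
  have subE (u v : R) (X Y Z : \bar R) : u%:E = X -> v%:E = Y -> (X - Y)%E = Z -> (u - v)%:E = Z.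
    by move=> <- <- <-; rewrite EFinB.
  refine (subE _ _ _ _ _ a1 a2 _).
  refine (etrans (esym (integralB measurableT i1 i2)) _).
  apply: eq_integral => z _; rewrite -EFinB -EFinM; congr EFin.
  by rewrite -mulrBr mB mulrCA.
rewrite -abse_EFin E1 abseM abse_EFin (ger0_norm q0).
apply: (le_trans (lee_wpmul2l _ bP)); first by rewrite lee_fin.
have mk := measurable_kslab z0 s.
have mF : measurable_fun setT (fun z => src G S z * \1_(kslab z0 s) z).
  by apply: measurable_funM; [exact: measurable_src KD|exact: measurable_indic].
rewrite muleCA le_eqVlt; apply/orP; left; apply/eqP; congr (_ * _)%E.
rewrite -integralZ_EFin//; last by move=> z; rewrite mulr_ge0// src_ge0.
by apply: eq_integral => z _; rewrite kE mulrCA.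
Qed.

(* AM-GM with weight s^-(2n+1) / N replaces the Cauchy-Schwarz inequality. *)
Lemma kker_L2_bound mu g (N : R) (z0 : E) (s : R) : is_lebesgue mu -> measurable_fun setT g ->
  (forall z, 0 <= g z) -> 0 < N -> (\int[mu]_z ((g z) ^+ 2)%:E <= (N ^+ 2)%:E)%E -> 0 < s ->
  (\int[mu]_z (g z * kker s (z0, z))%:E <= ((1 + kbound R n) * N * s^-1 ^+ (2 * n).+1)%:E)%E.
Proof.
move=> Lmu mg g0 N0 gN s0; set q := s^-1 ^+ (2 * n).+1.
have q0 : 0 < q by rewrite exprn_gt0// invr_gt0.
have q2 : s^-1 ^+ (4 * n + 2) = q ^+ 2 by rewrite /q -exprM; congr (_ ^+ _); lia.
have kb : 0 < kbound R n by apply: exprn_gt0; rewrite ltr0n.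
have k0 z : 0 <= kker s (z0, z) by exact: kker_ge0.
have mk := measurable_kker_section z0 s.
have a0 : 0 <= q / N by rewrite divr_ge0// ltW.
have b0 : 0 <= q * N by rewrite mulr_ge0// ltW.
have mg2 : measurable_fun setT (fun z => g z ^+ 2) by exact: measurable_funX.
apply: (@le_trans _ _ (\int[mu]_z (q / N * (g z) ^+ 2 + q * N * kker s (z0, z))%:E)%E).
  apply: le_integral_EFin.
  - exact: measurable_funM.
  - by apply: measurable_funD; exact: measurable_funM.
  move=> z; rewrite mulr_ge0//=.
  rewrite kkerE q2 indicE; case: (z \in _); last first.
    by rewrite !mulr0 addr0 mulr_ge0// sqr_ge0.
  rewrite !mulr1 -subr_ge0.
  have -> : q / N * g z ^+ 2 + q * N * q ^+ 2 - g z * q ^+ 2 =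
    q / N * ((g z - N * q / 2) ^+ 2 + 3 / 4 * (N * q) ^+ 2) by field; rewrite gt_eqF.
  by rewrite mulr_ge0// addr_ge0// ?sqr_ge0// mulr_ge0 ?sqr_ge0.
rewrite integralD_EFin//; [|exact: measurable_funM|exact: measurable_funM|
  by move=> z; rewrite mulr_ge0// sqr_ge0|by move=> z; rewrite mulr_ge0].
rewrite integralZ_EFin//; last by move=> z; rewrite sqr_ge0.
rewrite integralZ_EFin//.
have -> : ((1 + kbound R n) * N * q)%:E = ((q / N)%:E * (N ^+ 2)%:E + (q * N)%:E * (kbound R n)%:E)%E.
  by rewrite -!EFinM -EFinD; congr EFin; field; rewrite gt_eqF.
apply: leeD; first by apply: lee_wpmul2l => //; rewrite lee_fin.
apply: lee_wpmul2l; first by rewrite lee_fin.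
exact: kker_integral2.
Qed.

Lemma mollk_bound : exists2 C : R, 0 <= C & forall (z0 : E) (s : R) (z : E), 0 < s ->
  0 <= mollk z0 s z <= C * kker s (z0, z).
Proof.
have [C C0 HC] := @tens_kslab R n (fun _ => @step_bump R) (fun j => bump_step_bump R).
exists C => // z0 s z s0; have sQ : 0 <= s^-1 ^+ (4 * n + 2) by rewrite exprn_ge0// invr_ge0 ltW.
have t0 : 0 <= tens (fun _ => @step_bump R) z0 s z.
  by apply: prodr_ge0 => j _; exact: step_bump_ge0.
rewrite /mollk mulr_ge0//= kkerE mulrCA ler_wpM2l//.
by have := HC z0 s z s0; rewrite ger0_norm.
Qed.

Lemma measurable_mollk (z0 : E) (s : R) : measurable_fun setT (mollk z0 s : E -> R).
Proof.
apply: measurable_funM => //; apply: measurable_tens => j.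
exact: smooth1_step_bump.
Qed.

Lemma mollk_mass : exists2 c : R, 0 < c & forall mu (z0 : E) (s : R), is_lebesgue mu -> 0 < s ->
  (c%:E <= \int[mu]_z (mollk z0 s z)%:E)%E.
Proof.
have [d /andP[d0 _] Hd] := step_bump_lb R.
(* One factor bounds the product of bumps from below on the slab of half-widths $d\,s^{w_j}$; the
   other comes from the volume of that slab. *)
exists (d ^+ (1 + n + n) * d ^+ (1 + n + n)); first by rewrite mulr_gt0// exprn_gt0.
move=> mu z0 s Lmu s0.
have sQ : 0 <= s^-1 ^+ (4 * n + 2) by rewrite exprn_ge0// invr_ge0 ltW.
have sQ0 : s ^+ (4 * n + 2) != 0 by rewrite expf_neq0// gt_eqF.
pose a (j : 'I_(1 + n + n)) := d * s ^+ weight j.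
have a0 j : 0 < a j by rewrite mulr_gt0// exprn_gt0.
have ma := measurable_slab z0 a.
have dN : 0 <= d ^+ (1 + n + n) by rewrite exprn_ge0// ltW.
apply: (@le_trans _ _ (\int[mu]_z (s^-1 ^+ (4 * n + 2) * d ^+ (1 + n + n) * \1_(slab z0 a) z)%:E)%E).
  rewrite integralZ_EFin ?mulr_ge0// integral_indic// setIT.
  apply: le_trans (lee_wpmul2l _ (slab_lb z0 Lmu a0)); last by rewrite lee_fin mulr_ge0.
  rewrite -EFinM lee_fin /a big_split/= prod_weight prodr_const card_ord.
  rewrite [leRHS](_ : _ = d ^+ (1 + n + n) * d ^+ (1 + n + n) * (s^-1 ^+ (4 * n + 2) * s ^+ (4 * n + 2))); last by ring.
  by rewrite exprVn mulVf// mulr1.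
apply: le_integral_EFin.
- by apply: measurable_funM => //; exact: measurable_indic.
- exact: measurable_mollk.
move=> z; rewrite !mulr_ge0//= /mollk -mulrA ler_wpM2l// indicE.
case: (boolP (z \in _)) => za; last first.
  by rewrite mulr0; apply: prodr_ge0 => j _; exact: step_bump_ge0.
rewrite mulr1 /tens -[X in d ^+ X](card_ord) -prodr_const; apply: ler_prod => j _.
rewrite (ltW d0)/=; apply: Hd; rewrite coordk_le//.
by move: za; rewrite inE; exact.
Qed.

End Averages.

Section LevelEstimate.
Context (R : realType) (n : nat).
Hypothesis n0 : (0 < n)%N.
Local Notation E := (Rspace R (1 + n + n)).
Local Notation cb m := (@cube R (1 + n + n) m).
Context (mu : {sigma_finite_measure set E -> \bar R}) (f : E -> R) (G S : 'I_n -> E -> R).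
Hypothesis KD : kinetic_data mu f G S.
Let F := src G S.
Context (C1 C0 c1 N : R).
Hypotheses (C10 : 0 <= C1) (C00 : 0 <= C0) (c10 : 0 < c1) (N0 : 0 < N).
Hypothesis stepP : forall z0 s, 0 < s ->
  (`|average mu f z0 s - average mu f z0 (2 * s)|%:E <=
    (C1 * s)%:E * \int[mu]_z (F z * kker s (z0, z))%:E)%E.
Hypothesis mollP : forall (z0 z : E) (s : R), 0 < s -> 0 <= mollk z0 s z <= C0 * kker s (z0, z).
Hypothesis massP : forall (z0 : E) (s : R), 0 < s -> (c1%:E <= \int[mu]_z (mollk z0 s z)%:E)%E.
Hypothesis FN : (\int[mu]_z ((F z) ^+ 2)%:E <= (N ^+ 2)%:E)%E.

Let kb := 1 + kbound R n.
Let kb0 : 0 < kb.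
Proof. by rewrite /kb ltr_pwDl// ltW// kbound_gt0. Qed.
Let Lmu : is_lebesgue mu := kd_leb KD.
Let mF : measurable_fun setT F := measurable_src KD.
Let F0 z : 0 <= F z := src_ge0 G S z.
Let mf : measurable_fun setT f := L2_measurable (kd_f KD).

Lemma average_large z0 s : 0 < s ->
  `|average mu f z0 s - average mu f z0 (2 * s)| <= C1 * kb * N * s^-1 ^+ (2 * n).
Proof.
move=> s0; rewrite -lee_fin; apply: (le_trans (stepP z0 s0)).
apply: (le_trans (lee_wpmul2l _ (kker_L2_bound z0 Lmu mF (src_ge0 _ _) N0 FN s0))).
  by rewrite lee_fin mulr_ge0// ltW.
rewrite -EFinM lee_fin -/kb exprS.
rewrite (_ : C1 * s * _ = C1 * kb * N * s^-1 ^+ (2 * n) * (s * s^-1)); last by ring.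
by rewrite divff ?mulr1// gt_eqF.
Qed.

(** Here the $L^2$ norm of $f$ enters only qualitatively: it lets the telescoping start at infinity,
    and no trace of it remains in the resulting bound. *)
Lemma average_decay z0 (e : R) : 0 < e -> exists M, forall s, M <= s -> `|average mu f z0 s| <= e.
Proof.
move=> e0; have Lf := kd_f KD.
have fint : (\int[mu]_z ((f z) ^+ 2)%:E)%E \is a fin_num.
  exact: (integrable_fin_num measurableT (L2_sqr_integrable Lf)).
pose M2 := fine (\int[mu]_z ((f z) ^+ 2)%:E)%E.
have M20 : 0 <= M2 by apply: fine_ge0; apply: integral_ge0 => z _; rewrite lee_fin sqr_ge0.
(* A positive number with $K^2\ge M_2$, which spares a square root. *)
pose K := 1 + M2; have K0 : 0 < K by rewrite ltr_pwDl.
have fK : (\int[mu]_z ((`|f z|) ^+ 2)%:E <= (K ^+ 2)%:E)%E.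
  under eq_integral do rewrite real_normK ?num_real//.
  rewrite -(fineK fint) lee_fin -/M2 /K; move: M2 M20 {K K0 fint} => M2 M20; nra.
pose B := C0 * (kb * K).
have B0 : 0 <= B by rewrite mulr_ge0// mulr_ge0// ltW.
exists (Num.max 1 ((B + 1) / e)) => s; rewrite ge_max => /andP[s1 sB].
have s0 : 0 < s by apply: lt_le_trans s1.
have Im := mollk_integrable z0 Lmu Lf s0.
rewrite -lee_fin -abse_EFin /average fineK; last exact: (integrable_fin_num measurableT Im).
have mk := measurable_kker_section z0 s.
have mnf : measurable_fun setT (fun z => `|f z|) by exact: measurableT_comp (@normr_measurable R setT) mf.
apply: (@le_trans _ _ (\int[mu]_z (C0 * (`|f z| * kker s (z0, z)))%:E)%E).
  apply: abse_integral_le.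
  - by apply: measurable_funM => //; exact: measurable_mollk.
  - by apply: measurable_funM => //; exact: measurable_funM.
  move=> z; have /andP[h1 h2] := mollP z0 z s0.
  by rewrite normrM (ger0_norm h1) [leRHS]mulrCA ler_wpM2l.
rewrite integralZ_EFin//; last 2 first.
- exact: measurable_funM.
- by move=> z; rewrite mulr_ge0// kker_ge0.
apply: (le_trans (lee_wpmul2l _ (kker_L2_bound z0 Lmu mnf (fun z => normr_ge0 _) K0 fK s0))).
  by rewrite lee_fin.
rewrite -EFinM lee_fin -/kb.
have sV : s^-1 ^+ (2 * n).+1 <= s^-1.
  rewrite exprS ger_pMr ?invr_gt0// exprn_ile1// ?invr_ge0 ?(ltW s0)//.
  by rewrite invf_le1.
apply: (@le_trans _ _ (B * s^-1)).
  by rewrite mulrA; exact: ler_wpM2l.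
rewrite ler_pdivrMr//; move: sB; rewrite ler_pdivrMr// [s * e]mulrC => sB.
by apply: le_trans sB; rewrite lerDl.
Qed.

Lemma average_le z0 s : 0 < s ->
  `|average mu f z0 s| <= 2 * (C1 * kb * N) * s^-1 ^+ (2 * n).
Proof.
move=> s0; set B := C1 * kb * N.
have B0 : 0 <= B by rewrite /B !mulr_ge0// ltW.
have sV : 0 <= s^-1 ^+ (2 * n) by rewrite exprn_ge0// invr_ge0 ltW.
(* The last factor is $\sum_{i<m}2^{-i}$. *)
have H m : `|average mu f z0 s| <=
    `|average mu f z0 (2 ^+ m * s)| + B * s^-1 ^+ (2 * n) * (2 - 2 * 2^-1 ^+ m).
  elim: m => [|m IH]; first by rewrite !expr0 mul1r mulr1 subrr mulr0 addr0.
  apply: (le_trans IH).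
  have s2 : 0 < 2 ^+ m * s by rewrite mulr_gt0// exprn_gt0.
  have := average_large z0 s2; rewrite -/B mulrA -exprS => h1.
  (* The true ratio between scales is $2^{-2n}$; since $n\ge1$ it may be replaced by $1/2$, which
     gives the constant 2. *)
  have h2 : (2 ^+ m * s)^-1 ^+ (2 * n) <= 2^-1 ^+ m * s^-1 ^+ (2 * n).
    rewrite invfM exprMn ler_wpM2r// -exprVn -exprM.
    apply: ler_wiXn2l; [by rewrite invr_ge0|by rewrite invf_le1// ler1n|].
    by rewrite leq_pmulr// muln_gt0.
  have h3 : `|average mu f z0 (2 ^+ m * s)| <= `|average mu f z0 (2 ^+ m.+1 * s)| +
      B * (2^-1 ^+ m * s^-1 ^+ (2 * n)).
    by apply: norm_le_add; apply: (le_trans h1); exact: ler_wpM2l.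
  apply: (le_trans (lerD h3 (lexx _))); rewrite -addrA lerD2l le_eqVlt.
  by apply/orP; left; apply/eqP; rewrite exprS; field.
apply/ler_addgt0Pr => e e0.
have [M HM] := average_decay z0 e0.
have [m hm] : exists m, M <= 2 ^+ m * s.
  have hm := @upper_nthrootP _ (M / s) _ (leqnn _).
  by exists (Num.bound (M / s)); rewrite -ler_pdivrMr// ltW.
apply: (le_trans (H m)).
have m0 : 0 <= 2^-1 ^+ m :> R by rewrite exprn_ge0//; lra.
have Bs : 0 <= B * s^-1 ^+ (2 * n) by rewrite mulr_ge0.
rewrite addrC; apply: lerD; last exact: HM.
rewrite [leRHS](_ : _ = B * s^-1 ^+ (2 * n) * 2); last by ring.
by apply: ler_wpM2l => //; lra.
Qed.

(** Descent from scale [rho] through [q] halvings with $F\le\tau+F1_{F>\tau}$. The parts under [tau]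
    form a geometric series of scales bounded by [rho]. The parts above have no useful bound at a
    single centre and are kept as an integral, to be estimated after integration in [z0]. *)
Lemma average_small z0 (rho tau : R) q : 0 < rho -> 0 <= tau ->
  (`|average mu f z0 (2^-1 ^+ q * rho)|%:E <= (2 * (C1 * kb * N) * rho^-1 ^+ (2 * n) + C1 * kb * tau * rho)%:E +
   \int[mu]_z (\sum_(i < q) C1 * (2^-1 ^+ i.+1 * rho) *
      (F z * \1_[set z | (tau < F z)%R] z * kker (2^-1 ^+ i.+1 * rho) (z0, z)))%:E)%E.
Proof.
move=> rho0 tau0.
pose s i : R := 2^-1 ^+ i * rho.
have s0 i : 0 < s i by rewrite mulr_gt0// exprn_gt0//; lra.
have mA : measurable [set z : E | (tau < F z)%R].
  exact: measurable_gt_cst.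
have mH i : measurable_fun setT (fun z => F z * \1_[set z | (tau < F z)%R] z * kker (s i.+1) (z0, z)).
  apply: measurable_funM; last exact: measurable_kker_section.
  by apply: measurable_funM => //; exact: measurable_indic.
have H0 i z : 0 <= F z * \1_[set z | (tau < F z)%R] z * kker (s i.+1) (z0, z).
  by apply: mulr_ge0; [exact: mulr_ge0|exact: kker_ge0].
have c0 i : 0 <= C1 * s i.+1 by rewrite mulr_ge0// ltW.
pose W q := (\int[mu]_z (\sum_(i < q) C1 * s i.+1 *
   (F z * \1_[set z | (tau < F z)%R] z * kker (s i.+1) (z0, z)))%:E)%E.
have key : (`|average mu f z0 (s q)|%:E <=
   (2 * (C1 * kb * N) * rho^-1 ^+ (2 * n) + C1 * kb * tau * rho * (1 - 2^-1 ^+ q))%:E + W q)%E.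
  elim: q => [|q IH].
    rewrite /W; under eq_integral do rewrite big_ord0.
    by rewrite integral0 adde0 lee_fin /s expr0 mul1r subrr mulr0 addr0 average_le.
  have stp := stepP z0 (s0 q.+1).
  have sE : 2 * s q.+1 = s q by rewrite /s exprS !mulrA divff ?mul1r// pnatr_eq0.
  rewrite sE in stp.
  have WS : W q.+1 = (W q + (C1 * s q.+1)%:E * \int[mu]_z (F z * \1_[set z | (tau < F z)%R] z * kker (s q.+1) (z0, z))%:E)%E.
    rewrite /W -integralZ_EFin// -integralD_EFin.
    - by apply: eq_integral => z _; rewrite big_ord_recr.
    - by apply: measurable_sum => i; apply: measurable_funM => //; exact: mH.
    - by apply: measurable_funM => //; exact: mH.
    - by move=> z; apply: sumr_ge0 => i _; rewrite mulr_ge0.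
    - by move=> z; rewrite mulr_ge0.
  have spl : (\int[mu]_z (F z * kker (s q.+1) (z0, z))%:E <= (tau * kb)%:E +
     \int[mu]_z (F z * \1_[set z | (tau < F z)%R] z * kker (s q.+1) (z0, z))%:E)%E.
    apply: (@le_trans _ _ (\int[mu]_z (tau * kker (s q.+1) (z0, z) +
        F z * \1_[set z | (tau < F z)%R] z * kker (s q.+1) (z0, z))%:E)%E).
      apply: le_integral_EFin.
      - by apply: measurable_funM => //; exact: measurable_kker_section.
      - apply: measurable_funD; last exact: mH.
        by apply: measurable_funM => //; exact: measurable_kker_section.
      move=> z; have k0 : 0 <= kker (s q.+1) (z0, z) by exact: kker_ge0.
      rewrite mulr_ge0//= -mulrDl ler_wpM2r// indicE.
      case: (boolP (z \in _)); first by rewrite mulr1 lerDr.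
      rewrite mulr0 addr0 => zA; rewrite leNgt; apply: contra zA => zA.
      by rewrite inE.
    rewrite integralD_EFin//; [|by apply: measurable_funM => //; exact: measurable_kker_section|
      by move=> z; rewrite mulr_ge0// kker_ge0].
    apply: leeD => //; rewrite integralZ_EFin//; [|exact: measurable_kker_section|by move=> z; exact: kker_ge0].
    rewrite EFinM; apply: lee_wpmul2l; first by rewrite lee_fin.
    apply: le_trans (kker_integral2 z0 Lmu (s0 q.+1)) _.
    by rewrite lee_fin /kb lerDr.
  have tri : (`|average mu f z0 (s q.+1)|%:E <= `|average mu f z0 (s q)|%:E +
      `|average mu f z0 (s q.+1) - average mu f z0 (s q)|%:E)%E.
    by rewrite -EFinD lee_fin; exact: norm_le_add.
  apply: (le_trans tri).
  apply: (le_trans (leeD IH (le_trans stp (lee_wpmul2l _ spl)))); first by rewrite lee_fin.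
  rewrite WS ge0_muleDr; [|by rewrite lee_fin mulr_ge0// ltW|
    by apply: integral_ge0 => z _; rewrite lee_fin].
  rewrite addeACA; apply: leeD => //.
  rewrite -EFinM -EFinD lee_fin le_eqVlt; apply/orP; left; apply/eqP.
  by rewrite /s exprS; field.
apply: (le_trans key); apply: leeD => //.
have cc : 0 <= C1 * kb * tau * rho by rewrite !mulr_ge0// ltW.
have q0 : 0 <= 2^-1 ^+ q :> R by rewrite exprn_ge0//; lra.
by rewrite lee_fin lerD2l; apply: ler_piMr => //; lra.
Qed.

Lemma mollk_integral_lty (z0 : E) (s : R) : 0 < s ->
  mu.-integrable setT (fun z => (mollk z0 s z)%:E).
Proof.
move=> s0; apply/integrableP; split; first by apply/measurable_EFinP; exact: measurable_mollk.
have mk := measurable_kker_section z0 s.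
apply: (@le_lt_trans _ _ (C0%:E * (kbound R n)%:E)%E); last by rewrite -EFinM ltry.
apply: le_trans (lee_wpmul2l _ (kker_integral2 z0 Lmu s0)); last by rewrite lee_fin.
rewrite -integralZ_EFin//; last by move=> z; exact: kker_ge0.
rewrite [leLHS](eq_integral (fun z : E => (mollk z0 s z)%:E)); last first.
  by move=> z _; rewrite gee0_abs// lee_fin; case/andP: (mollP z0 z s0).
apply: le_integral_EFin; [exact: measurable_mollk|exact: measurable_funM|].
by move=> z; exact: mollP.
Qed.

(** Writes $f(z_0)$ times the mass of the mollifier as the average minus the average of $f-f(z_0)$.
    It holds at every point and every scale, so the limit in the scale can be taken after
    integration in [z0]. *)
Lemma pointwise_le (z0 : E) (r : R) : 0 < r ->
  ((c1 * `|f z0|)%:E <= `|average mu f z0 r|%:E +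
    \int[mu]_z (C0 * (`|f z - f z0| * kker r (z0, z)))%:E)%E.
Proof.
move=> r0; have Im := mollk_integral_lty z0 r0.
have If := mollk_integrable z0 Lmu (kd_f KD) r0.
have Ic : mu.-integrable setT (fun z => ((f z0)%:E * (mollk z0 r z)%:E)%E).
  exact: integrableZl.
have mm := measurable_mollk z0 r.
have m0 z : 0 <= mollk z0 r z by case/andP: (mollP z0 z r0).
have ff := integrable_fin_num measurableT If.
apply: (@le_trans _ _ (`|\int[mu]_z ((f z0)%:E * (mollk z0 r z)%:E)|)%E).
  rewrite integralZl// abseM abse_EFin mulrC EFinM.
  rewrite [X in (_ <= _ * X)%E]gee0_abs; last by apply: integral_ge0 => z _; rewrite lee_fin.
  by apply: lee_wpmul2l; [rewrite lee_fin|exact: massP].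
have E1 : (\int[mu]_z ((f z0)%:E * (mollk z0 r z)%:E) = \int[mu]_z (f z * mollk z0 r z)%:E -
    \int[mu]_z ((f z - f z0) * mollk z0 r z)%:E)%E.
  have Id : mu.-integrable setT (fun z => ((f z - f z0) * mollk z0 r z)%:E).
    have -> : (fun z => ((f z - f z0) * mollk z0 r z)%:E) =
      ((fun z => (f z * mollk z0 r z)%:E) \- (fun z => (f z0)%:E * (mollk z0 r z)%:E))%E.
      by apply/funext => z; rewrite -EFinM -EFinB -mulrBl.
    exact: integrableB.
  refine (etrans _ (integralB measurableT If Id)).
  apply: eq_integral => z _; rewrite -EFinM -EFinB; congr EFin; ring.
rewrite E1; apply: (le_trans (lee_abs_sub _ _)); apply: leeD.
  rewrite -(fineK ff) abse_EFin; exact: lexx.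
apply: abse_integral_le.
- by apply: measurable_funM => //; exact: measurable_funB.
- apply: measurable_funM => //; apply: measurable_funM; last exact: measurable_kker_section.
  by apply: (measurableT_comp (@normr_measurable R setT)); exact: measurable_funB.
move=> z; rewrite normrM [leRHS]mulrCA ler_wpM2l//.
by have /andP[h1 h2] := mollP z0 z r0; rewrite ger0_norm.
Qed.

(** By Schur's test each scale costs a constant times its own size, so the gain of one factor [s]
    makes the sum over all scales below [rho] comparable to [rho]. *)
Lemma dint_scales (u : E -> R) rho q : measurable_fun setT u -> (forall z, 0 <= u z) -> 0 < rho ->
  (dint mu (fun p => \sum_(i < q) C1 * (2^-1 ^+ i.+1 * rho) * (u p.2 * kker (2^-1 ^+ i.+1 * rho) p))%R <=
   (C1 * kb * rho * (1 - 2^-1 ^+ q))%:E * \int[mu]_z (u z)%:E)%E.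
Proof.
move=> mu_ u0 rho0.
have s0 i : 0 < 2^-1 ^+ i * rho by rewrite mulr_gt0// exprn_gt0//; lra.
have c0 i : 0 <= C1 * (2^-1 ^+ i * rho) by rewrite mulr_ge0// ltW.
have mt i : measurable_fun setT (fun p : E * E => u p.2 * kker (2^-1 ^+ i.+1 * rho) p).
  apply: measurable_funM; last exact: measurable_kker.
  exact: (measurableT_comp mu_ measurable_snd).
have t0 i p : 0 <= u p.2 * kker (2^-1 ^+ i.+1 * rho) p.
  by apply: mulr_ge0 => //; exact: kker_ge0.
have i0 : (0 <= \int[mu]_z (u z)%:E)%E by apply: integral_ge0 => z _; rewrite lee_fin.
elim: q => [|q IH].
  rewrite (_ : (fun p => _) = fun=> 0); last by apply/funext => p; rewrite big_ord0.
  rewrite /dint; under eq_integral do rewrite integral0.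
  by rewrite integral0 subrr mulr0 mul0e.
rewrite (_ : (fun p => _) = (fun p => \sum_(i < q) C1 * (2^-1 ^+ i.+1 * rho) * (u p.2 * kker (2^-1 ^+ i.+1 * rho) p)
   + C1 * (2^-1 ^+ q.+1 * rho) * (u p.2 * kker (2^-1 ^+ q.+1 * rho) p))); last first.
  by apply/funext => p; rewrite big_ord_recr.
rewrite dintD; last 4 first.
- by apply: measurable_sum => i; exact: measurable_funM.
- exact: measurable_funM.
- by move=> p; apply: sumr_ge0 => i _; apply: mulr_ge0.
- by move=> p; apply: mulr_ge0.
rewrite dintZ//.
have b := dint_right mu_ (@measurable_kker R n (2^-1 ^+ q.+1 * rho)) u0
  (fun p => kker_ge0 p (s0 q.+1)) (fun z => kker_integral1 z Lmu (s0 q.+1)).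
have c0' : (0 <= (C1 * (2^-1 ^+ q.+1 * rho))%:E)%E by rewrite lee_fin.
apply: (le_trans (leeD IH (lee_wpmul2l c0' b))).
have qle : 2^-1 ^+ q <= 1 :> R by rewrite exprn_ile1//; lra.
rewrite muleA -EFinM -ge0_muleDl ?lee_fin; last 2 first.
- by rewrite !mulr_ge0 ?subr_ge0// ltW.
- by apply: mulr_ge0 => //; rewrite ltW// kbound_gt0.
rewrite -EFinD; apply: lee_wpmul2r => //; rewrite lee_fin.
have -> : C1 * kb * rho * (1 - 2^-1 ^+ q.+1) = C1 * kb * rho * (1 - 2^-1 ^+ q) +
  C1 * (2^-1 ^+ q.+1 * rho) * kb by rewrite exprS; field.
by rewrite lerD2l; apply: ler_wpM2l => //; rewrite /kb lerDr.
Qed.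

(* At scales above [rho] the global L^2 bound on [F] suffices. Below [rho], the
   part of [F] under [tau] contributes at most a multiple of [L], and the rest is
   summed over dyadic scales after integrating in [z0]. *)
Lemma level_estimate (rho : R) (L := (1 + 3 * (C1 * kb)) * N * rho^-1 ^+ (2 * n))
    (tau := N * rho^-1 ^+ (2 * n).+1) : 0 < rho ->
  (L%:E * mu [set z | (2 * L / c1 < `|f z|)%R] <=
   (C1 * kb * rho)%:E * \int[mu]_z (F z * \1_[set z | (tau < F z)%R] z)%:E)%E.
Proof.
move=> rho0.
have rV : 0 < rho^-1 by rewrite invr_gt0.
have rn k : 0 < rho^-1 ^+ k by rewrite exprn_gt0.
have tau0 : 0 <= tau by rewrite /tau mulr_ge0 ?ltW.
have cc : 0 <= C1 * kb by rewrite mulr_ge0// ltW.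
(* The summand 1 in [L] keeps it positive even if [C1 = 0]. *)
have L0 : 0 < L by rewrite /L !mulr_gt0// ltr_pwDl// mulr_ge0.
pose A : set E := [set z | (2 * L / c1 < `|f z|)%R].
have mnf : measurable_fun setT (fun z => `|f z|).
  exact: (measurableT_comp (@normr_measurable R setT) mf).
have mA : measurable A by exact: measurable_gt_cst.
pose u z := F z * \1_[set z | (tau < F z)%R] z.
have mu_ : measurable_fun setT u.
  by apply: measurable_funM => //; apply: measurable_indic; exact: measurable_gt_cst.
have u0 z : 0 <= u z by apply: mulr_ge0.
pose T q (p : E * E) := \sum_(i < q) C1 * (2^-1 ^+ i.+1 * rho) * (u p.2 * kker (2^-1 ^+ i.+1 * rho) p).
have s0 i : 0 < 2^-1 ^+ i * rho by rewrite mulr_gt0// exprn_gt0//; lra.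
have mT q : measurable_fun setT (T q).
  apply: measurable_sum => i; apply: measurable_funM => //.
  apply: measurable_funM; last exact: measurable_kker.
  exact: (measurableT_comp mu_ measurable_snd).
have T0 q p : 0 <= T q p.
  apply: sumr_ge0 => i _; apply: mulr_ge0; first by rewrite mulr_ge0// ltW.
  by apply: mulr_ge0 => //; exact: kker_ge0.
(* The smallest scale and the cube are still finite here; the oscillation term is removed in
   [step2], the cube by monotone limits afterwards. *)
have step1 m q : (L%:E * mu (A `&` cb m) <=
    C0%:E * dint mu (oscker m (2^-1 ^+ q * rho) f) + (C1 * kb * rho)%:E * \int[mu]_z (u z)%:E)%E.
  set r := 2^-1 ^+ q * rho.
  have r0 : 0 < r by exact: s0.
  have mo := @measurable_oscker R n m r f mf.
  have o0 p : 0 <= oscker m r f p by exact: oscker_ge0.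
  have mAm : measurable (A `&` cb m) by apply: measurableI => //; exact: measurable_cube.
  apply: (@le_trans _ _ (dint mu (fun p => C0 * oscker m r f p + T q p))); last first.
    rewrite dintD//; [|exact: measurable_funM|by move=> p; exact: mulr_ge0].
    rewrite dintZ//; apply: leeD => //.
    apply: (le_trans (dint_scales _ mu_ u0 rho0)); apply: lee_wpmul2r.
      by apply: integral_ge0 => z _; rewrite lee_fin.
    have q0 : 0 <= 2^-1 ^+ q :> R by rewrite exprn_ge0//; lra.
    by rewrite lee_fin; apply: ler_piMr; [rewrite mulr_ge0// ltW|lra].
  have mI : measurable_fun setT (\1_(A `&` cb m) : E -> R) by exact: measurable_indic.
  apply: (@le_trans _ _ (L%:E * \int[mu]_z (\1_(A `&` cb m) z)%:E)%E).
    by rewrite integral_indic// setIT.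
  rewrite -integralZ_EFin ?(ltW L0)//.
  apply: ge0_le_integral => //.
  - by move=> z0 _; rewrite lee_fin mulr_ge0// ltW.
  - by apply/measurable_EFinP; exact: measurable_funM.
  - apply: (@measurable_dint_inner _ _ _ mu (fun p => C0 * oscker m r f p + T q p)).
      by apply: measurable_funD => //; exact: measurable_funM.
    by move=> p; apply: addr_ge0 => //; exact: mulr_ge0.
  move=> z0 _; rewrite indicE in_setI.
  have I0 : (0 <= \int[mu]_y (C0 * oscker m r f (z0, y) + T q (z0, y))%:E)%E.
    by apply: integral_ge0 => y _; rewrite lee_fin; apply: addr_ge0 => //; exact: mulr_ge0.
  case: (boolP (z0 \in A)) => zA; last by rewrite mulr0.
  case: (boolP (z0 \in cb m)) => zm; last by rewrite mulr0.
  rewrite mulr1.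
  have sec (phi : E * E -> R) : measurable_fun setT phi -> measurable_fun setT (fun y => phi (z0, y)).
    by move=> mphi; exact: measurableT_comp mphi _.
  rewrite integralD_EFin//; [|by apply: measurable_funM => //; exact: (sec _ mo)|exact: (sec _ (mT q))|
    by move=> y; exact: mulr_ge0].
  have pw := pointwise_le z0 r0.
  have oE : (\int[mu]_z (C0 * (`|f z - f z0| * kker r (z0, z)))%:E =
      \int[mu]_z (C0 * oscker m r f (z0, z))%:E)%E.
    by apply: eq_integral => z _; rewrite /oscker /= indicE zm mul1r.
  rewrite oE in pw.
  set W := (\int[mu]_y (T q (z0, y))%:E)%E.
  have as_ : (`|average mu f z0 r|%:E <= (2 * (C1 * kb * N) * rho^-1 ^+ (2 * n) +
      C1 * kb * tau * rho)%:E + W)%E := average_small z0 q rho0 tau0.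
  have := le_trans pw (leeD as_ (lexx _)).
  set O := (\int[mu]_z (C0 * oscker m r f (z0, z))%:E)%E.
  have W0 : (0 <= W)%E by apply: integral_ge0 => y _; rewrite lee_fin; exact: (T0 q (z0, y)).
  have O0 : (0 <= O)%E by apply: integral_ge0 => y _; rewrite lee_fin; exact: mulr_ge0.
  (* The choice of [tau] gives $\tau\rho=N\rho^{-2n}$, the size of the large-scale bound; the
     coefficients 2 and 1 add up to the 3 in [L]. *)
  have cE : 2 * (C1 * kb * N) * rho^-1 ^+ (2 * n) + C1 * kb * tau * rho <= L.
    rewrite /tau exprS /L.
    rewrite [X in X <= _](_ : _ = 3 * (C1 * kb) * N * rho^-1 ^+ (2 * n)); last first.
      by field; rewrite gt_eqF.
    by rewrite !mulrDl lerDr !mul1r mulr_ge0// ltW.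
  (* One [L] absorbs the bounded terms; the other survives as the lower bound in a Chebyshev
     argument. *)
  have fA : 2 * L < c1 * `|f z0|.
    by move: zA; rewrite inE /A /= ltr_pdivrMr// [c1 * _]mulrC.
  move=> H; have {}H : ((2 * L)%:E <= (L%:E + W) + O)%E.
    apply: (le_trans _ (le_trans H _)); first by rewrite lee_fin ltW.
    apply: leeD; last exact: lexx.
    by apply: leeD; [rewrite lee_fin|exact: lexx].
  move: H; rewrite -addeA [(W + O)%E]addeC; move: (O + W)%E => X.
  rewrite (_ : 2 * L = L + L) ?EFinD; last by ring.
  by rewrite leeD2lE.
have step2 m : (L%:E * mu (A `&` cb m) <= (C1 * kb * rho)%:E * \int[mu]_z (u z)%:E)%E.
  apply/lee_addgt0Pr => e e0.
  have [_ vf] := vanishing_L2 Lmu (kd_f KD).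
  have eC : 0 < e / (C0 + 1) by rewrite divr_gt0// ltr_wpDl.
  have [r0 r00 Hr] := vf m _ eC.
  have hq := @upper_nthrootP _ (rho / r0) _ (leqnn _).
  set q := Num.bound _ in hq.
  have rq : 0 < 2^-1 ^+ q * rho <= r0.
    rewrite s0/= exprVn mulrC ler_pdivrMr ?exprn_gt0//.
    by rewrite [r0 * _]mulrC -ler_pdivrMr// ltW.
  apply: (le_trans (step1 m q)); rewrite addeC; apply: leeD => //.
  apply: (le_trans (lee_wpmul2l _ (Hr _ rq))); first by rewrite lee_fin.
  rewrite -EFinM lee_fin mulrCA ger_pMr// ler_pdivrMr ?ltr_wpDl// mul1r lerDl//.
have cA : (mu \o (fun m => A `&` cb m)) @ \oo --> mu (\bigcup_m (A `&` cb m)).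
  apply: nondecreasing_cvg_mu.
  - by move=> m; apply: measurableI => //; exact: measurable_cube.
  - by apply: bigcupT_measurable => m; apply: measurableI => //; exact: measurable_cube.
  - move=> m1 m2 m12; apply/subsetPset => z [Az cz]; split => // j.
    have := cz j; rewrite !mxE => /andP[h1 h2].
    have m12R : m1%:R <= m2%:R :> R by rewrite ler_nat.
    by apply/andP; split; lra.
rewrite -setI_bigcupr bigcup_cube setIT in cA.
have cA2 : (L%:E * (mu (A `&` cb m)))%E @[m --> \oo] --> (L%:E * mu A)%E by exact: cvgeZl.
rewrite -(cvg_lim _ cA2)//; apply: lime_le; first by apply/cvg_ex; exists (L%:E * mu A)%E.
exact: nearW.
Qed.

End LevelEstimate.

(** * Summation over dyadic levels *)

(** The terms below [x] are dominated by the largest of them. The increasing case serves the dyadic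
    levels above 1, the decreasing case of [sum_geometric_gt] those below 1. *)
Lemma sum_geometric_lt (R : realType) (c : nat -> R) (x : R) k :
  (forall i, 0 <= c i) -> (forall i, 2 * c i <= c i.+1) -> 0 <= x ->
  \sum_(i < k) c i * (c i < x)%R%:R <= 2 * x.
Proof.
move=> c0 cS x0.
have S j : \sum_(i < j) c i <= c j.
  elim: j => [|j IH]; first by rewrite big_ord0.
  by rewrite big_ord_recr/=; have := cS j; lra.
elim: k => [|k IH]; first by rewrite big_ord0 mulr_ge0.
rewrite big_ord_recr/=; have [ckx|ckx] := ltP (c k) x; last by rewrite mulr0 addr0.
rewrite mulr1; have : \sum_(i < k) c i * (c i < x)%R%:R <= \sum_(i < k) c i.
  apply: ler_sum => i _; move: ((_ < _)%R) => []; by rewrite ?mulr1 ?mulr0.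
by have := S k; lra.
Qed.

Lemma sum_geometric_gt (R : realType) (c : nat -> R) (x : R) k :
  (forall i, 0 <= c i) -> (forall i, 2 * c i.+1 <= c i) -> 0 <= x ->
  \sum_(i < k) c i * (c i < x)%R%:R <= 2 * x.
Proof.
move=> + + x0; elim: k c => [|k IH] c c0 cS; first by rewrite big_ord0 mulr_ge0.
have S j (d : nat -> R) : (forall i, 0 <= d i) -> (forall i, 2 * d i.+1 <= d i) -> \sum_(i < j) d i <= 2 * d 0.
  elim: j d => [|j IHj] d d0 dS; first by rewrite big_ord0 mulr_ge0.
  rewrite big_ord_recl/=.
  have := IHj (fun i => d i.+1) (fun i => d0 _) (fun i => dS _).
  by have := dS 0; lra.
rewrite big_ord_recl/=; have [c0x|c0x] := ltP (c 0) x; last first.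
  by rewrite mulr0 add0r; exact: (IH (fun i => c i.+1)).
rewrite mulr1.
have : \sum_(i < k) c i.+1 * (c i.+1 < x)%R%:R <= \sum_(i < k) c i.+1.
  apply: ler_sum => i _; move: ((_ < _)%R) => []; by rewrite ?mulr1 ?mulr0.
have := S k (fun i => c i.+1) (fun i => c0 _) (fun i => cS _).
by have := cS 0; rewrite /bump/=; lra.
Qed.

Section LayerCake.
Context d (T : measurableType d) (R : realType) (mu : {measure set T -> \bar R}).
Context (n : nat) (g h : T -> R) (K : R).
Hypotheses (n0 : (0 < n)%N) (mg : measurable_fun setT g) (mh : measurable_fun setT h).
Hypotheses (g0 : forall z, 0 <= g z) (h0 : forall z, 0 <= h z) (K0 : 0 <= K).
Hypothesis gh : forall M : R, 0 < M ->
  (mu [set z | (M ^+ (2 * n) < g z)%R] <= (K * M^-1 ^+ (2 * n).+1)%:E *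
     \int[mu]_z (h z * \1_[set z | (M ^+ (2 * n).+1 < h z)%R] z)%:E)%E.

(** This is where keeping the tail of [h] pays off. After exchanging sum and integral, the weights
    $M^{4n+2}M^{-2n-1}=M^{2n+1}$ are summed at a fixed point over the levels with $M^{2n+1}<h$,
    which gives at most $2h$ and, with the remaining factor, $2h^2$. *)
Lemma level_sum (M : nat -> R) : (forall i, 0 < M i) ->
  (forall (x : R) k, 0 <= x ->
     \sum_(i < k) M i ^+ (2 * n).+1 * (M i ^+ (2 * n).+1 < x)%R%:R <= 2 * x) ->
  (\int[mu]_z (\sum_(i <oo) (M i ^+ (4 * n + 2) * \1_[set z | (M i ^+ (2 * n) < g z)%R] z)%:E) <=
   (2 * K)%:E * \int[mu]_z ((h z) ^+ 2)%:E)%E.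
Proof.
move=> M0 Msum.
have m1 i : measurable [set z | (M i ^+ (2 * n) < g z)%R] by exact: measurable_gt_cst.
have m2 i : measurable [set z | (M i ^+ (2 * n).+1 < h z)%R] by exact: measurable_gt_cst.
have mt i : measurable_fun setT (fun z => h z * \1_[set z | (M i ^+ (2 * n).+1 < h z)%R] z).
  by apply: measurable_funM => //; exact: measurable_indic.
have t0 i z : 0 <= h z * \1_[set z | (M i ^+ (2 * n).+1 < h z)%R] z by exact: mulr_ge0.
have Mk i k : 0 <= M i ^+ k by rewrite exprn_ge0// ltW.
rewrite integral_nneseries//; last 2 first.
- move=> i; apply/measurable_EFinP/measurable_funM => //; exact: measurable_indic.
- by move=> i z _; rewrite lee_fin mulr_ge0.
apply: (@le_trans _ _ (\sum_(i <oo) \int[mu]_z (K * (M i ^+ (2 * n).+1 *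
    (h z * \1_[set z | (M i ^+ (2 * n).+1 < h z)%R] z)))%:E)%E).
  apply: lee_nneseries => [i _ _|i _].
    by apply: integral_ge0 => z _; rewrite lee_fin mulr_ge0.
  rewrite [leLHS]integralZ_EFin//.
  rewrite integral_indic// setIT.
  apply: (le_trans (lee_wpmul2l _ (gh (M0 i)))); first by rewrite lee_fin.
  rewrite muleA -EFinM -integralZ_EFin//; last by rewrite mulr_ge0// mulr_ge0// exprn_ge0// invr_ge0 ltW.
  rewrite le_eqVlt; apply/orP; left; apply/eqP; apply: eq_integral => z _; congr EFin.
  rewrite !mulrA; congr (_ * _ * _).
  have -> : (4 * n + 2 = (2 * n).+1 + (2 * n).+1)%N by lia.
  rewrite exprD exprVn; field; by rewrite expf_neq0// gt_eqF.
rewrite -integral_nneseries//; last 2 first.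
- by move=> i; apply/measurable_EFinP; do 2 apply: measurable_funM => //.
- by move=> i z _; rewrite lee_fin !mulr_ge0.
have mh2 : measurable_fun setT (fun z => h z ^+ 2) by exact: measurable_funX.
rewrite -integralZ_EFin//; last 2 first.
- by rewrite mulr_ge0.
- by move=> z; rewrite sqr_ge0.
apply: ge0_le_integral => //.
- by move=> z _; apply: nneseries_ge0 => i _ _; rewrite lee_fin !mulr_ge0.
- apply: ge0_emeasurable_sum => //.
  + by move=> i z _ _; rewrite lee_fin !mulr_ge0.
  + by move=> i _; apply/measurable_EFinP; do 2 apply: measurable_funM => //.
- by apply/measurable_EFinP; exact: measurable_funM.
move=> z _; apply: lime_le.
  by apply: is_cvg_nneseries => i _ _; rewrite lee_fin !mulr_ge0.
apply: nearW => k; rewrite sumEFin lee_fin big_mkord -mulr_sumr.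
rewrite [leRHS](_ : _ = K * (2 * h z * h z)); last by ring.
apply: ler_wpM2l => //.
apply: le_trans (ler_wpM2r (h0 z) (Msum (h z) k (h0 z))).
rewrite mulr_suml; apply: ler_sum => i _; rewrite indicE -!mulrA.
apply: ler_wpM2l => //; rewrite mulrC le_eqVlt; apply/orP; left; apply/eqP; congr (_%:R * _).
by congr nat_of_bool; apply/idP/idP; rewrite inE.
Qed.

Lemma dyadic_gt1 (x : R) : 1 < x -> exists i, (2 ^+ i) ^+ (2 * n) < x <= (2 ^+ i.+1) ^+ (2 * n).
Proof.
move=> x1.
have ex : exists i, x <= (2 ^+ i.+1) ^+ (2 * n).
  exists (Num.bound x); have := @upper_nthrootP _ x _ (leqnn _) => /ltW; move/le_trans; apply.
  rewrite -exprM; apply: ler_weXn2l; first by rewrite ler1n.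
  by apply: (leq_trans (leqnSn _)); rewrite leq_pmulr// muln_gt0.
case: (ex_minnP ex) => -[|i] xi mi.
  by exists 0%N; rewrite expr0 expr1n x1.
by exists i.+1; rewrite xi andbT ltNge; apply/negP => /mi; rewrite ltnn.
Qed.

Lemma dyadic_le1 (x : R) : 0 < x <= 1 ->
  exists i, (2^-1 ^+ i.+1) ^+ (2 * n) < x <= (2 * 2^-1 ^+ i.+1) ^+ (2 * n).
Proof.
move=> /andP[x0 x1].
have E i : 2 * 2^-1 ^+ i.+1 = 2^-1 ^+ i :> R by rewrite exprS; field.
have ex : exists i, (2^-1 ^+ i.+1) ^+ (2 * n) < x.
  exists (Num.bound x^-1); have := @upper_nthrootP _ x^-1 _ (leqnn _).
  set k := Num.bound _ => kx.
  apply: (@le_lt_trans _ _ (2^-1 ^+ k)).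
    rewrite -exprM; apply: ler_wiXn2l; [by rewrite invr_ge0|by rewrite invf_le1// ler1n|].
    by apply: (leq_trans (leqnSn _)); rewrite leq_pmulr// muln_gt0.
  by rewrite exprVn -[x]invrK ltf_pV2 ?posrE ?exprn_gt0 ?invr_gt0.
case: (ex_minnP ex) => -[|i] xi mi.
  by exists 0%N; rewrite xi/= E expr0 expr1n.
by exists i.+1; rewrite xi/= E leNgt; apply/negP => /mi; rewrite ltnn.
Qed.

(** The dyadic levels indexed by the integers are split into two sequences, each contributing $2K$.
    A point with $M^{2n}<g\le(2M)^{2n}$ satisfies $g^p\le(2M)^{4n+2}$ because $2n\,p=4n+2$; the loss
    from $M$ to $2M$ is the factor $2^{4n+2}$. *)
Lemma layer_cake :
  (\int[mu]_z (g z `^ (2 * (1 + (2 * n%:R)^-1)))%:E <=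
   (2 ^+ (4 * n + 2) * (4 * K))%:E * \int[mu]_z ((h z) ^+ 2)%:E)%E.
Proof.
set p := 2 * (1 + (2 * n%:R)^-1).
have nR : 0 < n%:R :> R by rewrite ltr0n.
have p0 : 0 < p by rewrite /p mulr_gt0// addr_gt0// invr_gt0 mulr_gt0.
pose B : R := 2 ^+ (4 * n + 2).
have B0 : 0 <= B by rewrite exprn_ge0.
pose M1 i : R := 2 ^+ i; pose M2 i : R := 2^-1 ^+ i.+1.
have M10 i : 0 < M1 i by rewrite exprn_gt0.
have M20 i : 0 < M2 i by rewrite exprn_gt0// invr_gt0.
have two : 2 <= 2 ^+ (2 * n).+1 :> R.
  by rewrite -[leLHS]expr1; apply: ler_weXn2l; rewrite ?ler1n.
have b1 := level_sum M10 (fun x k x0 => @sum_geometric_lt R (fun i => M1 i ^+ (2 * n).+1) x k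
  (fun i => exprn_ge0 _ (ltW (M10 i))) _ x0).
have b2 := level_sum M20 (fun x k x0 => @sum_geometric_gt R (fun i => M2 i ^+ (2 * n).+1) x k
  (fun i => exprn_ge0 _ (ltW (M20 i))) _ x0).
pose S (M : nat -> R) z : \bar R := (\sum_(i <oo) (M i ^+ (4 * n + 2) * \1_[set z | (M i ^+ (2 * n) < g z)%R] z)%:E)%E.
have t0 (M : nat -> R) i z : (forall i, 0 < M i) ->
  (0 <= (M i ^+ (4 * n + 2) * \1_[set z | (M i ^+ (2 * n) < g z)%R] z)%:E)%E.
  by move=> M0; rewrite lee_fin mulr_ge0// exprn_ge0// ltW.
have S0 (M : nat -> R) z : (forall i, 0 < M i) -> (0 <= S M z)%E.
  by move=> M0; apply: nneseries_ge0 => i _ _; exact: t0.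
have mS (M : nat -> R) : (forall i, 0 < M i) -> measurable_fun setT (S M).
  move=> M0; apply: ge0_emeasurable_sum => //; first by move=> i z _ _; exact: t0.
  move=> i _; apply/measurable_EFinP/measurable_funM => //; apply: measurable_indic.
  exact: measurable_gt_cst.
have ge_term (M : nat -> R) z i : (forall i, 0 < M i) -> M i ^+ (2 * n) < g z ->
    ((M i ^+ (4 * n + 2))%:E <= S M z)%E.
  move=> M0 Mg; rewrite /S (@nneseriesD1 R _ i xpredT)//; last by move=> k _; exact: t0.
  rewrite indicE mem_set// mulr1 leeDl//.
  by apply: nneseries_ge0 => k _ _; exact: t0.
have pw (z : T) (M : R) : 0 < M -> g z <= (2 * M) ^+ (2 * n) ->
    ((g z `^ p)%:E <= B%:E * (M ^+ (4 * n + 2))%:E)%E.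
  move=> M0 gM; rewrite -EFinM lee_fin.
  apply: (le_trans (ge0_ler_powR (ltW p0) _ _ gM)); rewrite ?nnegrE//.
    by rewrite exprn_ge0// mulr_ge0// ltW.
  have M2' : 0 <= 2 * M by rewrite mulr_ge0// ltW.
  rewrite -powR_mulrn// -powRrM.
  have -> : (2 * n)%:R * p = (4 * n + 2)%:R :> R.
    by rewrite /p natrD !natrM; field; rewrite gt_eqF.
  by rewrite powR_mulrn// exprMn.
apply: (@le_trans _ _ (\int[mu]_z (B%:E * (S M1 z + S M2 z)))%E).
  apply: ge0_le_integral => //.
  - by move=> z _; rewrite lee_fin powR_ge0.
  - by apply/measurable_EFinP; apply: (measurableT_comp (measurable_powR p)).
  - by apply: measurable_funeM; apply: emeasurable_funD; exact: mS.
  move=> z _; have [gz|gz] := eqVneq (g z) 0.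
    by rewrite gz powR0 ?gt_eqF// mule_ge0// adde_ge0// S0.
  have gz0 : 0 < g z by rewrite lt_neqAle eq_sym gz g0.
  have [g1|g1] := ltP 1 (g z).
    have [i /andP[gi gi1]] := dyadic_gt1 g1.
    rewrite exprS in gi1.
    apply: (le_trans (pw z _ (M10 i) gi1)); apply: lee_wpmul2l => //.
    by apply: (le_trans (ge_term M1 z i M10 gi)); rewrite leeDl// S0.
  have [|i /andP[gi gi1]] := @dyadic_le1 (g z); first by rewrite gz0.
  apply: (le_trans (pw z _ (M20 i) gi1)); apply: lee_wpmul2l => //.
  by apply: (le_trans (ge_term M2 z i M20 gi)); rewrite leeDr// S0.
rewrite ge0_integralZl_EFin//; last 2 first.
- by move=> z _; rewrite adde_ge0// S0.
- by apply: emeasurable_funD; exact: mS.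
rewrite EFinM -muleA; apply: lee_wpmul2l => //.
rewrite ge0_integralD//; last 4 first.
- by move=> z _; exact: S0.
- exact: mS.
- by move=> z _; exact: S0.
- exact: mS.
have I0 : (0 <= \int[mu]_z ((h z) ^+ 2)%:E)%E.
  by apply: integral_ge0 => z _; rewrite lee_fin sqr_ge0.
have -> : ((4 * K)%:E * \int[mu]_z ((h z) ^+ 2)%:E = (2 * K)%:E * \int[mu]_z ((h z) ^+ 2)%:E +
   (2 * K)%:E * \int[mu]_z ((h z) ^+ 2)%:E)%E.
  by rewrite -ge0_muleDl ?lee_fin ?mulr_ge0// -EFinD; congr (_%:E * _)%E; ring.
apply: leeD; [apply: b1|apply: b2] => i.
- rewrite /M1 [2 ^+ i.+1]exprS exprMn; apply: ler_wpM2r; last exact: two.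
  by apply: exprn_ge0; exact: ltW (M10 i).
- rewrite /M2 [2^-1 ^+ i.+2]exprS [(2^-1 * _) ^+ _]exprMn mulrA.
  rewrite -[leRHS]mul1r; apply: ler_wpM2r; first by apply: exprn_ge0; exact: ltW (M20 i).
  by rewrite exprVn ler_pdivrMr ?mul1r// exprn_gt0.
Qed.

End LayerCake.

(** * From integrals to norms, and uniformity of the constant *)

Lemma Lnorm_EFin d (T : measurableType d) (R : realType) (mu : {measure set T -> \bar R})
    (p : R) (f : T -> R) :
  Lnorm mu p%:E (EFin \o f) = ((\int[mu]_z (`|f z| `^ p)%:E) `^ p^-1)%E.
Proof. by rewrite unlock /=; congr (_ `^ _)%E; apply: eq_integral => z _; rewrite poweR_EFin. Qed.

Lemma le_Lnorm_EFin d (T : measurableType d) (R : realType) (mu : {measure set T -> \bar R})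
    (p : R) (f : T -> R) (A B : R) :
  measurable_fun setT f -> 0 < p -> 0 < A -> 0 <= B ->
  (\int[mu]_z ((`|f z| / A) `^ p)%:E <= B%:E)%E ->
  (Lnorm mu p%:E (EFin \o f) <= (A * B `^ p^-1)%:E)%E.
Proof.
move=> mf p0 A0 B0 H; rewrite Lnorm_EFin.
have mA : measurable_fun setT (fun z => (`|f z| / A) `^ p).
  apply: (measurableT_comp (measurable_powR p)); apply: measurable_funM => //.
  exact: (measurableT_comp (@normr_measurable R setT)).
have -> : (\int[mu]_z (`|f z| `^ p)%:E = (A `^ p)%:E * \int[mu]_z ((`|f z| / A) `^ p)%:E)%E.
  rewrite -integralZ_EFin ?powR_ge0//; last by move=> z; exact: powR_ge0.
  apply: eq_integral => z _; rewrite -powRM ?divr_ge0 ?(ltW A0)//.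
  by rewrite mulrC divfK// gt_eqF.
have -> : (A * B `^ p^-1)%:E = ((A `^ p * B)%:E `^ p^-1)%E.
  rewrite poweR_EFin powRM ?powR_ge0// -powRrM divff ?gt_eqF// powRr1//.
  exact: ltW.
have I0 : (0 <= \int[mu]_z ((`|f z| / A) `^ p)%:E)%E.
  by apply: integral_ge0 => z _; rewrite lee_fin powR_ge0.
apply: gt0_ler_poweR.
- by rewrite invr_ge0 ltW.
- by rewrite in_itv/= leey andbT mule_ge0// lee_fin powR_ge0.
- by rewrite in_itv/= leey andbT lee_fin mulr_ge0// powR_ge0.
- by rewrite EFinM lee_wpmul2l// lee_fin powR_ge0.
Qed.

(** With $f$ and $F$ rescaled, [level_estimate] at $\rho=1/M$ is the hypothesis of [layer_cake]. [N]
    is any positive upper bound for the norm of $F$, so a vanishing norm needs no separate argument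
    at this point. *)
Lemma kinetic_sobolev_sfinite (R : realType) (n : nat) : (0 < n)%N ->
  exists2 D : R, 0 < D & forall (mu : {sigma_finite_measure set (Rspace R (1 + n + n)) -> \bar R})
    (f : Rspace R (1 + n + n) -> R) (G S : 'I_n -> Rspace R (1 + n + n) -> R) (N : R),
  kinetic_data mu f G S -> 0 < N ->
  (\int[mu]_z ((src G S z) ^+ 2)%:E <= (N ^+ 2)%:E)%E ->
  (Lnorm mu (2 * (1 + (2 * n%:R)^-1))%:E (EFin \o f) <= (D * N)%:E)%E.
Proof.
move=> n0.
have [C1 C10 H1] := average_step R n.
have [C0 C00 H0] := mollk_bound R n.
have [c1 c10 Hc] := mollk_mass R n.
set p := 2 * (1 + (2 * n%:R)^-1).
have nR : 0 < n%:R :> R by rewrite ltr0n.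
have p0 : 0 < p by rewrite /p mulr_gt0// addr_gt0// invr_gt0 mulr_gt0.
have kb0 : 0 < 1 + kbound R n by rewrite ltr_pwDl// ltW// kbound_gt0.
(* [a] is the coefficient in [L]; [K] is the constant that remains when the level estimate is
   divided by [L]. *)
pose a := 1 + 3 * (C1 * (1 + kbound R n)).
have a0 : 0 < a.
  by rewrite /a ltr_pwDl// mulr_ge0// mulr_ge0// ltW.
pose K := C1 * (1 + kbound R n) / a.
have K0 : 0 <= K by rewrite /K divr_ge0 ?(ltW a0)// mulr_ge0// ltW.
pose B := 2 ^+ (4 * n + 2) * (4 * K).
have B0 : 0 <= B by rewrite /B mulr_ge0 ?exprn_ge0// mulr_ge0.
(* The final [+ 1] ensures positivity when [B] is 0. *)
exists (2 * a / c1 * (B `^ p^-1) + 1).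
  by rewrite ltr_wpDl// mulr_ge0 ?powR_ge0// divr_ge0 ?(ltW c10)// mulr_ge0// ltW.
move=> mu f G S N KD N0 FN.
have Lmu := kd_leb KD.
have mf := L2_measurable (kd_f KD).
have mF := measurable_src KD.
(* The threshold [2 * L / c1] is then exactly $A\,M^{2n}$. *)
pose A := 2 * (a * N) / c1.
have A0 : 0 < A by rewrite /A divr_gt0// mulr_gt0// mulr_gt0.
pose g z := `|f z| / A; pose h z := src G S z / N.
have mg : measurable_fun setT g.
  apply: measurable_funM => //; exact: (measurableT_comp (@normr_measurable R setT) mf).
have mh : measurable_fun setT h by exact: measurable_funM.
have g0 z : 0 <= g z by rewrite divr_ge0// ltW.
have h0 z : 0 <= h z by rewrite divr_ge0 ?src_ge0// ltW.
have gh (M : R) : 0 < M -> (mu [set z | (M ^+ (2 * n) < g z)%R] <= (K * M^-1 ^+ (2 * n).+1)%:E *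
     \int[mu]_z (h z * \1_[set z | (M ^+ (2 * n).+1 < h z)%R] z)%:E)%E.
  move=> M0; have MV : 0 < M^-1 by rewrite invr_gt0.
  have := level_estimate n0 KD C10 C00 c10 N0 (H1 mu f G S KD) (fun z0 z s => H0 z0 s z)
    (fun z0 s s0 => Hc mu z0 s Lmu s0) FN MV.
  rewrite !invrK -/a; set L := a * N * M ^+ (2 * n); set tau := N * M ^+ (2 * n).+1.
  have L0 : 0 < L by rewrite /L !mulr_gt0// exprn_gt0.
  have -> : [set z | (2 * L / c1 < `|f z|)%R] = [set z | (M ^+ (2 * n) < g z)%R].
    apply/seteqP; split => z /=; rewrite /g ltr_pdivlMr// /A /L;
      by rewrite (_ : M ^+ (2 * n) * (2 * (a * N) / c1) = 2 * (a * N * M ^+ (2 * n)) / c1)//; ring.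
  have -> : (\int[mu]_z (src G S z * \1_[set z | (tau < src G S z)%R] z)%:E =
     N%:E * \int[mu]_z (h z * \1_[set z | (M ^+ (2 * n).+1 < h z)%R] z)%:E)%E.
    rewrite -integralZ_EFin ?(ltW N0)//; last 2 first.
    - by apply: measurable_funM => //; apply: measurable_indic; exact: measurable_gt_cst.
    - by move=> z; exact: mulr_ge0.
    apply: eq_integral => z _; congr EFin.
    have -> : [set z | (tau < src G S z)%R] = [set z | (M ^+ (2 * n).+1 < h z)%R].
      by apply/seteqP; split => y /=; rewrite /h ltr_pdivlMr// mulrC.
    by rewrite mulrA; congr (_ * _); rewrite /h mulrC divfK// gt_eqF.
  set m := mu _; set X := (\int[mu]_z _)%E => H.
  have X0 : (0 <= X)%E by apply: integral_ge0 => z _; rewrite lee_fin mulr_ge0.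
  have -> : m = (L^-1%:E * (L%:E * m))%E by rewrite muleA -EFinM mulVf ?mul1e// gt_eqF.
  apply: (le_trans (lee_wpmul2l _ H)); first by rewrite lee_fin invr_ge0 ltW.
  rewrite !muleA -!EFinM le_eqVlt; apply/orP; left; apply/eqP; congr (_%:E * _)%E.
  rewrite /K /L exprS exprVn; field.
  by rewrite !gt_eqF//= exprn_gt0.
have hN : (\int[mu]_z ((h z) ^+ 2)%:E <= 1)%E.
  have -> : (\int[mu]_z ((h z) ^+ 2)%:E = (N^-1 ^+ 2)%:E * \int[mu]_z ((src G S z) ^+ 2)%:E)%E.
    rewrite -integralZ_EFin ?sqr_ge0//; last 2 first.
    - exact: measurable_funX.
    - by move=> z; exact: sqr_ge0.
    by apply: eq_integral => z _; rewrite /h exprMn mulrC.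
  apply: (le_trans (lee_wpmul2l _ FN)); first by rewrite lee_fin sqr_ge0.
  by rewrite -EFinM exprVn mulVf// expf_neq0// gt_eqF.
have lc := layer_cake n0 mg mh g0 h0 K0 gh.
have lB : (\int[mu]_z ((`|f z| / A) `^ p)%:E <= B%:E)%E.
  apply: (le_trans lc); rewrite -[leRHS]mule1; apply: lee_wpmul2l => //.
apply: (le_trans (le_Lnorm_EFin mf p0 A0 B0 lB)).
rewrite lee_fin mulrDl mul1r.
have -> : A * B `^ p^-1 = 2 * a / c1 * B `^ p^-1 * N by rewrite /A; field; rewrite gt_eqF.
by rewrite lerDl ltW.
Qed.

Section sigma_finite_pack.
Context d (T : measurableType d) (R : realType) (mu : {measure set T -> \bar R}).
Hypothesis sf : sigma_finite setT mu.

Let nu : set T -> \bar R := mu.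

HB.instance Definition _ := Measure.on nu.
HB.instance Definition _ := Measure_isSigmaFinite.Build _ _ _ nu sf.

(** Tonelli's theorem is applied to bundled sigma-finite measures, whereas a Lebesgue measure is
    given as a bare one; cubes supply the sigma-finiteness. *)
Lemma sigma_finite_pack : exists nu : {sigma_finite_measure set T -> \bar R}, mu = nu.
Proof. by exists nu; exact: eq_measure. Qed.

End sigma_finite_pack.

Lemma euclid_ge (R : realType) (T : Type) n (G : 'I_n -> T -> R) i z : `|G i z| <= euclid G z.
Proof.
rewrite /euclid -sqrtr_sqr ler_wsqrtr// (bigD1 i)//= lerDl sumr_ge0// => j _.
exact: sqr_ge0.
Qed.

Lemma src_le_euclid (R : realType) n (G S : 'I_n -> Rspace R (1 + n + n) -> R) z :
  src G S z <= n%:R * (euclid G z + euclid S z).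
Proof.
apply: (@le_trans _ _ (\sum_(i < n) (euclid G z + euclid S z))).
  by apply: ler_sum => i _; apply: lerD; exact: euclid_ge.
by rewrite sumr_const card_ord mulr_natl.
Qed.

Lemma measurable_euclid d (T : measurableType d) (R : realType) n (G : 'I_n -> T -> R) :
  (forall i, measurable_fun setT (G i)) -> measurable_fun setT (euclid G).
Proof.
move=> mG; apply: (measurableT_comp (f := @Num.sqrt R)).
  by apply: continuous_measurable_fun; exact: sqrt_continuous.
by apply: measurable_sum => i; exact: measurable_funX.
Qed.

Theorem mainTheorem4 (R : realType) (n : nat) (hn : (0 < n)%N) :
  exists C : R, 0 < C /\
  forall (mu : {measure set (Rspace R (1 + n + n)) -> \bar R}),
    is_lebesgue mu ->
  forall (f : Rspace R (1 + n + n) -> R)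
         (G S : 'I_n -> Rspace R (1 + n + n) -> R),
    L2 mu f ->
    (forall i, L2 mu (G i)) ->
    (forall i, weak_pd mu (vidx i) f (G i)) ->
    (forall i, L2 mu (S i)) ->
    kinetic_eq mu f S ->
    (Lnorm mu (2 * (1 + (2 * n%:R)^-1))%:E (EFin \o f)
     <= C%:E * (Lnorm mu 2%:E (EFin \o euclid G)
                + Lnorm mu 2%:E (EFin \o euclid S)))%E.
Proof.
have [D D0 HD] := kinetic_sobolev_sfinite R hn.
have nR : 0 < n%:R :> R by rewrite ltr0n.
(* The factor $2n$ comes from $F\le n(|G|+|S|)$ and $(a+b)^2\le2(a^2+b^2)$, followed by
   $2(x^2+y^2)\le4(x+y)^2$ for the norms. *)
exists (D * (2 * n%:R)); split; first by rewrite !mulr_gt0.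
move=> mu Lmu f G S Lf LG WG LS KE.
have KD := KineticData Lmu Lf LG WG LS KE.
set XG := Lnorm mu 2%:E (EFin \o euclid G); set XS := Lnorm mu 2%:E (EFin \o euclid S).
have XG0 : (0 <= XG)%E by exact: Lnorm_ge0.
have XS0 : (0 <= XS)%E by exact: Lnorm_ge0.
have [nu E] := sigma_finite_pack (lebesgue_sigma_finite Lmu).
have [xoo|xfin] := eqVneq (XG + XS)%E +oo%E.
  by rewrite xoo gt0_muley ?leey// lte_fin !mulr_gt0.
have XGf : XG \is a fin_num.
  by rewrite ge0_fin_numE// ltey; apply: contra xfin => /eqP ->; rewrite addye// gt_eqF// (lt_le_trans _ XS0).
have XSf : XS \is a fin_num.
  by rewrite ge0_fin_numE// ltey; apply: contra xfin => /eqP ->; rewrite addey// gt_eqF// (lt_le_trans _ XG0).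
rewrite -(fineK XGf) -(fineK XSf) -EFinD -EFinM.
set xg := fine XG; set xs := fine XS.
have xg0 : 0 <= xg by exact: fine_ge0.
have xs0 : 0 <= xs by exact: fine_ge0.
have mG := measurable_euclid (fun i => L2_measurable (LG i)).
have mS := measurable_euclid (fun i => L2_measurable (LS i)).
have srcN : (\int[mu]_z ((src G S z) ^+ 2)%:E <= ((2 * n%:R * (xg + xs)) ^+ 2)%:E)%E.
  apply: (@le_trans _ _ (\int[mu]_z (2 * n%:R ^+ 2 * ((euclid G z) ^+ 2 + (euclid S z) ^+ 2))%:E)%E).
    apply: le_integral_EFin.
    - by apply: measurable_funX; exact: measurable_src KD.
    - apply: measurable_funM => //; apply: measurable_funD; exact: measurable_funX.
    move=> z; rewrite sqr_ge0/=.
    have eG : 0 <= euclid G z by exact: sqrtr_ge0.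
    have eS : 0 <= euclid S z by exact: sqrtr_ge0.
    apply: (@le_trans _ _ ((n%:R * (euclid G z + euclid S z)) ^+ 2)).
      by rewrite ler_sqr ?nnegrE ?src_ge0// ?src_le_euclid// mulr_ge0// addr_ge0.
    rewrite exprMn [leRHS](_ : _ = n%:R ^+ 2 * (2 * (euclid G z ^+ 2 + euclid S z ^+ 2))); last by ring.
    rewrite ler_wpM2l ?sqr_ge0//.
    by have := sqr_ge0 (euclid G z - euclid S z); nra.
  rewrite integralZ_EFin; [|by rewrite mulr_ge0// sqr_ge0|by apply: measurable_funD; exact: measurable_funX|
    by move=> z; rewrite addr_ge0// sqr_ge0].
  rewrite integralD_EFin; [|exact: measurable_funX|exact: measurable_funX|
    by move=> z; exact: sqr_ge0|by move=> z; exact: sqr_ge0].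
  rewrite !Lnorm2_sqr -/XG -/XS -(fineK XGf) -(fineK XSf) -/xg -/xs -!EFin_expe -EFinD -EFinM lee_fin.
  have -> : (2 * n%:R * (xg + xs)) ^+ 2 = (2 * n%:R ^+ 2) * (2 * (xg + xs) ^+ 2) by ring.
  by rewrite ler_wpM2l ?mulr_ge0 ?sqr_ge0//; nra.
apply/lee_addgt0Pr => e e0.
(* Adding [e / D] makes the bound [N] positive even if both norms vanish, and costs exactly [e] in
   the conclusion. *)
have e1 : 0 < e / D by rewrite divr_gt0.
have N0 : 0 < 2 * n%:R * (xg + xs) + e / D by rewrite ltr_wpDl// !mulr_ge0// addr_ge0.
have HM N : 0 < N -> (\int[mu]_z ((src G S z) ^+ 2)%:E <= (N ^+ 2)%:E)%E ->
    (Lnorm mu (2 * (1 + (2 * n%:R)^-1))%:E (EFin \o f) <= (D * N)%:E)%E.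
  by move: KD; rewrite E; exact: HD.
apply: (le_trans (HM _ N0 _)).
  apply: (le_trans srcN); rewrite lee_fin ler_sqr ?nnegrE ?(ltW N0)//.
    by rewrite lerDl ltW.
  by rewrite !mulr_ge0// addr_ge0.
rewrite -EFinD lee_fin le_eqVlt; apply/orP; left; apply/eqP.
by field; rewrite gt_eqF.
Qed.
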